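(* Let $\Omega\subset\mathbb R^2$ be a domain and let $\rho_{(F_1,V_1)}$ and $\rho_{(F_2,V_2)}$ be two conformal capacitary metrics on $\Omega$. Then the metric spaces $(H_\rho,\rho_{(F_1,V_1)})$ and $(H_\rho,\rho_{(F_2,V_2)})$ are quasi-isometric. That is, there exists a constant $0<K<\infty$ such that $$\frac1K\rho_{(F_2,V_2)}(x,y)\le\rho_{(F_1,V_1)}(x,y)\le K\rho_{(F_2,V_2)}(x,y)\quad\text{for all }x,y\in H_\rho.$$
   Context: For disjoint sets $F_0,F_1\subset\Omega$, the conformal capacity is $\mathrm{cap}(F_0,F_1;\Omega)=\inf\int_\Omega|\nabla v|^2dx$, where the infimum is over nonnegative $v\in C(\Omega)$ with square integrable weak gradient, $v=0$ in a neighborhood of $F_0$, and $v\ge1$ in a neighborhood of $F_1$. A conformal capacitary metric is determined by a pair $(F,V)$, where $F\subset\Omega$ is a continuum and $V$ is a domain with $F\subset V\subset\overline V\subset\Omega$, $\overline V$ compact, and $\partial V$ the image of the unit circle under a quasiconformal homeomorphism of $\mathbb R^2$. For $x,y\in\Omega$, $$\rho_{(F,V)}(x,y)=\inf_{l(x,y)}\big\{\mathrm{cap}^{1/2}(F,l(x,y)\setminus V;\Omega)+\mathrm{cap}^{1/2}(\partial\Omega,l(x,y)\cap V;\Omega)\big\},$$ where the infimum is over rectifiable curves $l(x,y)$ in $\Omega$ joining $x$ and $y$. The conformal capacitary boundary is $H_\rho=\widetilde\Omega_\rho\setminus\Omega$, where $\widetilde\Omega_\rho$ is the metric completion of $(\Omega,\rho)$;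 its points are equivalence classes of $\rho$-Cauchy sequences in $\Omega$. The two metrics are comparable on $\Omega$, so they have the same Cauchy sequences, and $H_\rho$ is the same set for both. The metrics are extended to $H_\rho$ by limits. *)

(* Defs.v *)
(* The plane R^2 is modelled as R * R
   (R : realType); its topology is the product topology (= Euclidean).
   Distances below are written explicitly with the Euclidean norm. *)
From HB Require Import structures.
From mathcomp Require Import all_boot all_order all_algebra.
From mathcomp Require Import all_classical all_reals all_analysis.
Set Implicit Arguments. Unset Strict Implicit. Unset Printing Implicit Defensive.
Import Order.TTheory GRing.Theory Num.Theory.
Import numFieldNormedType.Exports.
Local Open Scope classical_set_scope.
Local Open Scope ring_scope.

Section ConfCap.
Variable R : realType.
Notation P2 := (R * R)%type.

Definition edist2 (x y : P2) : R :=
  Num.sqrt ((x.1 - y.1) ^+ 2 + (x.2 - y.2) ^+ 2).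

Definition leb2 := ((@lebesgue_measure R) \x (@lebesgue_measure R))%E.

Definition domain (O : set P2) := open O /\ connected O /\ O !=set0.

Definition boundary (A : set P2) := closure A `\` interior A.

Definition continuum (F : set P2) :=
  compact F /\ connected F /\ exists a b, F a /\ F b /\ a <> b.

Fixpoint iter_dir (s : seq P2) (f : P2 -> R) : P2 -> R :=
  match s with
  | [::] => f
  | v :: s' => fun x => 'D_v (iter_dir s' f) x
  end.

Definition smooth (f : P2 -> R) :=
  forall s : seq P2, continuous (iter_dir s f) /\
    forall (x v : P2), derivable (iter_dir s f) x v.

Definition test_fun (O : set P2) (phi : P2 -> R) :=
  smooth phi /\ exists K, compact K /\ K `<=` O /\ forall x, ~ K x -> phi x = 0.

Definition locally_integrable (O : set P2) (f : P2 -> R) :=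
  measurable_fun O f /\
  forall K, compact K -> K `<=` O -> leb2.-integrable K (EFin \o f).

Definition weak_gradient (O : set P2) (v g1 g2 : P2 -> R) :=
  locally_integrable O v /\ locally_integrable O g1 /\ locally_integrable O g2 /\
  forall phi, test_fun O phi ->
    (\int[leb2]_(x in O) (v x * 'D_(1, 0) phi x)%:E =
       - \int[leb2]_(x in O) (g1 x * phi x)%:E)%E /\
    (\int[leb2]_(x in O) (v x * 'D_(0, 1) phi x)%:E =
       - \int[leb2]_(x in O) (g2 x * phi x)%:E)%E.

Definition dirichlet (O : set P2) (g1 g2 : P2 -> R) : \bar R :=
  (\int[leb2]_(x in O) ((g1 x) ^+ 2 + (g2 x) ^+ 2)%:E)%E.

Definition cap_admissible (F0 F1 O : set P2) (v g1 g2 : P2 -> R) :=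
  {within O, continuous v} /\ (forall x, O x -> 0 <= v x) /\
  weak_gradient O v g1 g2 /\ (dirichlet O g1 g2 < +oo)%E /\
  (exists U, open U /\ F0 `<=` U /\ forall x, U x -> O x -> v x = 0) /\
  (exists U, open U /\ F1 `<=` U /\ forall x, U x -> O x -> 1 <= v x).

Definition cap (F0 F1 O : set P2) : R :=
  inf [set r | exists v g1 g2, cap_admissible F0 F1 O v g1 g2 /\
                               r = fine (dirichlet O g1 g2)].

Definition circle (x : P2) (r : R) := [set y | edist2 y x = r].
Definition Lmax (f : P2 -> P2) x r := sup [set edist2 (f y) (f x) | y in circle x r].
Definition Lmin (f : P2 -> P2) x r := inf [set edist2 (f y) (f x) | y in circle x r].

Definition homeomorphism (f : P2 -> P2) :=
  exists g, cancel f g /\ cancel g f /\ continuous f /\ continuous g.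

Definition quasiconformal (f : P2 -> P2) :=
  homeomorphism f /\
  exists H : R, forall x, \forall r \near 0^'+, Lmax f x r <= H * Lmin f x r.

Definition unit_circle : set P2 := [set x | x.1 ^+ 2 + x.2 ^+ 2 = 1].

Definition cap_pair (O F V : set P2) :=
  continuum F /\ F `<=` O /\ domain V /\ F `<=` V /\
  compact (closure V) /\ closure V `<=` O /\
  exists f, quasiconformal f /\ boundary V = f @` unit_circle.

Definition I01 : set R := [set t | 0 <= t <= 1].

Definition rect_curve (O : set P2) (x y : P2) (c : R -> P2) :=
  {within I01, continuous c} /\ c 0 = x /\ c 1 = y /\ c @` I01 `<=` O /\
  exists M : R, forall (n : nat) (t : nat -> R),
    0 <= t 0%N -> t n <= 1 -> (forall i, (i < n)%N -> t i <= t i.+1) ->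
    \sum_(i < n) edist2 (c (t i.+1)) (c (t i)) <= M.

Definition rho (O F V : set P2) (x y : P2) : R :=
  inf [set Num.sqrt (cap F (l `\` V) O) + Num.sqrt (cap (boundary O) (l `&` V) O)
      | l in [set l | exists c, rect_curve O x y c /\ l = c @` I01]].

Definition rho_cauchy (O F V : set P2) (x : nat -> P2) :=
  (forall n, O (x n)) /\
  forall e : R, 0 < e -> exists N, forall m n, (N <= m)%N -> (N <= n)%N ->
    rho O F V (x m) (x n) < e.

(* a representative of a point of H_rho = completion \ O: a rho-Cauchy
   sequence whose class is not that of a (constant sequence at a) point of O *)
Definition boundary_seq (O F V : set P2) (x : nat -> P2) :=
  rho_cauchy O F V x /\
  ~ (exists a, O a /\ (fun n => rho O F V (x n) a) @ \oo --> (0 : R)).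

End ConfCap.

(* Main.v *)
Require Import Defs.
From HB Require Import structures.
From mathcomp Require Import all_boot all_order all_algebra.
From mathcomp Require Import all_classical all_reals all_analysis.
From mathcomp Require Import measurable_realfun.
From mathcomp Require Import ring lra.
Import Order.TTheory GRing.Theory Num.Theory.
Import numFieldNormedType.Exports.
Local Open Scope classical_set_scope.
Local Open Scope ring_scope.
Set Implicit Arguments. Unset Strict Implicit. Unset Printing Implicit Defensive.

(* Both metrics are infima of a functional of curves, so it suffices to compare
   the two functionals on a curve l that starts outside a compact set W; this is
   enough because a sequence representing a boundary point leaves every compact
   subset of O. Let theta be a cutoff equal to 1 near the closures of V1 and V2,
   with support S in the interior of W.
   If l misses S, only the terms cap(F1, l) and cap(F2, l) survive; for v
   admissible for F2, the function (1 - theta) v is admissible for F1, and its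
   energy is controlled by that of v through a Poincare inequality on S for
   functions vanishing on F2.
   If l meets S, it crosses a rectangle of fixed size inside W. Admissible
   functions are absolutely continuous on almost every line, so this crossing
   and the Poincare inequality bound cap(F2, l \ V2) from below, while the
   functional of (F1, V1) is bounded from above.
   The Poincare inequality holds on some box centred on F2, because a
   coordinate projection of the nondegenerate continuum F2 contains an
   interval, and it propagates from box to box since O is connected. *)

(** * Smooth functions *)

(** An admissible v is prescribed only on neighbourhoods of F2 and of l whose size is not
    controlled, so integrals over the plane do not see these conditions with a uniform constant.
    Lines do: a nondegenerate continuum, or a curve that crosses a box, meets a family of parallel
    lines of positive measure, and on almost each of them the oscillation of v is bounded by the
    integral of a partial derivative. Hence the conversion of the weak gradient into absolute
    continuity on lines, by testing against products of functions of one variable. The energy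
    controls the gradient of v but not v itself, while the gradient of (1 - theta) v contains the
    term v grad theta. That term lives on S, so an L2 bound on S is all that is missing in the first
    case. The start of l outside W leaves room for a box of fixed radius between S and the
    complement of W: a curve that reaches S has crossed such a box while still outside V2. Then the
    ratio of a uniform upper bound to a uniform lower bound is enough. *)

Section Smooth.
Context {R : realType}.

Section Cn.
Context {V : normedModType R}.

(* For all n this is [smooth] (lemma [CnP]); the recursion on the order, with
   no reference to lists of directions, is what makes products and inverses easy. *)
Fixpoint Cn (n : nat) (f : V -> R) : Prop :=
  continuous f /\
  if n is m.+1 then (forall x v, derivable f x v) /\ forall v, Cn m ('D_v f)
  else True.

Lemma Cn_continuous n f : Cn n f -> continuous f.
Proof. by case: n => [|n] []. Qed.

Lemma CnW n f : Cn n.+1 f -> Cn n f.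
Proof.
elim: n f => [|n IH] f [cf [df Df]]; split => //; split => // v.
by apply: IH; apply: Df.
Qed.

Lemma Cn_cst n (k : R) : Cn n (cst k).
Proof.
elim: n k => [|n IH] k; split=> //; try exact: cst_continuous.
split=> [x v|v]; first exact: derivable_cst.
by rewrite (_ : 'D_v (cst k) = cst 0)//; apply/funext => x; rewrite derive_cst.
Qed.

Lemma CnD n f g : Cn n f -> Cn n g -> Cn n (f \+ g).
Proof.
elim: n f g => [|n IH] f g [cf Hf] [cg Hg]; split=> //;
  try by move=> x; apply: continuousD; [exact: cf|exact: cg].
case: Hf => df Df; case: Hg => dg Dg; split=> [x v|v].
  exact: derivableD.
rewrite (_ : 'D_v (f \+ g) = 'D_v f \+ 'D_v g).
  by apply: IH; [exact: Df|exact: Dg].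
by apply/funext => x; rewrite deriveD.
Qed.

Lemma CnM n f g : Cn n f -> Cn n g -> Cn n (f \* g).
Proof.
elim: n f g => [|n IH] f g Hf0 Hg0;
  have [cf Hf] := Hf0; have [cg Hg] := Hg0; split=> //;
  try by move=> x; apply: continuousM; [exact: cf|exact: cg].
case: Hf => df Df; case: Hg => dg Dg; split=> [x v|v].
  exact: derivableM.
rewrite (_ : 'D_v (f \* g) = (f \* 'D_v g) \+ (g \* 'D_v f)).
  by apply: CnD; (apply: IH; [exact: CnW|]); [exact: Dg|exact: Df].
by apply/funext => x; rewrite deriveM.
Qed.

Lemma CnN n f : Cn n f -> Cn n (\- f).
Proof.
move=> Hf; have -> : \- f = cst (-1) \* f by apply/funext => x /=; rewrite mulN1r.
by apply: CnM => //; exact: Cn_cst.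
Qed.

Lemma CnV n f : (forall x, f x != 0) -> Cn n f -> Cn n (fun x => (f x)^-1).
Proof.
move=> f0; elim: n f f0 => [|n IH] f f0 Hf0; have [cf Hf] := Hf0; split=> //;
  try by move=> x; apply: continuousV => //; exact: cf.
case: Hf => df Df; split=> [x v|v]; first exact: derivableV.
rewrite (_ : 'D_v _ =
  (\- ((fun x => (f x)^-1) \* (fun x => (f x)^-1))) \* 'D_v f).
  apply: CnM; [apply: CnN|exact: Df].
  by apply: CnM; (apply: IH; [by []|exact: CnW]).
by apply/funext => x; rewrite deriveV //= expr2 invfM.
Qed.

Lemma Cn_sum n (I : Type) (r : seq I) (F : I -> V -> R) :
  (forall i, Cn n (F i)) -> Cn n (fun x => \sum_(i <- r) F i x).
Proof.
move=> HF; elim: r => [|i r IH].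
  rewrite (_ : (fun _ => _) = cst 0); first exact: Cn_cst.
  by apply/funext => x; rewrite big_nil.
rewrite (_ : (fun _ => _) = F i \+ (fun x => \sum_(i <- r) F i x)).
  exact: CnD.
by apply/funext => x; rewrite big_cons.
Qed.

Lemma derive_line (f : V -> R) (x v : V) :
  'D_v f x = 'D_1 (fun h : R => f (h *: v + x)) 0.
Proof.
rewrite /derive; set g1 := fun h => h^-1 *: _; set g2 := fun h => h^-1 *: _.
suff -> : g1 = g2 by [].
by rewrite funeqE /g1 /g2 => h /=; rewrite addr0 scale0r add0r [_%:A]mulr1.
Qed.

(** Only the derivative of [G] in the direction [v] is available, so the chain rule is taken along
    the line through [x] in that direction, where it is the rule in one variable. *)
Lemma is_derive_comp_dir (h : R -> R) (G : V -> R) (x v : V) (h' : R) :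
  is_derive (G x) 1 h h' -> derivable G x v ->
  is_derive x v (h \o G) (h' * 'D_v G x).
Proof.
move=> dh dG.
have dG1 : is_derive (0 : R) 1 (fun t : R => G (t *: v + x)) ('D_v G x).
  by have /derivable1P dd := dG; apply: DeriveDef; [exact: dd|rewrite derive_line].
have dc : is_derive (0 : R) 1 (h \o (fun t : R => G (t *: v + x))) (h' * 'D_v G x).
  by apply: is_derive1_comp; rewrite scale0r add0r.
apply: DeriveDef; first by apply/derivable1P; case: dc.
by rewrite derive_line; case: dc.
Qed.

(** A function of one variable with all its derivatives: the derivative of [d k \o G] involves
    [d k.+1 \o G], so composition is an induction on the order with [k] generalised. *)
Definition jet (d : nat -> R -> R) := forall n (x : R), is_derive x 1 (d n) (d n.+1 x).

Lemma Cn_jet n d k G : jet d -> Cn n G -> Cn n (d k \o G).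
Proof.
move=> jd; elim: n k G => [|n IH] k G HG; have [cG HG'] := HG.
all: have cd : continuous (d k \o G).
1,3: move=> x; apply: continuous_comp; first exact: cG.
1,2: by apply: differentiable_continuous; apply/derivable1_diffP; case: (jd k (G x)).
- by split.
case: HG' => dG DG; split => //; split => [x v|v].
  by apply: ex_derive; apply: is_derive_comp_dir => //; exact: jd.
rewrite (_ : 'D_v _ = (d k.+1 \o G) \* 'D_v G).
  by apply: CnM; [apply: IH; exact: CnW|exact: DG].
apply/funext => x; apply: (@derive_val); apply: is_derive_comp_dir => //; exact: jd.
Qed.

End Cn.

(** [iter_dir] applies the head of the list last, whereas [Cn] peels off the innermost derivative;
    one direction is therefore an induction on the last element of the list. *)
Lemma CnP (f : R * R -> R) : (forall n, Cn n f) <-> smooth f.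
Proof.
split=> [Hf s|].
  elim/last_ind: s f Hf => [|s v IH] f Hf.
    by have [? []] := Hf 1%N.
  have -> : iter_dir (rcons s v) f = iter_dir s ('D_v f).
    by elim: (s) => //= w s' ->.
  by apply: IH => n; have [_ [_]] := Hf n.+1; exact.
move=> Hf n; elim: n f Hf => [|n IH] f Hf.
  by split=> //; exact: (Hf [::]).1.
split; first exact: (Hf [::]).1.
split=> [x v|v]; first exact: (Hf [::]).2.
apply: IH => s.
have -> : iter_dir s ('D_v f) = iter_dir (rcons s v) f.
  by elim: (s) => //= w s' ->.
exact: Hf.
Qed.

Lemma Cn_fstc n (h : R -> R) : Cn n h -> Cn n (fun z : R * R => h z.1).
Proof.
elim: n h => [|n IH] h [ch H]; split.
1,3: by move=> x; apply: continuous_comp; [exact: cvg_fst|exact: ch].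
- by [].
case: H => dh Dh; split=> [x v|v]; first exact: (dh x.1 v.1).
have -> : 'D_v (fun z : R * R => h z.1) = fun z => 'D_(v.1) h z.1 by [].
exact: (IH _ (Dh v.1)).
Qed.

Lemma Cn_sndc n (h : R -> R) : Cn n h -> Cn n (fun z : R * R => h z.2).
Proof.
elim: n h => [|n IH] h [ch H]; split.
1,3: by move=> x; apply: continuous_comp; [exact: cvg_snd|exact: ch].
- by [].
case: H => dh Dh; split=> [x v|v]; first exact: (dh x.2 v.2).
have -> : 'D_v (fun z : R * R => h z.2) = fun z => 'D_(v.2) h z.2 by [].
exact: (IH _ (Dh v.2)).
Qed.

Lemma Cn_id n : Cn n (id : R -> R).
Proof.
case: n => [|n]; split => //; try by move=> x; exact: cvg_id.
split=> [x v|v]; first exact: derivable_id.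
rewrite (_ : 'D_v _ = cst v); first exact: Cn_cst.
by apply/funext => x; rewrite derive_id.
Qed.

(* p(1/t) exp(-1/t) for t > 0: this family is stable under derivation. *)
Definition flat (p : {poly R}) (t : R) : R :=
  if 0 < t then p.[t^-1] * expR (- t^-1) else 0.

(** With s = 1/t, the bound exp s >= s^(i+1) / (i+1)! gives s^i exp(-s) <= (i+1)! t, and the
    constant is summed over the coefficients of [p]. *)
Lemma flat_bound p : exists2 C : R, 0 <= C & forall t, `|flat p t| <= C * `|t|.
Proof.
exists (\sum_(i < size p) `|p`_i| * (i.+1)`!%:R).
  by apply: sumr_ge0 => i _; rewrite mulr_ge0.
move=> t; rewrite /flat; case: ifPn => [t0|_]; last first.
  by rewrite normr0 mulr_ge0// sumr_ge0// => i _; rewrite mulr_ge0.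
rewrite horner_coef mulr_suml mulr_suml.
apply: (le_trans (ler_norm_sum _ _ _)); apply: ler_sum => i _.
rewrite -mulrA normrM -mulrA ler_wpM2l//.
have s0 : 0 < t^-1 by rewrite invr_gt0.
rewrite ger0_norm; last by rewrite mulr_ge0 ?expR_ge0// exprn_ge0 ?ltW.
rewrite (gtr0_norm t0) expRN -ler_pdivrMr// -[X in _ / X]invrK invrK.
rewrite mulrAC ler_pdivrMr ?expR_gt0// -exprSr.
have := expR_ge1Dxn i (ltW s0).
move=> H; have {}H : t^-1 ^+ i.+1 / (i.+1)`!%:R <= expR t^-1.
  by apply: le_trans H; rewrite lerDr.
by rewrite mulrC -ler_pdivrMr// ltr0n fact_gt0.
Qed.

Lemma flat_deriv p (x : R) :
  is_derive x 1 (flat p) (flat ((p - p^`()) * 'X^2) x).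
Proof.
have [x0|x0|x0] := ltrgtP x 0.
- rewrite {2}/flat ltNge (ltW x0) /=.
  have d0 : is_derive x 1 (cst 0 : R -> R) (0 : R) by exact: is_derive_cst.
  apply: near_eq_is_derive d0.
  near=> t; rewrite /flat ifN// -leNgt ltW//; near: t; exact: lt_nbhsl.
- rewrite {2}/flat x0.
  have dV : is_derive x 1 (fun t : R => t^-1) (- x ^- 2).
    by have := @is_deriveV R id x 1 1 (lt0r_neq0 x0) (is_derive_id _ _); rewrite /GRing.scale/= mulr1.
  have d1 : is_derive x 1 (fun t : R => p.[t^-1]) (p^`().[x^-1] * - x ^- 2).
    by apply: (is_derive1_comp (f := horner p)).
  have d2 : is_derive x 1 (fun t : R => expR (- t^-1)) (expR (- x^-1) * x ^- 2).
    have dN : is_derive x 1 (fun t : R => - t^-1) (x ^- 2).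
      by have := is_deriveN dV; rewrite opprK.
    exact: (is_derive1_comp (f := expR)).
  have dM := is_deriveM d1 d2.
  have dF : is_derive x 1 (flat p) (p.[x^-1] *: (expR (- x^-1) * x ^- 2) +
      expR (- x^-1) *: (p^`().[x^-1] * - x ^- 2)).
    apply: near_eq_is_derive dM.
    near=> t; rewrite /flat ifT//; near: t; exact: lt_nbhsr.
  apply: is_derive_eq dF _; rewrite /GRing.scale/= hornerM hornerXn hornerD hornerN; field; by rewrite gt_eqF.
(* At 0 the difference quotient of [flat p] is [flat (p * 'X)], which tends to 0 by the linear
   bound. *)
- subst x; have cv : flat (p * 'X) t @[t --> (0 : R)^'] --> (0 : R).
    have [C C0 HC] := flat_bound (p * 'X).
    apply/cvgr0Pnorm_lt => e e0; near=> t.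
    apply: (le_lt_trans (HC t)).
    have : `|t| < e / (C + 1).
      near: t; apply: dnbhs0_lt; by rewrite divr_gt0// ltr_wpDl.
    rewrite ltr_pdivlMr ?ltr_wpDl// => H.
    apply: le_lt_trans H; rewrite mulrC ler_wpM2l// lerDl//.
  have E : (fun h : R => h^-1 *: ((flat p \o shift 0) (h *: (1:R)) - flat p 0)) =
     flat (p * 'X).
    apply/funext => h /=; rewrite addr0 /GRing.scale/= mulr1 /flat ltxx subr0.
    by case: ifP; rewrite ?mulr0// hornerMX => _; rewrite mulrCA mulrA.
  apply: DeriveDef.
    by rewrite /derivable E; apply/cvg_ex; exists 0.
  rewrite /derive E {2}/flat ltxx; exact: cvg_lim.
Unshelve. all: by end_near. Qed.

Definition flat_jet (n : nat) : R -> R :=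
  flat (iter n (fun p => (p - p^`()) * 'X^2) 1).

Lemma jet_flat : jet flat_jet.
Proof. by move=> n x; apply: flat_deriv. Qed.

Lemma flat0_gt0 t : 0 < t -> 0 < flat_jet 0 t.
Proof. by move=> t0; rewrite /flat_jet/= /flat t0 hornerC mul1r expR_gt0. Qed.

Lemma flat0_le0 t : t <= 0 -> flat_jet 0 t = 0.
Proof. by move=> t0; rewrite /flat_jet/= /flat ltNge t0. Qed.

Lemma flat0_ge0 t : 0 <= flat_jet 0 t.
Proof. by have [/flat0_gt0/ltW//|/flat0_le0->] := ltP 0 t. Qed.

Definition step (t : R) : R :=
  flat_jet 0 t / (flat_jet 0 t + flat_jet 0 (1 - t)).

Lemma step_den t : 0 < flat_jet 0 t + flat_jet 0 (1 - t).
Proof.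
have [t0|t0] := ltP 0 t; first by rewrite ltr_wpDr ?flat0_gt0 ?flat0_ge0.
by rewrite ltr_wpDl ?flat0_ge0// flat0_gt0// subr_gt0 (le_lt_trans t0).
Qed.

Lemma step_ge0 t : 0 <= step t.
Proof. by rewrite divr_ge0 ?flat0_ge0// ltW// step_den. Qed.

Lemma step_le1 t : step t <= 1.
Proof. by rewrite ler_pdivrMr ?step_den// mul1r lerDl flat0_ge0. Qed.

Lemma step_le0 t : t <= 0 -> step t = 0.
Proof. by move=> t0; rewrite /step flat0_le0// mul0r. Qed.

Lemma step_ge1 t : 1 <= t -> step t = 1.
Proof.
move=> t1; rewrite /step (@flat0_le0 (1 - t)) ?subr_le0// addr0 divff//.
by rewrite gt_eqF// flat0_gt0// (lt_le_trans _ t1).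
Qed.

Lemma Cn_step (V : normedModType R) n (G : V -> R) :
  Cn n G -> Cn n (step \o G).
Proof.
move=> HG; rewrite (_ : step \o G = (flat_jet 0 \o G) \*
  (fun x => (((flat_jet 0 \o G) \+ (flat_jet 0 \o (cst 1 \+ (\- G)))) x)^-1))//.
have H1 : Cn n (flat_jet 0 \o G) by apply: Cn_jet; [exact: jet_flat|].
apply: CnM => //; apply: CnV; first by move=> x; rewrite gt_eqF// step_den.
apply: CnD => //; apply: Cn_jet; first exact: jet_flat.
by apply: CnD; [exact: Cn_cst|exact: CnN].
Qed.

End Smooth.

(** * Boxes, finite covers and smooth cutoff functions *)

Section Cutoff.
Context {R : realType}.
Notation P2 := (R * R)%type.

Lemma compact_closed2 (K : set P2) : compact K -> closed K.
Proof. by apply: compact_closed; exact: norm_hausdorff. Qed.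

(** A closed ball of the sup norm, the norm of the product. Being a product of segments, it suits
    Fubini arguments. *)
Definition box (c : P2) (r : R) : set P2 :=
  `[c.1 - r, c.1 + r] `*` `[c.2 - r, c.2 + r].

Lemma boxP (c : P2) (r : R) (z : P2) :
  box c r z <-> (`|z.1 - c.1| <= r /\ `|z.2 - c.2| <= r).
Proof.
by rewrite /box /= !in_itv /= !ler_distl.
Qed.

Lemma ballP2 (c : P2) (r : R) (z : P2) :
  ball c r z <-> (`|z.1 - c.1| < r /\ `|z.2 - c.2| < r).
Proof.
rewrite (distrC z.1) (distrC z.2); split => [[/= h1 h2]|[h1 h2]]; split => //.
Qed.

Lemma box_compact c r : compact (box c r).
Proof. by apply: compact_setX; exact: segment_compact. Qed.

Lemma ball_box c r : ball c r `<=` box c r.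
Proof. by move=> z /ballP2[h1 h2]; apply/boxP; split; exact: ltW. Qed.

Lemma box_ball c r s : r < s -> box c r `<=` ball c s.
Proof.
by move=> rs z /boxP[h1 h2]; apply/ballP2; split; exact: le_lt_trans rs.
Qed.

Lemma open_box (U : set P2) c : open U -> U c -> exists2 r, 0 < r & box c r `<=` U.
Proof.
move=> oU Uc; have /nbhs_ballP[r /= r0 H] : nbhs c U by exact: open_nbhs_nbhs.
exists (r / 2); first by rewrite divr_gt0.
apply: subset_trans H; apply: box_ball.
by rewrite ltr_pdivrMr// ltr_pMr// ltr1n.
Qed.

Lemma compact_box_cover (K : set P2) (r : P2 -> R) : compact K ->
  (forall c, K c -> 0 < r c) ->
  exists s : seq P2, (forall c, c \in s -> K c) /\
    forall z, K z -> exists2 c, c \in s & ball c (r c) z.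
Proof.
move=> cK0 r0; pose T : ptopologicalType := HB.pack P2 (Topological.on P2) (Pointed.on P2).
have cK : @compact T K := cK0.
move: cK; rewrite compact_cover => /(_ _ K (fun c => ball c (r c))).
case.
- by move=> c Kc; have [] := ball_open_nbhs c (r0 _ Kc).
- by move=> z Kz; exists z => //; apply: ballxx; exact: r0.
move=> D HD HK; exists (finmap.enum_fset D); split.
  by move=> c cD; have := HD c cD; rewrite inE.
by move=> z /HK[c /= cD zc]; exists c.
Qed.

Definition bump (c : P2) (r : R) (z : P2) : R :=
  flat_jet 0 (r ^+ 2 - (z.1 - c.1) ^+ 2) * flat_jet 0 (r ^+ 2 - (z.2 - c.2) ^+ 2).

Lemma bump_ge0 c r z : 0 <= bump c r z.
Proof. by rewrite mulr_ge0 ?flat0_ge0. Qed.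

Lemma bump_gt0 c r z : ball c r z -> 0 < bump c r z.
Proof.
move=> /ballP2[h1 h2]; rewrite mulr_gt0// flat0_gt0// subr_gt0.
  by rewrite -real_normK ?num_real// ltr_pXn2r// nnegrE ?(le_trans _ (ltW h1)).
by rewrite -real_normK ?num_real// ltr_pXn2r// nnegrE ?(le_trans _ (ltW h2)).
Qed.

Lemma bump_out c r z : 0 <= r -> ~ box c r z -> bump c r z = 0.
Proof.
move=> r0 h; rewrite /bump.
have [h1|h1] := leP `|z.1 - c.1| r.
  have [h2|h2] := leP `|z.2 - c.2| r; first by case: h; apply/boxP.
  rewrite [X in _ * X]flat0_le0 ?mulr0// subr_le0 -[leRHS]real_normK ?num_real//.
  by rewrite ler_pXn2r// ?nnegrE// ltW.
rewrite [X in X * _]flat0_le0 ?mul0r// subr_le0 -[leRHS]real_normK ?num_real//.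
by rewrite ler_pXn2r// ?nnegrE// ltW.
Qed.

Lemma Cn_bump n c r : Cn n (bump c r).
Proof.
have H (k : R) : Cn n (fun x : R => flat_jet 0 (r ^+ 2 - (x - k) ^+ 2)).
  apply: (@Cn_jet _ _ n flat_jet 0%N (fun x : R => r ^+ 2 - (x - k) ^+ 2)); first exact: jet_flat.
  have Hk : Cn n (fun x : R => x - k) by apply: CnD; [exact: Cn_id|exact: Cn_cst].
  by apply: CnD; [exact: Cn_cst|apply: CnN; exact: CnM].
apply: CnM.
  exact: (Cn_fstc (h := fun x => flat_jet 0 (r ^+ 2 - (x - c.1) ^+ 2))).
exact: (Cn_sndc (h := fun x => flat_jet 0 (r ^+ 2 - (x - c.2) ^+ 2))).
Qed.

(** A sum of bumps over a finite cover is positive on [K], hence has a positive minimum [G m] there.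
    Composing [step] with 2 G / G m gives a function equal to 1 on the whole neighbourhood G > G m /
    2 of [K]; a neighbourhood is what admissibility for the capacity asks for. *)
Lemma cutoff (K U : set P2) : compact K -> open U -> K `<=` U ->
  exists eta : P2 -> R, exists S W : set P2,
    [/\ forall n, Cn n eta, forall z, 0 <= eta z <= 1,
        open W /\ K `<=` W /\ forall z, W z -> eta z = 1 &
        compact S /\ S `<=` U /\ forall z, ~ S z -> eta z = 0].
Proof.
move=> cK oU KU.
have [K0|/set0P K0] := eqVneq K set0.
  exists (cst 0), set0, set0; split.
  - by move=> n; exact: Cn_cst.
  - by move=> z; rewrite lexx ler01.
  - by split; [exact: open0|split; rewrite ?K0].
  - by split; [exact: compact0|split].
have /choice[r Hr] (c : P2) : exists r, K c -> 0 < r /\ box c r `<=` U.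
  have [Kc|nKc] := pselect (K c); last by exists 0.
  by have [r r0 H] := open_box oU (KU _ Kc); exists r.
have [s [sK sc]] := compact_box_cover cK (fun c Kc => (Hr c Kc).1).
pose G z := \sum_(c <- s) bump c (r c) z.
have CG n : Cn n G by apply: Cn_sum => c; exact: Cn_bump.
have G0 z : K z -> 0 < G z.
  move=> /sc[c cs zc]; rewrite /G (big_rem c)//=.
  by rewrite ltr_wpDr ?bump_gt0// sumr_ge0// => i _; exact: bump_ge0.
have [m Km Hm] : exists2 m, m \in K & forall t, t \in K -> G m <= G t.
  apply: compact_EVT_min => //.
  by apply: continuous_subspaceT; exact: Cn_continuous (CG 0%N).
have d0 : 0 < G m by apply: G0; rewrite -in_setE.
exists (fun z => step (2 / G m * G z)), (\big[setU/set0]_(c <- s) box c (r c)),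
  (G @^-1` [set x | G m / 2 < x]); split.
- by move=> n; apply: (Cn_step (G := fun z => 2 / G m * G z)); apply: CnM => //; exact: Cn_cst.
- by move=> z; rewrite step_ge0 step_le1.
- split; last split.
  + apply: open_comp; last exact: open_gt.
    by move=> z _; exact: Cn_continuous (CG 0%N) z.
  + move=> z Kz /=; have := Hm z; rewrite in_setE => /(_ Kz); apply: lt_le_trans.
    by rewrite ltr_pdivrMr// ltr_pMr// ltr1n.
  + move=> z /= Hz; apply: step_ge1.
    by rewrite mulrAC ler_pdivlMr// mul1r mulrC -ler_pdivrMr// ltW.
- split; last split.
  + by apply: bigsetU_compact => c _; exact: box_compact.
  + move=> z; rewrite -bigcup_seq => -[c /= cs]; exact: (Hr c (sK c cs)).2.
  + move=> z; rewrite -bigcup_seq => Sz; apply: step_le0.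
    suff -> : G z = 0 by rewrite mulr0.
    rewrite /G big_seq big1// => c cs; apply: bump_out.
      by apply: ltW; exact: (Hr c (sK c cs)).1.
    by move=> h; apply: Sz; exists c.
Qed.

End Cutoff.

(** * Integration on the plane *)

Section Measure2.
Context {R : realType}.
Notation P2 := (R * R)%type.
Notation mu := (@leb2 R).
Local Notation M2 := (measurableTypeR R * measurableTypeR R)%type.
Local Notation mset A := (@measurable _ M2 A).
Local Notation mfun D f := (@measurable_fun _ _ M2 _ D f).

Lemma box_measurable (c : P2) r : mset (box c r).
Proof. by apply: measurableX; exact: measurable_itv. Qed.

(** Openness refers to the product topology and measurability to the product sigma-algebra; the
    countable family of boxes with rational centre and radius links the two. *)
Lemma open_measurable2 (U : set P2) : open U -> mset U.
Proof.
move=> oU.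
pose B (q : rat * rat * rat) : set P2 := box (ratr q.1.1, ratr q.1.2) (ratr q.2).
pose F q : set P2 := if `[< B q `<=` U >] then B q else set0.
have -> : U = \bigcup_q F q.
  apply/seteqP; split => [z Uz|z [q _]]; last first.
    by rewrite /F; case: asboolP => // BU; exact: BU.
  have [r r0 zU] := open_box oU Uz.
  (* With a radius between r/4 and r/2 and a centre within r/4 of [z] in each coordinate, the
     rational box contains [z] and stays in the box of radius [r]. *)
  have r4 : r / 4 < r / 2 by rewrite ltr_pM2l// ltf_pV2 ?posrE// ltr_nat.
  have [q] := rat_in_itvoo r4; rewrite in_itv/= => /andP[q1 q2].
  have zlt (t : R) : t - r / 4 < t + r / 4.
    by rewrite ltrD2l gtrN// divr_gt0.
  have [a] := rat_in_itvoo (zlt z.1); rewrite in_itv/= => /andP[a1 a2].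
  have [b] := rat_in_itvoo (zlt z.2); rewrite in_itv/= => /andP[b1 b2].
  exists (a, b, q) => //; rewrite /F.
  have Ha : `|z.1 - ratr a| <= r / 4 by rewrite ler_distl; lra.
  have Hb : `|z.2 - ratr b| <= r / 4 by rewrite ler_distl; lra.
  case: asboolP => [_|]; first by apply/boxP => /=; lra.
  case; apply: subset_trans zU => w /boxP[/= w1 w2]; apply/boxP.
  rewrite !ler_distl in Ha Hb w1 w2 *; lra.
apply: (@countable_bigcupT_measurable _ M2); first exact: countableP.
move=> q; rewrite /F; case: asboolP => _; [exact: box_measurable|exact: measurable0].
Qed.

Lemma compact_measurable2 (K : set P2) : compact K -> mset K.
Proof.
move=> /compact_closed2 /closed_openC /open_measurable2 /measurableC.
by rewrite setCK.
Qed.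

Lemma leb2_rect (a b c d : R) : a <= b -> c <= d ->
  mu (`[a, b] `*` `[c, d]) = ((b - a) * (d - c))%:E.
Proof.
move=> ab cd; rewrite /leb2 product_measure1E//= !lebesgue_measure_itv/= !lte_fin.
move: ab cd; rewrite !le_eqVlt => /predU1P[->|->] /predU1P[->|->];
  rewrite ?ltxx ?subrr ?(mulr0, mul0r, mule0, mul0e)//.
Qed.

Lemma compact_box (K : set P2) : compact K -> exists2 M, 0 < M & K `<=` box 0 M.
Proof.
move=> /compact_bounded[M [Mr HM]]; exists (`|M| + 1); first by rewrite ltr_wpDl.
move=> z Kz; have /= := HM (`|M| + 1) _ z Kz.
rewrite ltr_pwDr ?ler_norm// => /(_ isT).
by rewrite prod_normE ge_max => /andP[h1 h2]; apply/boxP; rewrite /= !subr0.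
Qed.

Lemma compact_leb2 (K : set P2) : compact K -> (mu K < +oo)%E.
Proof.
move=> cK; have [M M0 KM] := compact_box cK.
apply: (@le_lt_trans _ _ (mu (box 0 M))).
  apply: le_measure => //; rewrite inE; first exact: compact_measurable2.
  exact: box_measurable.
by rewrite /box leb2_rect ?ltry//=; lra.
Qed.

Lemma cont_measurable2 (f : P2 -> R) : continuous f -> mfun setT f.
Proof.
move=> /continuousP cf; apply: (measurability _ (measurable_realfun.RGenOpens.measurableE R)).
move=> _ [_ [a [b ->] <-]]; rewrite setTI; apply: open_measurable2.
exact/cf/interval_open.
Qed.

Lemma cont_bounded (f : P2 -> R) (K : set P2) : compact K -> {within K, continuous f} ->
  exists2 M, 0 < M & forall z, K z -> `|f z| <= M.
Proof.
move=> cK cf; have /compact_bounded[M [Mr HM]] := continuous_compact cf cK.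
exists (`|M| + 1); first by rewrite ltr_wpDl.
move=> z Kz; apply: (HM (`|M| + 1)); last by exists z.
by rewrite ltr_pwDr// ler_norm.
Qed.

Lemma bounded_integrable (f : P2 -> R) (K : set P2) M : compact K -> mfun K f ->
  (forall z, K z -> `|f z| <= M) -> mu.-integrable K (EFin \o f).
Proof.
move=> cK mf fM; apply: measurable_bounded_integrable => //.
- exact: compact_measurable2.
- exact: compact_leb2.
- by exists M; split; rewrite ?num_real // => t Mt z Kz /=; rewrite (le_trans (fM z Kz))// ltW.
Qed.

Lemma cont_integrable (f : P2 -> R) (K : set P2) : compact K -> continuous f ->
  mu.-integrable K (EFin \o f).
Proof.
move=> cK cf.
have [M _ HM] := cont_bounded cK (continuous_subspaceT cf).
apply: bounded_integrable HM => //.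
by apply: measurable_funTS; exact: cont_measurable2.
Qed.

Lemma integral_support (f : P2 -> \bar R) (A B : set P2) : A `<=` B ->
  (forall z, B z -> ~ A z -> f z = 0%E) ->
  (\int[mu]_(z in B) f z = \int[mu]_(z in A) f z)%E.
Proof.
move=> AB f0; rewrite integral_mkcond [RHS]integral_mkcond.
congr (integral _ _ _); apply/funext => z; rewrite /patch.
have [/set_mem Bz|/negP nBz] := boolP (z \in B).
  by case: ifPn => // /negP nA; apply: f0 => // Az; apply: nA; rewrite inE.
by case: ifPn => // /set_mem /AB Bz; case: nBz; rewrite inE.
Qed.

Lemma integrable_support (f : P2 -> \bar R) (A B : set P2) : A `<=` B ->
  mset A -> mset B ->
  (forall z, B z -> ~ A z -> f z = 0%E) ->
  mu.-integrable A f -> mu.-integrable B f.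
Proof.
move=> AB mA mB f0 iA.
apply: (proj2 (@integrable_mkcond _ _ _ mu B f mB)).
move: iA => /(proj1 (@integrable_mkcond _ _ _ mu A f mA)).
suff -> : f \_ A = f \_ B by [].
apply/funext => z; rewrite /patch.
have [/set_mem Bz|/negP nBz] := boolP (z \in B).
  by case: ifPn => // /negP nA; apply/esym/f0 => // Az; apply: nA; rewrite inE.
by case: ifPn => // /set_mem /AB Bz; case: nBz; rewrite inE.
Qed.

Lemma derive_support (f : P2 -> R) (K : set P2) v : compact K -> (forall z, ~ K z -> f z = 0) ->
  forall z, ~ K z -> 'D_v f z = 0.
Proof.
move=> cK f0 z nKz; rewrite -(derive_cst (0 : R) z v) /=.
have oK : open (~` K) by apply: closed_openC; exact: compact_closed2.
have [->|v0] := eqVneq v 0; first by rewrite !derive0.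
apply: near_eq_derive => //.
near=> w; apply: f0; near: w.
exact: open_nbhs_nbhs.
Unshelve. all: by end_near. Qed.

Lemma FTC2_smooth (f : R -> R) (a b : R) : a < b -> (forall x, derivable f x 1) ->
  continuous (fun x => 'D_1 f x) ->
  (\int[lebesgue_measure]_(x in `[a, b]) ('D_1 f x)%:E = (f b - f a)%:E)%E.
Proof.
move=> ab df cf.
have cff : continuous f.
  by move=> x; apply: differentiable_continuous; apply/derivable1_diffP; exact: df.
rewrite (continuous_FTC2 (F := f)) ?EFinB//.
- exact: continuous_subspaceT.
- split; first by move=> x _; exact: df.
  + by apply: cvg_at_right_filter; exact: cff.
  + by apply: cvg_at_left_filter; exact: cff.
- by move=> x _; rewrite derive1E.
Qed.

Lemma integral_line0 (g h : R -> R) (M : R) : 0 < M ->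
  (forall x : R, is_derive x 1 g (h x)) -> continuous h ->
  (forall x, M < `|x| -> g x = 0) -> (forall x, M < `|x| -> h x = 0) ->
  (\int[lebesgue_measure]_x (h x)%:E = 0)%E.
Proof.
move=> M0 dg ch g0 h0.
have hE : h = (fun x => 'D_1 g x) by apply/funext => x; case: (dg x).
have -> : (\int[lebesgue_measure]_x (h x)%:E = integral lebesgue_measure `[(- (M + 1))%R, (M + 1)%R] (fun x => (h x)%:E))%E.
  rewrite [RHS]integral_mkcond; apply: eq_integral => x _; rewrite /patch.
  case: ifPn => // /negP nx'; have nx : ~ (`[(- (M + 1))%R, (M + 1)%R]%classic x) by move=> ?; apply: nx'; rewrite inE.
  rewrite h0//; apply: contrapT => /negP; rewrite -leNgt => xM; apply: nx.
  by rewrite /= in_itv /= -ler_norml (le_trans xM)// lerDl.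
rewrite hE FTC2_smooth.
- have HM : M < `|M + 1| by apply: (lt_le_trans _ (ler_norm _)); rewrite ltrDl.
  by rewrite !g0 ?subrr// normrN.
- by rewrite -subr_gt0 opprK !addr_gt0.
- by move=> x; case: (dg x).
- by rewrite -hE.
Qed.

Lemma scale_e1 (h x y : R) : h *: (1, 0) + (x, y) = (h + x, y) :> P2.
Proof.
congr (_, _); first exact: (congr1 (+%R^~ x) (mulr1 h)).
by rewrite -[RHS]add0r; exact: (congr1 (+%R^~ y) (mulr0 h)).
Qed.

Lemma scale_e2 (h x y : R) : h *: (0, 1) + (x, y) = (x, h + y) :> P2.
Proof.
congr (_, _); last exact: (congr1 (+%R^~ y) (mulr1 h)).
by rewrite -[RHS]add0r; exact: (congr1 (+%R^~ x) (mulr0 h)).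
Qed.

Lemma continuous_fst (f : P2 -> R) (y : R) : continuous f -> continuous (fun x => f (x, y)).
Proof.
move=> cf x; apply: (@continuous_comp _ _ _ (fun x => (x, y)) f); last exact: cf.
apply: (@cvg_pair _ _ _ (nbhs x) (nbhs x) (nbhs y) _ _ _ id (fun=> y)).
  exact: cvg_id.
exact: cvg_cst.
Qed.

Lemma continuous_snd (f : P2 -> R) (x : R) : continuous f -> continuous (fun y => f (x, y)).
Proof.
move=> cf y; apply: (@continuous_comp _ _ _ (fun y => (x, y)) f); last exact: cf.
apply: (@cvg_pair _ _ _ (nbhs y) (nbhs x) (nbhs y) _ _ _ (fun=> x) id).
  exact: cvg_cst.
exact: cvg_id.
Qed.

Lemma is_derive_fst (f : P2 -> R) (x y : R) : derivable f (x, y) (1, 0) ->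
  is_derive x 1 (fun x => f (x, y)) ('D_(1, 0) f (x, y)).
Proof.
have E : (fun h : R => h^-1 *: ((f \o shift (x, y)) (h *: (1, 0)) - f (x, y))) =
    (fun h : R => h^-1 *: (((fun x => f (x, y)) \o shift x) (h *: (1:R)) - f (x, y))).
  by apply/funext => h /=; rewrite scale_e1 [h%:A]mulr1.
by rewrite /derivable E => H; apply: DeriveDef => //; rewrite /derive E.
Qed.

Lemma is_derive_snd (f : P2 -> R) (x y : R) : derivable f (x, y) (0, 1) ->
  is_derive y 1 (fun y => f (x, y)) ('D_(0, 1) f (x, y)).
Proof.
have E : (fun h : R => h^-1 *: ((f \o shift (x, y)) (h *: (0, 1)) - f (x, y))) =
    (fun h : R => h^-1 *: (((fun y => f (x, y)) \o shift y) (h *: (1:R)) - f (x, y))).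
  by apply/funext => h /=; rewrite scale_e2 [h%:A]mulr1.
by rewrite /derivable E => H; apply: DeriveDef => //; rewrite /derive E.
Qed.

(** Fubini, with the variable of differentiation integrated first, reduces this to the fundamental
    theorem of calculus on each line. *)
Lemma integral_deriv0 (f : P2 -> R) (K : set P2) (v : P2) : v = (1, 0) \/ v = (0, 1) ->
  (forall n, Cn n f) -> compact K -> (forall z, ~ K z -> f z = 0) ->
  (\int[mu]_z ('D_v f z)%:E = 0)%E.
Proof.
move=> Hv Cf cK f0.
have [cf0 [df Df]] := Cf 1%N.
have cDf : continuous ('D_v f) := (Df v).1.
have D0 := derive_support v cK f0.
have iD : mu.-integrable setT (fun z => ('D_v f z)%:E).
  apply: (integrable_support (A := K)) => //.
  - exact: compact_measurable2.
  - by move=> z _ nK; rewrite D0.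
  - exact: cont_integrable.
have [M M0 KM] := compact_box cK.
have out1 x y : M < `|x| -> ~ K (x, y).
  by move=> Mx /KM /boxP[/=]; rewrite subr0 leNgt Mx.
have out2 x y : M < `|y| -> ~ K (x, y).
  by move=> Mx /KM /boxP[/= _]; rewrite subr0 leNgt Mx.
case: Hv => vE.
- have L y : (\int[lebesgue_measure]_x ('D_v f (x, y))%:E = 0)%E.
    apply: (integral_line0 M0 (g := fun x => f (x, y))) => [x||x Mx|x Mx].
    + rewrite vE; apply: is_derive_fst; exact: df.
    + exact: (@continuous_fst ('D_v f) y cDf).
    + by apply: f0; exact: out1.
    + by apply: D0; exact: out1.
  rewrite -(fubini2 iD) /fubini_G; under eq_integral => y _ do rewrite L.
  by rewrite integral0.
- have L x : (\int[lebesgue_measure]_y ('D_v f (x, y))%:E = 0)%E.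
    apply: (integral_line0 M0 (g := fun y => f (x, y))) => [y||y My|y My].
    + rewrite vE; apply: is_derive_snd; exact: df.
    + exact: (@continuous_snd ('D_v f) x cDf).
    + by apply: f0; exact: out2.
    + by apply: D0; exact: out2.
  rewrite -(fubini1 iD) /fubini_F; under eq_integral => x _ do rewrite L.
  by rewrite integral0.
Qed.

End Measure2.

(** * Weak gradients and capacity *)

Section WeakGradient.
Context {R : realType}.
Notation P2 := (R * R)%type.
Notation mu := (@leb2 R).
Local Notation M2 := (measurableTypeR R * measurableTypeR R)%type.
Local Notation mset A := (@measurable _ M2 A).
Local Notation mfun D f := (@measurable_fun _ _ M2 _ D f).
Implicit Types (O K S : set P2) (f g v : P2 -> R).

Lemma loc_int_mul O f (eta : P2 -> R) : open O -> Defs.locally_integrable O f ->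
  continuous eta -> Defs.locally_integrable O (eta \* f).
Proof.
move=> oO [mf If] ce; split.
  apply: measurable_funM => //; apply: measurable_funTS; exact: cont_measurable2.
move=> K cK KO; have [M M0 HM] := cont_bounded cK (continuous_subspaceT ce).
have mK := compact_measurable2 cK.
apply: (@le_integrable _ _ _ mu K mK _ (fun z => (M * f z)%:E)).
- apply/measurable_EFinP; apply: (@measurable_funS _ _ _ _ O) => //.
    exact: open_measurable2.
  apply: measurable_funM => //; apply: measurable_funTS; exact: cont_measurable2.
- move=> z Kz; rewrite /= lee_fin !normrM ler_wpM2r//.
  by rewrite (le_trans (HM _ Kz))// ler_norm.
- have := @integrableZl _ _ _ mu K mK M (EFin \o f) (If K cK KO).
  by apply: eq_integrable => // z _; rewrite /= EFinM.
Qed.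

Lemma loc_intD O f g : Defs.locally_integrable O f -> Defs.locally_integrable O g ->
  Defs.locally_integrable O (f \+ g).
Proof.
move=> [mf If] [mg Ig]; split; first exact: measurable_funD.
move=> K cK KO; have mK := compact_measurable2 cK.
exact: (@integrableD _ _ _ mu K mK _ _ (If K cK KO) (Ig K cK KO)).
Qed.

Lemma loc_int_cont O f : continuous f -> Defs.locally_integrable O f.
Proof.
move=> cf; split; first by apply: measurable_funTS; exact: cont_measurable2.
by move=> K cK _; exact: cont_integrable.
Qed.

Lemma loc_int_test O f (phi : P2 -> R) K : open O -> Defs.locally_integrable O f ->
  continuous phi -> compact K -> K `<=` O -> (forall z, ~ K z -> phi z = 0) ->
  mu.-integrable O (fun z => (f z * phi z)%:E).
Proof.
move=> oO lf cp cK KO p0.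
have [_ /(_ K cK KO) H] := loc_int_mul oO lf cp.
apply: (integrable_support KO).
- exact: compact_measurable2.
- exact: open_measurable2.
- by move=> z _ nK; rewrite p0// mulr0.
- by move: H; apply: eq_integrable => [|z _]; [exact: compact_measurable2|rewrite /= mulrC].
Qed.

Lemma test_mul O (eta phi : P2 -> R) : (forall n, Cn n eta) -> test_fun O phi ->
  test_fun O (eta \* phi).
Proof.
move=> Ce [/CnP Cp [K [cK [KO p0]]]]; split.
  by apply/CnP => n; exact: CnM.
by exists K; split=> //; split=> // z nK; rewrite /= p0// mulr0.
Qed.

(** The identity for [v] is tested against [eta \* phi], which is again a test function; the term
    that carries the derivative of [eta] moves to the side of the gradient. *)
Lemma weak_gradient_mul O v g1 g2 (eta : P2 -> R) : open O ->
  (forall n, Cn n eta) -> weak_gradient O v g1 g2 ->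
  weak_gradient O (eta \* v) ((eta \* g1) \+ ('D_(1, 0) eta \* v))
    ((eta \* g2) \+ ('D_(0, 1) eta \* v)).
Proof.
move=> oO Ce [lv [lg1 [lg2 H]]].
have ce : continuous eta := Cn_continuous (Ce 0%N).
have [_ [dde De]] := Ce 1%N.
have cDe w : continuous ('D_w eta) := (De w).1.
have mO := open_measurable2 oO.
split; first exact: loc_int_mul.
split; first by apply: loc_intD; exact: loc_int_mul.
split; first by apply: loc_intD; exact: loc_int_mul.
move=> phi tphi; have := H _ (test_mul Ce tphi).
have key w g : Defs.locally_integrable O g ->
  (\int[mu]_(x in O) (v x * 'D_w (eta \* phi) x)%:E =
    - \int[mu]_(x in O) (g x * (eta \* phi) x)%:E)%E ->
  (\int[mu]_(x in O) ((eta \* v) x * 'D_w phi x)%:E =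
    - \int[mu]_(x in O) (((eta \* g) \+ ('D_w eta \* v)) x * phi x)%:E)%E; last first.
  by case=> H1 H2; split; apply: key.
move=> lg HE.
have [/CnP Cp [K [cK [KO p0]]]] := tphi.
have [cp [ddp Dp]] := Cp 1%N.
have Dp0 := derive_support w cK p0.
have I1 : mu.-integrable O (fun z => ((eta \* v) z * 'D_w phi z)%:E).
  apply: (loc_int_test oO _ _ cK KO Dp0); first exact: loc_int_mul.
  exact: (Dp w).1.
have I2 : mu.-integrable O (fun z => (('D_w eta \* v) z * phi z)%:E).
  by apply: (loc_int_test oO _ cp cK KO p0); exact: loc_int_mul.
have I3 : mu.-integrable O (fun z => ((eta \* g) z * phi z)%:E).
  by apply: (loc_int_test oO _ cp cK KO p0); exact: loc_int_mul.
have E1 : (\int[mu]_(x in O) (v x * 'D_w (eta \* phi) x)%:E =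
   \int[mu]_(x in O) ((eta \* v) x * 'D_w phi x)%:E +
   \int[mu]_(x in O) (('D_w eta \* v) x * phi x)%:E)%E.
  rewrite -integralD//; apply: eq_integral => z _; rewrite -EFinD; congr (_%:E).
  rewrite (deriveM (dde z w) (ddp z w)) /GRing.scale/=; ring.
have E2 : (\int[mu]_(x in O) (((eta \* g) \+ ('D_w eta \* v)) x * phi x)%:E =
   \int[mu]_(x in O) ((eta \* g) x * phi x)%:E +
   \int[mu]_(x in O) (('D_w eta \* v) x * phi x)%:E)%E.
  rewrite -integralD//; apply: eq_integral => z _; rewrite -EFinD; congr (_%:E) => /=; ring.
have E3 : (\int[mu]_(x in O) (g x * (eta \* phi) x)%:E =
   \int[mu]_(x in O) ((eta \* g) x * phi x)%:E)%E.
  by apply: eq_integral => z _; congr (_%:E) => /=; ring.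
(* The three integrals are finite, which allows the terms to be rearranged as real numbers. *)
have := integrable_fin_num mO I1; have := integrable_fin_num mO I2.
have := integrable_fin_num mO I3.
move: HE; rewrite E1 E2 E3.
move: (integral _ _ _) => a; move: (integral _ _ _) => b; move: (integral _ _ _) => c.
case: a => [a| |] // HE; case: b HE => [b| |] // HE; case: c HE => [c| |] // [HE] _ _ _.
by congr (_%:E); lra.
Qed.

Lemma weak_gradient_one O : open O -> weak_gradient O (cst 1) (cst 0) (cst 0).
Proof.
move=> oO; do 3 (split; first by apply: loc_int_cont; exact: cst_continuous).
move=> phi [/CnP Cp [K [cK [KO p0]]]].
have key w : w = (1, 0) \/ w = (0, 1) ->
  (\int[mu]_(x in O) (cst 1 x * 'D_w phi x)%:E = - \int[mu]_(x in O) (cst 0 x * phi x)%:E)%E.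
  move=> Hw; under [X in (- X)%E]eq_integral do rewrite /= mul0r.
  rewrite integral0 oppe0 -[RHS](integral_deriv0 Hw Cp cK p0).
  rewrite [RHS](integral_support (A := O))//; last first.
    move=> z _ nO; rewrite (derive_support _ cK p0)// => /KO; exact: nO.
  by apply: eq_integral => z _; rewrite /= mul1r.
by split; apply: key; [left|right].
Qed.

(** This is the product rule applied to the constant function 1. *)
Lemma weak_gradient_smooth O (eta : P2 -> R) : open O -> (forall n, Cn n eta) ->
  weak_gradient O eta ('D_(1, 0) eta) ('D_(0, 1) eta).
Proof.
move=> oO Ce; have := weak_gradient_mul oO Ce (weak_gradient_one oO).
have E (f : P2 -> R) : (eta \* cst 0) \+ (f \* cst 1) = f.
  by apply/funext => z /=; rewrite mulr0 add0r mulr1.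
rewrite !E (_ : eta \* cst 1 = eta)//.
by apply/funext => z /=; rewrite mulr1.
Qed.

Lemma weak_gradientD O v g1 g2 u h1 h2 : open O ->
  weak_gradient O v g1 g2 -> weak_gradient O u h1 h2 ->
  weak_gradient O (v \+ u) (g1 \+ h1) (g2 \+ h2).
Proof.
move=> oO [lv [lg1 [lg2 H]]] [lu [lh1 [lh2 H']]].
do 3 (split; first exact: loc_intD).
move=> phi tphi; have := H _ tphi; have := H' _ tphi.
have [/CnP Cp [K [cK [KO p0]]]] := tphi.
have [cp [ddp Dp]] := Cp 1%N.
have mO := open_measurable2 oO.
have key w g h : Defs.locally_integrable O g -> Defs.locally_integrable O h ->
  (\int[mu]_(x in O) (u x * 'D_w phi x)%:E = - \int[mu]_(x in O) (h x * phi x)%:E)%E ->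
  (\int[mu]_(x in O) (v x * 'D_w phi x)%:E = - \int[mu]_(x in O) (g x * phi x)%:E)%E ->
  (\int[mu]_(x in O) ((v \+ u) x * 'D_w phi x)%:E =
    - \int[mu]_(x in O) ((g \+ h) x * phi x)%:E)%E; last first.
  by case=> ? ? [? ?]; split; apply: key.
move=> lg lh.
have Dp0 := derive_support w cK p0.
have I f : Defs.locally_integrable O f -> mu.-integrable O (fun z => (f z * phi z)%:E).
  by move=> lf; apply: (loc_int_test oO lf cp cK KO p0).
have J f : Defs.locally_integrable O f -> mu.-integrable O (fun z => (f z * 'D_w phi z)%:E).
  by move=> lf; apply: (loc_int_test oO lf (Dp w).1 cK KO Dp0).
have S (a b c : P2 -> R) : mu.-integrable O (fun z => (a z * c z)%:E) ->
   mu.-integrable O (fun z => (b z * c z)%:E) ->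
   (\int[mu]_(z in O) ((a \+ b) z * c z)%:E = \int[mu]_(z in O) (a z * c z)%:E +
    \int[mu]_(z in O) (b z * c z)%:E)%E.
  move=> Ia Ib; rewrite -integralD//; apply: eq_integral => z _.
  by rewrite -EFinD /= mulrDl.
move=> E1 E2; rewrite S ?E1 ?E2; [|exact: J|exact: J].
rewrite S; [|exact: I|exact: I].
have := integrable_fin_num mO (I _ lg); have := integrable_fin_num mO (I _ lh).
move: (integral _ _ _) => a; move: (integral _ _ _) => b.
by case: a => // a; case: b => // b _ _; congr (_%:E); rewrite opprD addrC.
Qed.

Lemma dirichlet_ge0 O g1 g2 : (0 <= dirichlet O g1 g2)%E.
Proof. by apply: integral_ge0 => z _; rewrite lee_fin addr_ge0 ?sqr_ge0. Qed.

Lemma sqsum_measurable O g1 g2 : mfun O g1 -> mfun O g2 ->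
  mfun O (fun z => (g1 z ^+ 2 + g2 z ^+ 2)%:E).
Proof.
move=> m1 m2; apply/measurable_EFinP.
by apply: measurable_funD; apply: measurable_funX.
Qed.

Lemma dirichlet_comb O (a b : R) g1 g2 (h1 h2 k1 k2 : P2 -> R) : mset O -> 0 <= a -> 0 <= b ->
  mfun O g1 -> mfun O g2 ->
  mfun O h1 -> mfun O h2 ->
  mfun O k1 -> mfun O k2 ->
  (forall z, O z -> k1 z ^+ 2 + k2 z ^+ 2 <=
    a * (g1 z ^+ 2 + g2 z ^+ 2) + b * (h1 z ^+ 2 + h2 z ^+ 2)) ->
  (dirichlet O k1 k2 <= a%:E * dirichlet O g1 g2 + b%:E * dirichlet O h1 h2)%E.
Proof.
move=> mO a0 b0 mg1 mg2 mh1 mh2 mk1 mk2 H.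
have mg := sqsum_measurable mg1 mg2; have mh := sqsum_measurable mh1 mh2.
rewrite /dirichlet -!ge0_integralZl_EFin//;
  try by move=> z _; rewrite lee_fin addr_ge0 ?sqr_ge0.
have sq0 (f g : P2 -> R) z : (0 <= (f z ^+ 2 + g z ^+ 2)%:E)%E.
  by rewrite lee_fin addr_ge0 ?sqr_ge0.
have mag := measurable_funeM a%:E mg; have mbh := measurable_funeM b%:E mh.
rewrite -ge0_integralD//; try by move=> z _; rewrite mule_ge0.
apply: ge0_le_integral => //; first exact: sqsum_measurable.
exact: emeasurable_funD.
Qed.

End WeakGradient.

(** * Capacity: monotonicity, subadditivity, smooth admissible functions *)

Section Capacity.
Context {R : realType}.
Notation P2 := (R * R)%type.
Notation mu := (@leb2 R).
Local Notation M2 := (measurableTypeR R * measurableTypeR R)%type.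
Local Notation mfun D f := (@measurable_fun _ _ M2 _ D f).
Implicit Types (O K S F A : set P2) (f g v : P2 -> R).

(** Since [inf] is 0 on the empty set, a set without admissible functions has [cap] equal to 0
    rather than infinite. Lower bounds and monotonicity therefore carry this condition. *)
Definition adm_exists F A O := exists v g1 g2, cap_admissible F A O v g1 g2.

Lemma cap_lb F A O : lbound [set r | exists v g1 g2, cap_admissible F A O v g1 g2 /\
   r = fine (dirichlet O g1 g2)] 0.
Proof. by move=> _ [v [g1 [g2 [_ ->]]]]; apply: fine_ge0; exact: dirichlet_ge0. Qed.

Lemma cap_ge0 F A O : 0 <= cap F A O.
Proof.
have [[x Ex]|nE] := pselect ([set r | exists v g1 g2, cap_admissible F A O v g1 g2 /\
   r = fine (dirichlet O g1 g2)] !=set0).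
  by apply: lb_le_inf; [exists x|exact: cap_lb].
rewrite /cap (_ : mkset _ = set0) ?inf0//.
by apply/seteqP; split => // x Ex; apply: nE; exists x.
Qed.

Lemma cap_le F A O v g1 g2 : cap_admissible F A O v g1 g2 ->
  cap F A O <= fine (dirichlet O g1 g2).
Proof.
move=> H; apply: ge_inf; last by exists v, g1, g2.
by exists 0; exact: cap_lb.
Qed.

Lemma cap_near F A O (e : R) : adm_exists F A O -> 0 < e ->
  exists v g1 g2, cap_admissible F A O v g1 g2 /\
    fine (dirichlet O g1 g2) < cap F A O + e.
Proof.
move=> [v [g1 [g2 H]]] e0.
have hi : has_inf [set r | exists v g1 g2, cap_admissible F A O v g1 g2 /\
   r = fine (dirichlet O g1 g2)].
  split; last by exists 0; exact: cap_lb.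
  by exists (fine (dirichlet O g1 g2)), v, g1, g2.
have [_ [w [h1 [h2 [Hw ->]]]] Hlt] := inf_adherent e0 hi.
by exists w, h1, h2.
Qed.

Lemma le_cap F A O (c : R) : adm_exists F A O ->
  (forall v g1 g2, cap_admissible F A O v g1 g2 -> c <= fine (dirichlet O g1 g2)) ->
  c <= cap F A O.
Proof.
move=> [v [g1 [g2 H]]] Hc; apply: lb_le_inf.
  by exists (fine (dirichlet O g1 g2)), v, g1, g2.
by move=> _ [w [h1 [h2 [Hw ->]]]]; exact: Hc Hw.
Qed.

Lemma admS F A B O v g1 g2 : A `<=` B -> cap_admissible F B O v g1 g2 ->
  cap_admissible F A O v g1 g2.
Proof.
move=> AB [cv [v0 [wg [df [HF [U [oU [BU HU]]]]]]]].
do 5 (split => //); exists U; split=> //; split=> //; exact: subset_trans BU.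
Qed.

(** Convexity of the square: a + b is the mean of a / l and b / (1 - l) with weights l and 1 - l. *)
Lemma sqrD_conv (a b l : R) : 0 < l < 1 ->
  (a + b) ^+ 2 <= l^-1 * a ^+ 2 + (1 - l)^-1 * b ^+ 2.
Proof.
move=> /andP[l0 l1]; have l1' : 0 < 1 - l by rewrite subr_gt0.
rewrite -subr_ge0.
have -> : l^-1 * a ^+ 2 + (1 - l)^-1 * b ^+ 2 - (a + b) ^+ 2 =
  ((1 - l) * a - l * b) ^+ 2 / (l * (1 - l)).
  by field; rewrite !gt_eqF.
by rewrite divr_ge0 ?sqr_ge0// mulr_ge0// ltW.
Qed.

Lemma adm_meas F A O v g1 g2 : cap_admissible F A O v g1 g2 ->
  [/\ mfun O v, mfun O g1 & mfun O g2].
Proof. by move=> [_ [_ [[[mv _] [[m1 _] [[m2 _] _]]] _]]]; split. Qed.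

Lemma adm_fin F A O v g1 g2 : cap_admissible F A O v g1 g2 ->
  dirichlet O g1 g2 = (fine (dirichlet O g1 g2))%:E.
Proof.
move=> [_ [_ [_ [df _]]]]; rewrite fineK// ge0_fin_numE//.
exact: dirichlet_ge0.
Qed.

(** The sum [v \+ u] is admissible for the union, because each function is nonnegative where the
    other is at least 1. *)
Lemma admU F A B O v g1 g2 u h1 h2 (l : R) : open O -> 0 < l < 1 ->
  cap_admissible F A O v g1 g2 -> cap_admissible F B O u h1 h2 ->
  cap F (A `|` B) O <= l^-1 * fine (dirichlet O g1 g2) +
    (1 - l)^-1 * fine (dirichlet O h1 h2).
Proof.
move=> oO l01 Hv Hu.
have [mv mg1 mg2] := adm_meas Hv; have [mmu mh1 mh2] := adm_meas Hu.
have l01' := l01; move: l01' => /andP[l0 l1].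
have D : (dirichlet O (g1 \+ h1)%R (g2 \+ h2)%R <=
   (l^-1)%:E * dirichlet O g1 g2 + ((1 - l)^-1)%:E * dirichlet O h1 h2)%E.
  apply: dirichlet_comb => //.
  - exact: open_measurable2.
  - by rewrite invr_ge0 ltW.
  - by rewrite invr_ge0 subr_ge0 ltW.
  - exact: measurable_funD.
  - exact: measurable_funD.
  - move=> z _; have := sqrD_conv (g1 z) (h1 z) l01.
    by have := sqrD_conv (g2 z) (h2 z) l01 => /=; lra.
have Ev := adm_fin Hv; have Eu := adm_fin Hu.
have HH : cap_admissible F (A `|` B) O (v \+ u) (g1 \+ h1) (g2 \+ h2).
  move: Hv Hu => [cv [v0 [wv [dv [[U1 [oU1 [FU1 HU1]]] [U2 [oU2 [AU2 HU2]]]]]]]].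
  move=> [cu [u0 [wu [du [[W1 [oW1 [FW1 HW1]]] [W2 [oW2 [BW2 HW2]]]]]]]].
  split; first by move=> z; apply: continuousD; [exact: cv|exact: cu].
  split; first by move=> z Oz /=; rewrite addr_ge0 ?v0 ?u0.
  split; first exact: weak_gradientD.
  split; first by apply: le_lt_trans D _; rewrite Ev Eu -!EFinM -EFinD ltry.
  split.
    exists (U1 `&` W1); split; first exact: openI.
    split; first by move=> z Fz; split; [exact: FU1|exact: FW1].
    by move=> z [z1 z2] Oz /=; rewrite HU1// HW1// addr0.
  exists (U2 `|` W2); split; first exact: openU.
  split; first exact: setUSS.
  move=> z [zU|zW] Oz /=.
    by rewrite -[leLHS]addr0 lerD ?HU2 ?u0.
  by rewrite -[leLHS]add0r lerD ?HW2 ?v0.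
apply: le_trans (cap_le HH) _.
move: D; rewrite (adm_fin HH) Ev Eu -!EFinM -EFinD lee_fin; exact: le_trans.
Qed.

(* The weight l = a / (a + b) turns a^2 / l + b^2 / (1 - l) into (a + b)^2. *)
Lemma sqrt_capU F A B O : open O -> adm_exists F A O -> adm_exists F B O ->
  Num.sqrt (cap F (A `|` B) O) <= Num.sqrt (cap F A O) + Num.sqrt (cap F B O).
Proof.
move=> oO eA eB; apply/ler_addgt0Pr => e e0.
pose d := (e / 2) ^+ 2.
have d0 : 0 < d by rewrite exprn_gt0// divr_gt0.
have [v [g1 [g2 [Hv vlt]]]] := cap_near eA d0.
have [u [h1 [h2 [Hu ult]]]] := cap_near eB d0.
(* The shift by [e / 2] absorbs the error [d] and keeps the weight strictly between 0 and 1 even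
   when a capacity is 0. *)
pose a := Num.sqrt (cap F A O) + e / 2; pose b := Num.sqrt (cap F B O) + e / 2.
have a0 : 0 < a by rewrite ltr_wpDl ?sqrtr_ge0// divr_gt0.
have b0 : 0 < b by rewrite ltr_wpDl ?sqrtr_ge0// divr_gt0.
have sq (x : R) : 0 <= x -> x + d <= (Num.sqrt x + e / 2) ^+ 2.
  move=> x0; rewrite sqrrD sqr_sqrtr// /d lerD2r lerDl mulrn_wge0// mulr_ge0 ?sqrtr_ge0//.
  by rewrite divr_ge0// ltW.
have ga : fine (dirichlet O g1 g2) <= a ^+ 2 by apply: le_trans (ltW vlt) (sq _ (cap_ge0 _ _ _)).
have gb : fine (dirichlet O h1 h2) <= b ^+ 2 by apply: le_trans (ltW ult) (sq _ (cap_ge0 _ _ _)).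
have ab0 : 0 < a + b by rewrite addr_gt0.
have l01 : 0 < a / (a + b) < 1.
  by rewrite divr_gt0//= ltr_pdivrMr// mul1r ltrDl.
have H := admU oO l01 Hv Hu.
have -> : Num.sqrt (cap F A O) + Num.sqrt (cap F B O) + e = a + b by rewrite /a /b; field.
rewrite -(sqr_sqrtr (cap_ge0 F (A `|` B) O)) in H.
suff : Num.sqrt (cap F (A `|` B) O) ^+ 2 <= (a + b) ^+ 2.
  by rewrite ler_pXn2r// nnegrE ?sqrtr_ge0 ?ltW.
apply: le_trans H _.
have -> : (a + b) ^+ 2 = (a / (a + b))^-1 * a ^+ 2 + (1 - a / (a + b))^-1 * b ^+ 2.
  field; rewrite !gt_eqF//=; lra.
apply: lerD; rewrite ler_wpM2l// ?invr_ge0//.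
  by rewrite divr_ge0// ltW.
by rewrite subr_ge0; case/andP: l01 => _ /ltW.
Qed.

(** Only the derivatives are asked to vanish off [S], so that functions equal to 1 far away, such as
    1 minus a cutoff, are covered too. *)
Lemma smooth_adm F A O S (eta : P2 -> R) : open O -> (forall n, Cn n eta) ->
  (forall z, 0 <= eta z) -> compact S -> S `<=` O ->
  (forall w z, ~ S z -> 'D_w eta z = 0) ->
  (exists U, open U /\ F `<=` U /\ forall x, U x -> O x -> eta x = 0) ->
  (exists U, open U /\ A `<=` U /\ forall x, U x -> O x -> 1 <= eta x) ->
  cap_admissible F A O eta ('D_(1, 0) eta) ('D_(0, 1) eta).
Proof.
move=> oO Ce e0 cS SO De HF HA.
split; first by apply: continuous_subspaceT; exact: Cn_continuous (Ce 0%N).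
split; first by move=> z _; exact: e0.
split; first exact: weak_gradient_smooth.
split => //.
have [_ [_ CD]] := Ce 1%N.
have cI : continuous (fun z => ('D_(1, 0) eta z) ^+ 2 + ('D_(0, 1) eta z) ^+ 2).
  rewrite (_ : (fun z => _) = ('D_(1, 0) eta \* 'D_(1, 0) eta) \+
    ('D_(0, 1) eta \* 'D_(0, 1) eta)).
    by apply: (@Cn_continuous _ _ 0); apply: CnD; apply: CnM; exact: CD.
  by apply/funext => z; rewrite /= !expr2.
have I := cont_integrable cS cI.
rewrite /dirichlet (integral_support SO); last first.
  by move=> z _ nS; rewrite !De// expr0n/= addr0.
have /integrable_fin_num : (mu.-integrable S (fun z => (('D_(1, 0) eta z) ^+ 2 + ('D_(0, 1) eta z) ^+ 2)%:E)) by exact: I.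
by move=> /(_ (compact_measurable2 cS)); rewrite ge0_fin_numE// integral_ge0// => z _;
  rewrite lee_fin addr_ge0 ?sqr_ge0.
Qed.

End Capacity.

(** * Rectifiable curves *)

Section Curves.
Context {R : realType}.
Notation P2 := (R * R)%type.
Implicit Types (O V F l : set P2) (x y z : P2) (c : R -> P2).

(** Comparable with [edist2] up to a factor 2 and computed coordinate by coordinate; whether lengths
    are bounded does not depend on the choice between the two. *)
Definition l1dist (x y : P2) : R := `|x.1 - y.1| + `|x.2 - y.2|.

Lemma edist2_le_l1 x y : edist2 x y <= l1dist x y.
Proof.
rewrite /edist2 /l1dist; move: (x.1 - y.1) (x.2 - y.2) => a b.
rewrite -[leRHS]ger0_norm ?addr_ge0// -sqrtr_sqr ler_sqrt ?sqr_ge0//.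
rewrite sqrrD !real_normK ?num_real// [leRHS]addrAC lerDl.
by rewrite mulrn_wge0// mulr_ge0.
Qed.

Lemma l1_le_edist2 x y : l1dist x y <= 2 * edist2 x y.
Proof.
rewrite /edist2 /l1dist; move: (x.1 - y.1) (x.2 - y.2) => a b.
have Ha : `|a| <= Num.sqrt (a ^+ 2 + b ^+ 2).
  by rewrite -sqrtr_sqr ler_sqrt ?addr_ge0 ?sqr_ge0// lerDl sqr_ge0.
have Hb : `|b| <= Num.sqrt (a ^+ 2 + b ^+ 2).
  by rewrite -sqrtr_sqr ler_sqrt ?addr_ge0 ?sqr_ge0// lerDr sqr_ge0.
lra.
Qed.

(** The retraction onto [0, 1]: composing with it makes a curve continuous on the whole line without
    changing its image. *)
Definition clamp (t : R) : R := Num.max 0 (Num.min 1 t).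

Lemma clamp_I01 t : 0 <= clamp t <= 1.
Proof. by rewrite /clamp le_max lexx /= ge_max ler01 ge_min lexx. Qed.

Lemma clamp_id t : 0 <= t <= 1 -> clamp t = t.
Proof. by move=> /andP[t0 t1]; rewrite /clamp min_r// max_r. Qed.

Lemma clamp_le0 t : t <= 0 -> clamp t = 0.
Proof.
by move=> t0; rewrite /clamp max_l// ge_min t0 orbT.
Qed.

Lemma clamp_ge1 t : 1 <= t -> clamp t = 1.
Proof. by move=> t1; rewrite /clamp min_l// max_r. Qed.

Lemma clamp_mono s t : s <= t -> clamp s <= clamp t.
Proof.
move=> st; rewrite /clamp ge_max le_max lexx /= le_max le_min !ge_min lexx /=.
by rewrite st !orbT.
Qed.

Lemma clamp_continuous : continuous clamp.
Proof.
move=> t.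
have H1 : {for t, continuous ((cst 1 : R -> R^o) \min (id : R -> R^o))}.
  by apply: continuous_min; [exact: cst_continuous|exact: cvg_id].
have H0 : {for t, continuous (cst 0 : R -> R^o)} by exact: cst_continuous.
exact: (continuous_max H0 H1).
Qed.

Lemma rect_curve_clamp O x y c : rect_curve O x y c ->
  continuous (c \o clamp) /\ (c \o clamp) @` (@I01 R) = c @` (@I01 R).
Proof.
move=> [cc _]; split.
  have /subspace_continuousP H := cc.
  move=> t; apply: (@cvg_trans _ (c s @[s --> within (@I01 R) (nbhs (clamp t))])).
    move=> A HA; have H1 : within (@I01 R) (nbhs (clamp t)) (c @^-1` A) by exact: HA.
    have := @clamp_continuous t _ H1.
    change (nbhs t (clamp @^-1` (fun s => @I01 R s -> A (c s))) -> nbhs t ((c \o clamp) @^-1` A)).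
    by apply: filterS => s /=; apply; exact: clamp_I01.
  by apply: H; exact: clamp_I01.
apply/seteqP; split => z [t Ht <-] /=.
  by exists (clamp t) => //; exact: clamp_I01.
by exists t => //=; rewrite clamp_id.
Qed.

Lemma rect_curve_cat O x y z c1 c2 : rect_curve O x y c1 -> rect_curve O y z c2 ->
  exists c, rect_curve O x z c /\ c @` (@I01 R) `<=` c1 @` (@I01 R) `|` c2 @` (@I01 R).
Proof.
move=> H1 H2.
have [k1 i1] := rect_curve_clamp H1; have [k2 i2] := rect_curve_clamp H2.
case: H1 => _ [c10 [c11 [c1O [M1 HM1]]]]; case: H2 => _ [c20 [c21 [c2O [M2 HM2]]]].
pose d1 (t : R) := c1 (clamp (2 * t)); pose d2 (t : R) := c2 (clamp (2 * t - 1)).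
(* At each time at least one of [d1], [d2] rests at [y], so this sum is the concatenation, and its
   continuity requires no gluing. *)
pose c t := d1 t + d2 t - y.
have cl t : t <= 2^-1 -> c t = d1 t.
  move=> ht; rewrite /c /d2 clamp_le0 ?c20 ?addrK//; lra.
have cr t : 2^-1 <= t -> c t = d2 t.
  move=> ht; rewrite /c /d1 clamp_ge1 ?c11 1?addrC ?addKr//; lra.
have cim t : 0 <= t <= 1 -> (c1 @` (@I01 R) `|` c2 @` (@I01 R)) (c t).
  move=> t01; have [ht|/ltW ht] := leP t 2^-1.
    by rewrite cl//; left; exists (clamp (2 * t)) => //; exact: clamp_I01.
  by rewrite cr//; right; exists (clamp (2 * t - 1)) => //; exact: clamp_I01.
have k2t : continuous (fun t : R => 2 * t).
  by move=> t; apply: cvgM; [exact: cvg_cst|exact: cvg_id].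
have kd1 : continuous d1.
  by move=> t; exact: (continuous_comp (k2t t) (k1 _)).
have kd2 : continuous d2.
  have k2t1 : continuous (fun t : R => 2 * t - 1).
    by move=> t; apply: cvgB; [exact: k2t|exact: cvg_cst].
  by move=> t; exact: (continuous_comp (k2t1 t) (k2 _)).
exists c; split; last by move=> _ [t t01 <-]; exact: cim.
split.
  apply: continuous_subspaceT => t; rewrite /c.
  apply: cvgB; last exact: cvg_cst.
  by apply: cvgD; [exact: kd1|exact: kd2].
split; first by rewrite cl ?invr_ge0// /d1 mulr0 clamp_le0.
split; first by rewrite cr ?invf_le1 ?ler1n// /d2 clamp_ge1 ?c21//; lra.
split; first by move=> _ [t t01 <-]; case: (cim t t01) => [/c1O|/c2O].
exists (2 * M1 + 2 * M2) => n t t0 tn tm.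
have tri (a b a' b' : P2) :
    edist2 (a + b - y) (a' + b' - y) <= 2 * edist2 a a' + 2 * edist2 b b'.
  apply: (le_trans (edist2_le_l1 _ _)).
  apply: le_trans (lerD (l1_le_edist2 a a') (l1_le_edist2 b b')).
  rewrite /l1dist /=.
  have E (p q p' q' w : R) : `|p + q - w - (p' + q' - w)| <= `|p - p'| + `|q - q'|.
    by rewrite (_ : _ - _ = p - p' + (q - q')) ?ler_normD//; ring.
  have := E a.1 b.1 a'.1 b'.1 y.1; have := E a.2 b.2 a'.2 b'.2 y.2; lra.
apply: (@le_trans _ _ (\sum_(i < n) (2 * edist2 (d1 (t i.+1)) (d1 (t i)) +
   2 * edist2 (d2 (t i.+1)) (d2 (t i))))).
  by apply: ler_sum => i _; exact: tri.
rewrite big_split /= -!mulr_sumr; apply: lerD; rewrite ler_pM2l//.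
  apply: (HM1 n (fun i => clamp (2 * t i))).
  - by have /andP[] := clamp_I01 (2 * t 0%N).
  - by have /andP[] := clamp_I01 (2 * t n).
  - by move=> i ni; apply: clamp_mono; rewrite ler_pM2l// tm.
apply: (HM2 n (fun i => clamp (2 * t i - 1))).
- by have /andP[] := clamp_I01 (2 * t 0%N - 1).
- by have /andP[] := clamp_I01 (2 * t n - 1).
- by move=> i ni; apply: clamp_mono; rewrite lerD2r ler_pM2l// tm.
Qed.

Lemma rect_curve_segment O a (r : R) x y : box a r `<=` O -> box a r x -> box a r y ->
  exists c, rect_curve O x y c /\ c @` (@I01 R) `<=` box a r.
Proof.
move=> aO ax ay; pose c (t : R) : P2 := (x.1 + t * (y.1 - x.1), x.2 + t * (y.2 - x.2)).
have cb t : 0 <= t <= 1 -> box a r (c t).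
  move=> t01; move: ax ay => /boxP[]; rewrite !ler_distl => hx1 hx2 /boxP[].
  rewrite !ler_distl => hy1 hy2; apply/boxP; rewrite !ler_distl /c /=.
  have P (p q b : R) : b - r <= p <= b + r -> b - r <= q <= b + r ->
      b - r <= p + t * (q - p) <= b + r by nra.
  by split; apply: P.
exists c; split; last by move=> _ [t t01 <-]; exact: cb.
have cont (p q : R) : continuous (fun t : R => p + t * q).
  move=> t; apply: cvgD; first exact: cvg_cst.
  by apply: cvgM; [exact: cvg_id|exact: cvg_cst].
split.
  apply: continuous_subspaceT => t.
  apply: (@cvg_pair _ _ _ (nbhs t) (nbhs (c t).1) (nbhs (c t).2)); exact: cont.
split; first by rewrite /c !mul0r !addr0; case: (x).
split; first by rewrite /c !mul1r !(addrC _ (_ - _)) !subrK; case: (y).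
split; first by move=> _ [t t01 <-]; apply: aO; exact: cb.
exists (l1dist x y) => n t t0 tn tm.
apply: (@le_trans _ _ (\sum_(0 <= i < n) (t i.+1 - t i) * l1dist x y)).
  rewrite big_mkord; apply: ler_sum => i _; apply: (le_trans (edist2_le_l1 _ _)).
  have ti : 0 <= t i.+1 - t i by rewrite subr_ge0 tm.
  have E (p q : R) : `|p + t i.+1 * (q - p) - (p + t i * (q - p))| = (t i.+1 - t i) * `|p - q|.
    rewrite (_ : _ - _ = (t i.+1 - t i) * (q - p)); last by ring.
    by rewrite normrM ger0_norm// distrC.
  by rewrite /l1dist /c /= !E mulrDr.
rewrite -mulr_suml telescope_sumr// ler_piMl//; first by rewrite addr_ge0.
lra.
Qed.

(** The points of [O] that satisfy [P] form a set that is both open and closed in [O]: within one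
    box [P] passes from the centre to nearby points and back. *)
Lemma connected_ind O (P : P2 -> Prop) : open O -> connected O ->
  (exists2 x, O x & P x) ->
  (forall x, O x -> exists2 r, 0 < r & forall y z, box x r y -> box x r z -> O y -> O z -> P y -> P z) ->
  forall x, O x -> P x.
Proof.
move=> oO cO [x0 Ox0 Px0] loc x Ox.
pose B := O `&` [set y | P y].
have BE : B = O.
  apply: cO; first by exists x0.
  - exists B; last by rewrite /B setIA setIid.
    rewrite openE => y [Oy Py]; have [r r0 H] := loc y Oy.
    have : nbhs y (ball y r `&` O).
      apply: filterI; last exact: open_nbhs_nbhs.
      exact: nbhsx_ballx.
    apply: filterS => z [yz Oz]; split => //; apply: (H y z) => //.
      by apply/boxP; rewrite !subrr normr0 ltW.
    exact: ball_box.
  - exists (closure B); first exact: closed_closure.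
    apply/seteqP; split => [y By|y [Oy Cy]].
      by split; [case: By|exact: subset_closure].
    split => //; have [r r0 H] := loc y Oy.
    have [z [[Oz Pz] yz]] := Cy _ (nbhsx_ballx y _ r0).
    apply: (H z y) => //; first exact: ball_box.
    by apply/boxP; rewrite !subrr normr0 ltW.
by move: Ox; rewrite -BE => -[].
Qed.

(** Ensures that the infimum in [rho] runs over a nonempty set; otherwise [inf] would return 0 and
    lower bounds on [rho] would fail. *)
Lemma rect_connected O x y : domain O -> O x -> O y -> exists c, rect_curve O x y c.
Proof.
move=> [oO [cO _]] Ox; move: y.
apply: (connected_ind oO cO).
  have [r r0 xO] := open_box oO Ox.
  have xx : box x r x by apply/boxP; rewrite !subrr normr0 ltW.
  by have [c [Hc _]] := rect_curve_segment xO xx xx; exists x => //; exists c.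
move=> z Oz; have [r r0 zO] := open_box oO Oz; exists r => // u w zu zw _ _ [c Hc].
have [d [Hd _]] := rect_curve_segment zO zu zw.
by have [e [He _]] := rect_curve_cat Hc Hd; exists e.
Qed.

End Curves.

(** * Capacity of small sets and the capacitary metric *)

Section SmallCap.
Context {R : realType}.
Notation P2 := (R * R)%type.
Notation mu := (@leb2 R).
Local Notation M2 := (measurableTypeR R * measurableTypeR R)%type.
Local Notation mset A := (@measurable _ M2 A).
Local Notation mfun D f := (@measurable_fun _ _ M2 _ D f).
Implicit Types (O K S F A V l : set P2).

Lemma deriveZ_dir (f : P2 -> R) (x v : P2) (s : R) : derivable f x v ->
  'D_(s *: v) f x = s * 'D_v f x.
Proof.
move=> df.
have dF : is_derive (0 : R) 1 (fun h : R => f (h *: v + x)) ('D_v f x).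
  by have /derivable1P dd := df; apply: DeriveDef; [exact: dd|rewrite [RHS]derive_line].
have dL : is_derive (0 : R) 1 (fun h : R => s * h) s.
  by have := is_deriveZ s (is_derive_id (0 : R) (1 : R)); rewrite [s%:A]mulr1.
rewrite derive_line.
have dF' : is_derive (s * 0) 1 (fun h : R => f (h *: v + x)) ('D_v f x) by rewrite mulr0.
have := is_derive1_comp dF' dL; rewrite mulrC => /@derive_val <-.
congr (derive _ (0 : R) (1 : R)); apply/funext => h /=; by rewrite scalerA mulrC.
Qed.

Lemma scale_aff (s h : R) (a z v : P2) :
  s *: (h *: v + z - a) = h *: (s *: v) + s *: (z - a).
Proof.
have E (p q t : R) : s * (h * p + q - t) = h * (s * p) + s * (q - t) by ring.
by congr (_, _); exact: E.
Qed.

Lemma derive_aff (f : P2 -> R) (s : R) (a z v : P2) :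
  'D_v (fun z => f (s *: (z - a))) z = 'D_(s *: v) f (s *: (z - a)).
Proof.
rewrite /derive; set g1 := fun h => h^-1 *: _; set g2 := fun h => h^-1 *: _.
suff -> : g1 = g2 by [].
apply/funext => h; rewrite /g1 /g2 /=.
by rewrite scale_aff.
Qed.

Lemma derivable_aff (f : P2 -> R) (s : R) (a z v : P2) :
  derivable f (s *: (z - a)) (s *: v) -> derivable (fun z => f (s *: (z - a))) z v.
Proof.
rewrite /derivable; set g1 := fun h => h^-1 *: _; set g2 := fun h => h^-1 *: _.
suff -> : g1 = g2 by [].
apply/funext => h; rewrite /g1 /g2 /=.
by rewrite scale_aff.
Qed.

Lemma Cn_aff n (f : P2 -> R) (s : R) (a : P2) : Cn n f -> Cn n (fun z => f (s *: (z - a))).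
Proof.
have ca : continuous (fun z : P2 => s *: (z - a)).
  by move=> z; apply: cvgZr; apply: cvgB; [exact: cvg_id|exact: cvg_cst].
elim: n f => [|n IH] f [cf Hf]; split=> //.
1,2: by move=> z; exact: (continuous_comp (ca z) (cf _)).
case: Hf => df Df; split=> [z v|v]; first by apply: derivable_aff; exact: df.
rewrite (_ : 'D_v _ = fun z => 'D_(s *: v) f (s *: (z - a))).
  exact: (IH _ (Df _)).
by apply/funext => z; rewrite derive_aff.
Qed.

Lemma dirichlet_subset O (g1 g2 : P2 -> R) : mset O -> mfun setT g1 -> mfun setT g2 ->
  (dirichlet O g1 g2 <= dirichlet setT g1 g2)%E.
Proof.
move=> mO m1 m2; apply: ge0_subset_integral => //.
- exact: sqsum_measurable.
- by move=> z _; rewrite lee_fin addr_ge0 ?sqr_ge0.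
Qed.

Lemma dirichlet_bound (g1 g2 : P2 -> R) (a : P2) (r M : R) : 0 < r ->
  mfun setT g1 -> mfun setT g2 ->
  (forall z, ~ box a r z -> g1 z = 0 /\ g2 z = 0) ->
  (forall z, `|g1 z| <= M /\ `|g2 z| <= M) ->
  (dirichlet setT g1 g2 <= (8 * M ^+ 2 * r ^+ 2)%:E)%E.
Proof.
move=> r0 m1 m2 g0 gM.
rewrite /dirichlet (integral_support (A := box a r))//; last first.
  by move=> z _ nz; have [-> ->] := g0 z nz; rewrite expr0n/= addr0.
have mb := box_measurable a r.
apply: (@le_trans _ _ (\int[mu]_(z in box a r) (2 * M ^+ 2)%:E)%E).
  apply: ge0_le_integral => //.
  - by move=> z _; rewrite lee_fin addr_ge0 ?sqr_ge0.
  - by apply: measurable_funTS; exact: sqsum_measurable.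
  - move=> z _; rewrite lee_fin.
    have [h1 h2] := gM z.
    have S (x : R) : `|x| <= M -> x ^+ 2 <= M ^+ 2.
      move=> h; rewrite -real_normK ?num_real// ler_pXn2r// ?nnegrE//.
      exact: le_trans h.
    by have := S _ h1; have := S _ h2; lra.
rewrite integral_cst//.
apply: (@le_trans _ _ ((2 * M ^+ 2)%:E * mu (box a r))%E); first exact: lexx.
rewrite /box leb2_rect; [|lra..].
by rewrite -EFinM lee_fin le_eqVlt; apply/orP; left; apply/eqP; ring.
Qed.

(* The Dirichlet energy is scale invariant in dimension two, hence C does not
   depend on the radius. *)
Lemma scaled_cutoff : exists2 C : R, 0 < C & forall (a : P2) (rho : R), 0 < rho ->
  exists chi : P2 -> R, [/\ forall n, Cn n chi, forall z, 0 <= chi z,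
    forall z, ball a (rho / 2) z -> chi z = 1 /\ forall w, 'D_w chi z = 0,
    forall z, ~ ball a rho z -> chi z = 0 /\ forall w, 'D_w chi z = 0 &
    (dirichlet setT ('D_((1%R : R), (0%R : R)) chi) ('D_((0%R : R), (1%R : R)) chi) <= C%:E)%E].
Proof.
have b12 : box (0 : P2) (1 / 2) `<=` ball (0 : P2) (3 / 4) by apply: box_ball; lra.
have o34 : open (ball (0 : P2) (3 / 4)) by have [] := @ball_open_nbhs _ P2 0 (3/4) ltac:(lra).
have [eta [S [W [Ce e01 [oW [KW W1]] [cS [SU S0]]]]]] := cutoff (@box_compact R 0 (1 / 2)) o34 b12.
have [_ [dde De]] := Ce 1%N.
have bd w : exists2 M, 0 < M & forall z, `|'D_w eta z| <= M.
  have [M M0 HM] := cont_bounded cS (continuous_subspaceT (De w).1).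
  exists M => // z; have [Sz|nS] := pselect (S z); first exact: HM.
  by rewrite (derive_support w cS S0)// normr0 ltW.
have [Ma Ma0 HMa] := bd (1, 0); have [Mb Mb0 HMb] := bd (0, 1).
(* The box of radius rho has area 4 rho^2 and both partial derivatives are at most (Ma + Mb) / rho,
   so rho cancels. *)
exists (8 * (Ma + Mb) ^+ 2); first by rewrite mulr_gt0// exprn_gt0// addr_gt0.
move=> a r r0; pose f z := eta (r^-1 *: (z - a)).
have E (z : P2) : r^-1 *: (z - a) = ((z.1 - a.1) / r, (z.2 - a.2) / r).
  by rewrite (mulrC (_ - _)) (mulrC (z.2 - _)).
have Cf n : Cn n f by apply: Cn_aff.
have Df w z : 'D_w f z = r^-1 * 'D_w eta (r^-1 *: (z - a)).
  by rewrite /f derive_aff deriveZ_dir.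
have B (z : P2) (t : R) : ball (0 : P2) t (r^-1 *: (z - a)) <-> ball a (t * r) z.
  rewrite E; split => /ballP2/= []; rewrite ?subr0 => h1 h2; apply/ballP2 => /=;
    rewrite ?subr0 !normrM !(gtr0_norm (x := r^-1)) ?invr_gt0// in h1 h2 *;
    by rewrite ?ltr_pdivrMr// -?ltr_pdivrMr.
have out z : ~ ball a r z -> ~ S (r^-1 *: (z - a)).
  move=> nz /SU /B /ballP2[h1 h2]; apply: nz; apply/ballP2.
  by split; [apply: lt_le_trans h1 _|apply: lt_le_trans h2 _]; rewrite ger_pMl//; lra.
exists f; split => //.
- by move=> z; have /andP[] := e01 (r^-1 *: (z - a)).
- move=> z zb; have Wz : W (r^-1 *: (z - a)).
    by apply: KW; apply: ball_box; apply/B; rewrite mulrC mulrA mulr1.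
  split; first exact: W1.
  move=> w; rewrite Df -[X in r^-1 * X](_ : 0 = _) ?mulr0//.
  rewrite -(derive_cst (1 : R) (r^-1 *: (z - a)) w).
  have [->|w0] := eqVneq w 0; first by rewrite !derive0.
  apply: near_eq_derive => //.
  have : nbhs (r^-1 *: (z - a)) W by exact: open_nbhs_nbhs.
  by apply: filterS => u /W1.
- move=> z /out nS; split; first exact: S0.
  by move=> w; rewrite Df (derive_support w cS S0)// mulr0.
- have mD w : mfun setT ('D_w f).
    by apply: cont_measurable2; have [_ [_ /(_ w) []]] := Cf 1%N.
  apply: (le_trans (@dirichlet_bound _ _ a r ((Ma + Mb) / r) r0 (mD _) (mD _) _ _)).
  + move=> z nz; rewrite !Df; have nS : ~ S (r^-1 *: (z - a)).
      by apply: out => /ball_box.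
    by rewrite !(derive_support _ cS S0)// mulr0.
  + move=> z.
    have N (w : P2) (K : R) : `|'D_w eta (r^-1 *: (z - a))| <= K -> `|'D_w f z| <= K / r.
      by move=> h; rewrite Df normrM gtr0_norm ?invr_gt0// mulrC ler_pM2r ?invr_gt0.
    have ha := HMa (r^-1 *: (z - a)); have hb := HMb (r^-1 *: (z - a)).
    by split; apply: N; lra.
  + rewrite lee_fin le_eqVlt; apply/orP; left; apply/eqP; field.
    by rewrite gt_eqF.
Qed.

End SmallCap.

Section Rho.
Context {R : realType}.
Notation P2 := (R * R)%type.
Local Notation M2 := (measurableTypeR R * measurableTypeR R)%type.
Local Notation mset A := (@measurable _ M2 A).
Local Notation mfun D f := (@measurable_fun _ _ M2 _ D f).
Local Notation e1 := ((1%R : R), (0%R : R)).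
Local Notation e2 := ((0%R : R), (1%R : R)).
Implicit Types (O K S F A V l : set P2).

Lemma smooth_mfun (f : P2 -> R) w D : (forall n, Cn n f) -> mfun D ('D_w f).
Proof.
by move=> Cf; apply: measurable_funTS; apply: cont_measurable2; have [_ [_ /(_ w) []]] := Cf 1%N.
Qed.

Lemma mset_setT : mset setT.
Proof. exact: (@measurableT _ M2). Qed.

(* The N summands have gradients with disjoint supports, so the energy grows
   like N and that of v / N decays like 1 / N. *)
Lemma log_cutoff : exists2 C : R, 0 < C & forall (a : P2) (r : R) (N : nat), 0 < r ->
  exists v : P2 -> R, exists2 d : R, 0 < d &
  [/\ forall n, Cn n v, forall z, 0 <= v z,
    forall z, ball a d z -> v z = N%:R /\ forall w, 'D_w v z = 0,
    forall z, ~ ball a r z -> v z = 0 /\ forall w, 'D_w v z = 0 &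
    (dirichlet setT ('D_e1 v) ('D_e2 v) <= (N%:R * C)%:E)%E].
Proof.
have [C C0 H] := @scaled_cutoff R; exists C => // a r N r0.
elim: N => [|N [v [d d0 [Cv v0 vd vr Dv]]]].
  exists (cst 0), r => //; split => //.
  - by move=> n; exact: Cn_cst.
  - by move=> z _; split => // w; exact: derive_cst.
  - by move=> z _; split => // w; exact: derive_cst.
  - rewrite mul0r /dirichlet integral0_eq// => z _.
    by rewrite !derive_cst expr0n/= addr0.
have m0 : 0 < Num.min d r by rewrite lt_min d0.
have [c [Cc c0 cd cr Dc]] := H a _ m0.
exists (v \+ c), (Num.min d r / 2); first by rewrite divr_gt0.
have [_ [dv _]] := Cv 1%N; have [_ [dc _]] := Cc 1%N.
have Dvc w z : 'D_w (v \+ c) z = 'D_w v z + 'D_w c z by rewrite deriveD.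
have sub (s t : R) z : s <= t -> ball a s z -> ball a t z by move=> st; exact: le_ball.
have md : Num.min d r <= d by rewrite ge_min lexx.
have mr : Num.min d r <= r by rewrite ge_min lexx orbT.
have m2 : Num.min d r / 2 <= Num.min d r by rewrite ler_pdivrMr// ler_pMr// ler1n.
split.
- by move=> n; exact: CnD.
- by move=> z /=; rewrite addr_ge0.
- move=> z zm /=; have [-> Dc0] := cd z zm.
  have [|-> Dv0] := vd z; first by apply: sub zm; exact: le_trans md.
  by rewrite -natr1; split => // w; rewrite Dvc Dc0 Dv0 addr0.
- move=> z zr /=; have [-> Dv0] := vr z zr.
  have [|-> Dc0] := cr z; first by move=> h; apply: zr; exact: sub h.
  by rewrite addr0; split => // w; rewrite Dvc Dc0 Dv0 addr0.
- have mT := mset_setT.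
  have mv w : mfun setT ('D_w v) by exact: smooth_mfun.
  have mc w : mfun setT ('D_w c) by exact: smooth_mfun.
  have mvc w : mfun setT ('D_w (v \+ c)) by apply: smooth_mfun => n; exact: CnD.
  have H1 : (dirichlet setT ('D_e1 (v \+ c)%R) ('D_e2 (v \+ c)%R) <=
      1%:E * dirichlet setT ('D_e1 v) ('D_e2 v) + 1%:E * dirichlet setT ('D_e1 c) ('D_e2 c))%E.
    apply: (dirichlet_comb mT ler01 ler01) => // z _; rewrite !Dvc !mul1r.
    have [/(sub _ _ _ md) /vd[_ Dv0]|/cr[_ Dc0]] := pselect (ball a (Num.min d r) z).
      by rewrite !Dv0 !add0r expr0n/= add0r add0r.
    by rewrite !Dc0 !addr0 expr0n/= !addr0.
  refine (le_trans H1 _).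
  apply: (@le_trans _ _ ((N%:R * C)%:E + C%:E)%E).
    apply: leeD.
      by rewrite mul1e.
    by rewrite mul1e.
  by rewrite -EFinD -natr1 mulrDl mul1r.
Qed.

(** A quantitative form of the fact that a point has zero capacity in the plane. As [F] is any
    closed set avoiding [a], the lemma serves for the continuum as well as for the boundary of
    [O]. *)
Lemma small_cap O F (a : P2) (e : R) : open O -> closed F -> O a -> ~ F a -> 0 < e ->
  exists2 d, 0 < d & forall A, A `<=` ball a d -> adm_exists F A O /\ cap F A O <= e.
Proof.
move=> oO cF Oa nFa e0.
have [C C0 HC] := log_cutoff.
have oU : open (O `&` ~` F) by apply: openI => //; exact: closed_openC.
have [r r0 rU] := open_box oU (conj Oa nFa).
pose N := (Num.trunc (C / e)).+1.
have NC : C / e <= N%:R by rewrite ltW// truncnS_gt.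
have [v [d d0 [Cv v0 vd vr Dv]]] := HC a r N r0.
exists d => // A Ad; pose u := cst (N%:R^-1) \* v.
have Cu n : Cn n u by apply: CnM => //; exact: Cn_cst.
have [_ [dv _]] := Cv 1%N.
have Du w z : 'D_w u z = N%:R^-1 * 'D_w v z.
  by rewrite /u deriveM// derive_cst scaler0 addr0.
have H : cap_admissible F A O u ('D_e1 u) ('D_e2 u).
  apply: (smooth_adm (S := box a r) oO Cu).
  - by move=> z; rewrite /u /= mulr_ge0// invr_ge0 ltW.
  - exact: box_compact.
  - by move=> z /rU[].
  - move=> w z nz; rewrite Du; have [|_ ->] := vr z; last by rewrite mulr0.
    by move=> /ball_box.
  - exists (~` box a r); split.
      by apply: closed_openC; apply: compact_closed2; exact: box_compact.
    split; first by move=> z Fz /rU[].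
    move=> z nz _; rewrite /u /=; have [|-> _] := vr z; last by rewrite mulr0.
    by move=> /ball_box.
  - exists (ball a d); split; first by have [] := ball_open_nbhs a d0.
    split => // z zd _; rewrite /u /=; have [-> _] := vd z zd.
    by rewrite mulVf ?gt_eqF.
split; first by exists u, ('D_e1 u), ('D_e2 u).
apply: (le_trans (cap_le H)); rewrite -lee_fin -(adm_fin H).
have mT := mset_setT.
have mv w : mfun setT ('D_w v) by exact: smooth_mfun.
have muu w : mfun setT ('D_w u) by exact: smooth_mfun.
have H1 := dirichlet_subset (open_measurable2 oO) (muu e1) (muu e2).
apply: (le_trans H1).
have N2 : 0 <= N%:R^-1 ^+ 2 :> R by rewrite sqr_ge0.
have := @dirichlet_comb _ setT (N%:R^-1 ^+ 2) 0 _ _ _ _ _ _ mT N2 (lexx 0) (mv e1) (mv e2)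
  (mv e1) (mv e2) (muu e1) (muu e2).
move=> /(_ _)/le_trans; apply.
  by move=> z _; rewrite !Du !exprMn mul0r addr0 mulrDr.
rewrite mul0e adde0; apply: (@le_trans _ _ ((N%:R^-1 ^+ 2)%:E * (N%:R * C)%:E)%E).
  by apply: lee_wpmul2l; rewrite ?lee_fin.
rewrite -EFinM lee_fin.
have -> : N%:R^-1 ^+ 2 * (N%:R * C) = C / N%:R by field; rewrite gt_eqF.
by rewrite ler_pdivrMr// mulrC -ler_pdivrMr.
Qed.

Lemma boundary_closed O : open O -> closed (boundary O).
Proof.
move=> oO; rewrite /boundary setDE; apply: closedI; first exact: closed_closure.
by apply: open_closedC; exact: open_interior.
Qed.

Lemma boundary_disj O (a : P2) : open O -> O a -> ~ boundary O a.
Proof.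
move=> oO Oa [_]; apply; have : O `<=` interior O by move: oO; rewrite openE.
exact.
Qed.

Lemma cap_mono F A B O : A `<=` B -> adm_exists F B O -> cap F A O <= cap F B O.
Proof.
move=> AB [v [g1 [g2 H]]]; apply: le_cap; first by exists v, g1, g2.
by move=> w h1 h2 Hw; apply: cap_le; apply: admS Hw.
Qed.

Lemma cap_set0 F O : open O -> adm_exists F set0 O /\ cap F set0 O = 0.
Proof.
move=> oO.
have H : cap_admissible F set0 O (cst 0) ('D_e1 (cst 0)) ('D_e2 (cst 0)).
  apply: (smooth_adm (S := set0)) => //.
  - by move=> n; exact: Cn_cst.
  - exact: compact0.
  - by move=> w z _; exact: derive_cst.
  - by exists setT; split; [exact: openT|split].
  - by exists set0; split; [exact: open0|split].
split; first by do 3 eexists; exact: H.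
apply/eqP; rewrite eq_le cap_ge0 andbT; apply: (le_trans (cap_le H)).
rewrite /dirichlet integral0_eq// => z _.
by rewrite !derive_cst expr0n/= addr0.
Qed.

(** One function serves every [l]: 1 minus a cutoff of [F] supported in [V] equals 1 outside [V].
    Hence the uniform bound. *)
Lemma adm_out O F V : domain O -> cap_pair O F V -> exists C, forall l,
  adm_exists F (l `\` V) O /\ cap F (l `\` V) O <= C.
Proof.
move=> [oO _] [[cF _] [FO [[oV _] [FV [cV [VO _]]]]]].
have [th [S [W [Ct t01 [oW [FW W1]] [cS [SV S0]]]]]] := cutoff cF oV FV.
pose eta := cst 1 \+ (\- th).
have Ce n : Cn n eta by apply: CnD; [exact: Cn_cst|exact: CnN].
have [_ [dt _]] := Ct 1%N.
have H l : cap_admissible F (l `\` V) O eta ('D_e1 eta) ('D_e2 eta).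
  apply: (smooth_adm (S := S)) => //.
  - by move=> z; rewrite /eta /= subr_ge0; case/andP: (t01 z).
  - by apply: subset_trans SV _; apply: subset_trans VO; exact: subset_closure.
  - move=> w z nS; rewrite /eta deriveB// derive_cst (derive_support w cS S0)//.
    by rewrite subr0.
  - by exists W; split => //; split => // z Wz _; rewrite /eta /= W1// subrr.
  - exists (~` S); split; first by apply: closed_openC; exact: compact_closed2.
    split; first by move=> z [_ nV] /SV.
    by move=> z nS _; rewrite /eta /= S0// subr0.
exists (fine (dirichlet O ('D_e1 eta) ('D_e2 eta))) => l; split; last exact: cap_le (H l).
by do 3 eexists; exact: H.
Qed.

(** Again one function for every [l]: a cutoff equal to 1 near the closure of [V], whose compact
    support in [O] stays away from the boundary. *)
Lemma adm_in O F V : domain O -> cap_pair O F V -> exists C, forall l,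
  adm_exists (boundary O) (l `&` V) O /\ cap (boundary O) (l `&` V) O <= C.
Proof.
move=> [oO _] [[cF _] [FO [[oV _] [FV [cV [VO _]]]]]].
have [th [S [W [Ct t01 [oW [VW W1]] [cS [SO S0]]]]]] := cutoff cV oO VO.
have H l : cap_admissible (boundary O) (l `&` V) O th ('D_e1 th) ('D_e2 th).
  apply: (smooth_adm (S := S)) => //.
  - by move=> z; case/andP: (t01 z).
  - by move=> w z nS; rewrite (derive_support w cS S0).
  - exists (~` S); split; first by apply: closed_openC; exact: compact_closed2.
    split; first by move=> z bz /SO Oz; exact: (boundary_disj oO Oz).
    by move=> z nS _; rewrite S0.
  - exists W; split => //; split => [z [_ Vz]|z Wz _]; last by rewrite W1.
    by apply: VW; exact: subset_closure.
exists (fine (dirichlet O ('D_e1 th) ('D_e2 th))) => l; split; last exact: cap_le (H l).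
by do 3 eexists; exact: H.
Qed.

(** * Weights of curves and the metric they define *)

Definition weight O F V l : R :=
  Num.sqrt (cap F (l `\` V) O) + Num.sqrt (cap (boundary O) (l `&` V) O).

Section Pair.
Variables (O F V : set P2).
Hypotheses (dO : domain O) (cp : cap_pair O F V).

Lemma weight_ge0 l : 0 <= weight O F V l.
Proof. by rewrite addr_ge0 ?sqrtr_ge0. Qed.

Lemma weight_bounded : exists2 C, 0 < C & forall l, weight O F V l <= C.
Proof.
have [C1 H1] := adm_out dO cp; have [C2 H2] := adm_in dO cp.
exists (Num.sqrt `|C1| + Num.sqrt `|C2| + 1).
  by rewrite ltr_wpDl// addr_ge0 ?sqrtr_ge0.
move=> l; rewrite -[leLHS]addr0 lerD// /weight lerD// ler_sqrt//.
  exact: le_trans (H1 l).2 (ler_norm _).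
exact: le_trans (H2 l).2 (ler_norm _).
Qed.

Lemma weight_mono l l' : l `<=` l' -> weight O F V l <= weight O F V l'.
Proof.
have [C1 H1] := adm_out dO cp; have [C2 H2] := adm_in dO cp.
move=> ll; rewrite /weight lerD// ler_sqrt ?cap_ge0//.
  by apply: cap_mono (H1 _).1; exact: setSD.
by apply: cap_mono (H2 _).1; exact: setSI.
Qed.

Lemma weightU l l' : weight O F V (l `|` l') <= weight O F V l + weight O F V l'.
Proof.
have oO := dO.1.
have [C1 H1] := adm_out dO cp; have [C2 H2] := adm_in dO cp.
rewrite /weight addrACA setDUl setIUl lerD// sqrt_capU//;
  by [exact: (H1 _).1|exact: (H2 _).1].
Qed.

Lemma rho_lb (x y : P2) : lbound [set weight O F V l
  | l in [set l | exists c, rect_curve O x y c /\ l = c @` @I01 R]] 0.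
Proof. by move=> _ [l _ <-]; exact: weight_ge0. Qed.

Lemma rho_le (x y : P2) c : rect_curve O x y c -> rho O F V x y <= weight O F V (c @` @I01 R).
Proof.
move=> H; apply: ge_inf; first by exists 0; exact: rho_lb.
by exists (c @` @I01 R) => //; exists c.
Qed.

Lemma le_rho (x y : P2) (d : R) : O x -> O y ->
  (forall c, rect_curve O x y c -> d <= weight O F V (c @` @I01 R)) ->
  d <= rho O F V x y.
Proof.
move=> Ox Oy Hd; apply: lb_le_inf.
  have [c Hc] := rect_connected dO Ox Oy.
  by exists (weight O F V (c @` @I01 R)), (c @` @I01 R) => //; exists c.
by move=> _ [_ [c [Hc ->]] <-]; exact: Hd.
Qed.

Lemma rho_ge0 (x y : P2) : O x -> O y -> 0 <= rho O F V x y.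
Proof. by move=> Ox Oy; apply: le_rho => // c _; exact: weight_ge0. Qed.

Lemma rho_near (x y : P2) (e : R) : O x -> O y -> 0 < e ->
  exists2 c, rect_curve O x y c & weight O F V (c @` @I01 R) < rho O F V x y + e.
Proof.
move=> Ox Oy e0; apply: contrapT => H.
have : rho O F V x y + e <= rho O F V x y.
  apply: le_rho => // c Hc; rewrite leNgt; apply/negP => h.
  by apply: H; exists c.
by rewrite gerDl leNgt e0.
Qed.

Lemma rho_triangle (x y z : P2) : O x -> O y -> O z ->
  rho O F V x z <= rho O F V x y + rho O F V y z.
Proof.
move=> Ox Oy Oz; apply/ler_addgt0Pr => e e0.
have e2 : 0 < e / 2 by rewrite divr_gt0.
have [c Hc lc] := rho_near Ox Oy e2; have [d Hd ld] := rho_near Oy Oz e2.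
have [k [Hk kcd]] := rect_curve_cat Hc Hd.
have := rho_le Hk; have := weight_mono kcd.
have := weightU (c @` @I01 R) (d @` @I01 R); lra.
Qed.

(** Euclidean closeness implies closeness for [rho]. This makes a sequence that returns near a point
    of [O] in the Euclidean sense return near it for [rho]. *)
Lemma rho_small (a : P2) (e : R) : O a -> 0 < e ->
  exists2 d, 0 < d & forall z, ball a d z -> O z /\ rho O F V z a <= e.
Proof.
move=> Oa e0; have oO := dO.1.
have [[cF _] [FO [[oV _] [FV _]]]] := cp.
pose e' := (e / 2) ^+ 2.
have e'0 : 0 < e' by rewrite exprn_gt0// divr_gt0.
have se' : Num.sqrt e' = e / 2 by rewrite sqrtr_sqr gtr0_norm// divr_gt0.
have [d1 d10 H1] := small_cap oO (boundary_closed oO) Oa (boundary_disj oO Oa) e'0.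
(* If [a] is in [V], a short segment at [a] has no part outside [V]; otherwise [a] is not in [F] and
   the smallness of capacity near a point applies. *)
have [d2 d20 H2] : exists2 d, 0 < d & forall l, l `<=` ball a d -> cap F (l `\` V) O <= e'.
  have [Va|nVa] := pselect (V a).
    have [r r0 aV] := open_box oV Va; exists r => // l lr.
    rewrite (_ : l `\` V = set0) ?(cap_set0 F oO).2 ?ltW//.
    by apply/seteqP; split => // z [/lr/ball_box/aV].
  have nFa : ~ F a by move=> /FV.
  have [d d0 H] := small_cap oO (compact_closed2 cF) Oa nFa e'0.
  by exists d => // l ld; apply: (H _ _).2; apply: subset_trans ld => z [].
have [d3 d30 H3] := open_box oO Oa.
pose d := Num.min d1 (Num.min d2 d3).
have d0 : 0 < d by rewrite !lt_min d10 d20.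
have dd1 : d <= d1 by rewrite ge_min lexx.
have dd2 : d <= d2 by rewrite !ge_min lexx orbT.
have dd3 : d <= d3 by rewrite !ge_min lexx !orbT.
have dd : d / 2 < d by rewrite ltr_pdivrMr// ltr_pMr// ltr1n.
have bO : box a (d / 2) `<=` O.
  by move=> z /(box_ball dd)/ball_box zd; apply: H3; move: zd => /boxP[h1 h2];
    apply/boxP; split; exact: le_trans dd3.
exists (d / 2); first by rewrite divr_gt0.
move=> z /ball_box az; split; first exact: bO.
have aa : box a (d / 2) a by apply/boxP; rewrite !subrr normr0 divr_ge0// ltW.
have [c [Hc ca]] := rect_curve_segment bO az aa.
apply: (le_trans (rho_le Hc)).
have sub (t : R) : d <= t -> c @` @I01 R `<=` ball a t.
  by move=> dt w /ca/(box_ball dd); exact: le_ball.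
have h1 : cap (boundary O) (c @` @I01 R `&` V) O <= e'.
  by apply: (H1 _ _).2 => w [/(sub _ dd1)].
have h2 := H2 _ (sub _ dd2).
rewrite /weight [leRHS](splitr e) -se'; apply: lerD; rewrite ler_sqrt// ltW//.
Qed.

End Pair.
End Rho.

(** * Absolute continuity on lines *)

Section AeNonneg.
Context {R : realType}.
Notation la := (@lebesgue_measure R).

Lemma ae_mp d (T : measurableType d) (m : {measure set T -> \bar R}) (P Q : T -> Prop) :
  (\forall x \ae m, P x) -> (\forall x \ae m, P x -> Q x) -> \forall x \ae m, Q x.
Proof. by apply: filterS2 => x Px; exact. Qed.

Lemma ae_impl d (T : measurableType d) (m : {measure set T -> \bar R}) (P Q : T -> Prop) :
  (\forall x \ae m, P x) -> (forall x, P x -> Q x) -> \forall x \ae m, Q x.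
Proof. by move=> H PQ; move: H; apply: filterS. Qed.

Lemma ae_neq (c : R) : \forall x \ae la, x <> c.
Proof.
exists [set c]; split => //; first exact: lebesgue_measure_set1.
by move=> x /= /contrapT.
Qed.

Lemma nondecreasing_derive_ge0 (F : R -> R) (x : R) : derivable F x 1 ->
  {homo F : x y / x <= y} -> 0 <= 'D_1 F x.
Proof.
move=> dF hF; rewrite /derive; apply: limr_ge => //.
near=> h => /=; rewrite /GRing.scale/= mulr1.
have : h != 0 by near: h; exact: nbhs_dnbhs_neq.
rewrite neq_lt => /orP[h0|h0].
  by apply: mulr_le0; [rewrite invr_le0 ltW|rewrite subr_le0 hF// gerDr ltW].
by apply: mulr_ge0; [rewrite invr_ge0 ltW|rewrite subr_ge0 hF// lerDr ltW].
Unshelve. all: by end_near. Qed.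

Lemma step_lim (c : R) : (fun n : nat => step (n%:R * c)) @ \oo --> (if 0 < c then 1 else 0 : R).
Proof.
case: ifPn => [c0|]; last first.
  rewrite -leNgt => c0; rewrite (_ : (fun _ => _) = cst 0); first exact: cvg_cst.
  by apply/funext => n; rewrite step_le0// mulr_ge0_le0.
apply: (@cvg_trans _ (cst 1 @ \oo)); last exact: cvg_cst.
apply: near_eq_cvg; near=> n; rewrite step_ge1//.
rewrite -ler_pdivrMr// mul1r; near: n; exact: nbhs_infty_ger.
Unshelve. all: by end_near. Qed.

Lemma Cn_step_lin n (p k : R) : Cn n (fun x : R => step (k * (x - p))).
Proof.
apply: (@Cn_step _ _ n (fun x : R => k * (x - p))).
apply: CnM; first exact: Cn_cst.
by apply: CnD; [exact: Cn_id|exact: Cn_cst].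
Qed.

Lemma Cn_step_lin_rev n (p k : R) : Cn n (fun x : R => step (k * (p - x))).
Proof.
apply: (@Cn_step _ _ n (fun x : R => k * (p - x))).
apply: CnM; first exact: Cn_cst.
by apply: CnD; [exact: Cn_cst|apply: CnN; exact: Cn_id].
Qed.

(** Smooth products of steps increase to indicators of intervals, so by dominated convergence all
    integrals of [h] over intervals inside [a, b] are nonnegative. The primitive of the extension of
    [h] by 0 is then nondecreasing, and by Lebesgue differentiation its derivative is [h] almost
    everywhere on [a, b]. *)
Lemma ae_nonneg (h : R -> R) (a b : R) : a < b ->
  la.-integrable `[a, b] (EFin \o h) ->
  (forall phi : R -> R, (forall n, Cn n phi) -> (forall x, 0 <= phi x <= 1) ->
    (forall x, ~ (a <= x <= b) -> phi x = 0) ->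
    (0 <= \int[la]_(x in `[a, b]) (phi x * h x)%:E)%E) ->
  \forall x \ae la, a <= x <= b -> 0 <= h x.
Proof.
move=> ab ih Hphi; pose H := h \_ `[a, b].
have iH : la.-integrable setT (EFin \o H).
  have := (@integrable_mkcond _ _ _ la `[a, b] (EFin \o h) (measurable_itv _)).1 ih.
  by rewrite /H restrict_EFin.
have iHS (D : set R) : measurable D -> la.-integrable D (EFin \o H).
  by move=> mD; apply: (@integrableS _ _ _ la setT).
have pos (p q : R) : (0 <= \int[la]_(x in `]p, q]) (H x)%:E)%E.
  pose p' := Num.max p a; pose q' := Num.min q b.
  (* As [n] grows this tends to the indicator of the open interval between p' and q'; clipping [p]
     and [q] to [a, b] keeps the support where [Hphi] applies. *)
  pose phi (n : nat) (x : R) := step (n%:R * (x - p')) * step (n%:R * (q' - x)).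
  have Cphi n m : Cn m (phi n) by apply: CnM; [exact: Cn_step_lin|exact: Cn_step_lin_rev].
  have phi01 n x : 0 <= phi n x <= 1.
    by rewrite mulr_ge0 ?step_ge0// mulr_ile1 ?step_ge0 ?step_le1.
  have phi0 n x : ~ (p' < x < q') -> phi n x = 0.
    move=> nx; rewrite /phi; have [px|px] := ltP p' x; last first.
      by rewrite step_le0 ?mul0r// mulr_ge0_le0// subr_le0.
    rewrite [X in _ * X]step_le0 ?mulr0// mulr_ge0_le0// subr_le0 leNgt.
    by apply/negP => xq; apply: nx; rewrite px.
  have pq_ab x : p' < x < q' -> a <= x <= b.
    rewrite /p' /q' gt_max lt_min => /andP[/andP[_ ax] /andP[_ xb]].
    by rewrite !ltW.
  pose L x := (if p' < x < q' then h x else 0)%:E.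
  have mab : measurable (`[a, b]%classic : set R) by exact: measurable_itv.
  have mh : measurable_fun `[a, b] (EFin \o h) by case/integrableP: ih.
  have mphi n : measurable_fun `[a, b] (fun x => (phi n x * h x)%:E).
    apply/measurable_EFinP; apply: measurable_funM; last exact/measurable_EFinP.
    by apply: measurable_funTS; apply: continuous_measurable_fun; exact: Cn_continuous (Cphi n 0%N).
  have lim x : (fun n => (phi n x * h x)%:E) @ \oo --> L x.
    apply: cvg_EFin; first by near=> n.
    rewrite (_ : (if _ then _ else _) = (if 0 < x - p' then 1 else 0) * (if 0 < q' - x then 1 else 0) * h x).
      by apply: cvgM; [apply: cvgM; exact: step_lim|exact: cvg_cst].
    rewrite !subr_gt0; case: (p' < x); case: (x < q'); rewrite /= ?mul1r ?mul0r ?mulr0 ?mul0r//.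
  have mL : measurable_fun `[a, b] L.
    by apply: (emeasurable_fun_cvg (fun n x => (phi n x * h x)%:E)) => // x _; exact: lim.
  have dom : \forall x \ae la, forall n : nat, `[a, b]%classic x ->
      (`|(phi n x * h x)%:E| <= (abse \o (EFin \o h)) x)%E.
    apply: aeW => x n _; rewrite /= lee_fin normrM ler_piMl//.
    by have /andP[? ?] := phi01 n x; rewrite ger0_norm.
  have limae : \forall x \ae la, `[a, b]%classic x -> (fun n => (phi n x * h x)%:E) @ \oo --> L x.
    by apply: aeW => x _; exact: lim.
  have [_ _ cv] := @dominated_convergence _ (measurableTypeR R) R la `[a, b]%classic mab
    (fun n x => (phi n x * h x)%:E) L _ mphi mL limae (integrable_abse ih) dom.
  have L0 : (0 <= \int[la]_(x in `[a, b]) L x)%E.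
    rewrite -(cvg_lim _ cv)//; apply: lime_ge; first by apply/cvg_ex; eexists; exact: cv.
    apply: nearW => n; apply: Hphi => // x nx; apply: phi0 => /pq_ab; exact: nx.
  apply: (le_trans L0); rewrite le_eqVlt; apply/orP; left; apply/eqP.
  rewrite integral_mkcond [RHS]integral_mkcond.
  apply: ae_eq_integral => //.
  - exact/(measurable_restrictT _ mab).
  - apply/(measurable_restrictT _ (measurable_itv _)).
    by case/integrableP: (iHS _ (measurable_itv `]p, q])).
  (* The limit involves open intervals while [H] and the domain involve closed endpoints; the
     difference lies in the three points removed here. *)
  - apply: (ae_mp (ae_neq q)); apply: (ae_mp (ae_neq b)); apply: (ae_impl (ae_neq a)).
    move=> x xa xb xq _; rewrite /patch /H /L /patch /= !mem_setE !in_itv /=.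
    rewrite /p' /q' gt_max lt_min.
    have -> : (x <= q) = (x < q) by rewrite [LHS]le_eqVlt; case: eqP.
    have -> : (x <= b) = (x < b) by rewrite [LHS]le_eqVlt; case: eqP.
    have -> : (a <= x) = (a < x) by rewrite [LHS]le_eqVlt; case: eqP => // /esym.
    by case: (p < x); case: (x < q); case: (x < b); case: (a < x).
have hF : {homo (fun x => \int[la]_(t in `]-oo, x]) H t) : x y / x <= y}.
  move=> x y xy; rewrite -subr_ge0 Rintegral_itvB//.
  - by rewrite /Rintegral fine_ge0// pos.
  - exact: iHS.
apply: (ae_impl (@FTC1Ny R H (fun y => iHS _ (measurable_itv _)) (open_integrable_locally openT iH))).
move=> x [dF EF] xab.
have := nondecreasing_derive_ge0 dF hF.
rewrite -derive1E EF /H /patch ifT//.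
by rewrite inE /= in_itv.
Unshelve. all: by end_near. Qed.

End AeNonneg.

(** * Smooth ramps whose derivatives approximate a point mass *)

Section Kernel.
Context {R : realType}.
Notation la := (@lebesgue_measure R).

Lemma Cn_step0 n : Cn n (@step R).
Proof. exact: (@Cn_step _ _ n id (Cn_id n)). Qed.

Lemma derivable_step (t : R) : derivable (@step R) t 1.
Proof. by have [_ [d _]] := Cn_step0 1%N; exact: d. Qed.

Lemma continuous_Dstep : continuous ('D_(1 : R) (@step R)).
Proof. by have [_ [_ D]] := Cn_step0 1%N; exact: (D 1).1. Qed.

Lemma Dstep_out (t : R) : ~ (0 <= t <= 1) -> 'D_1 (@step R) t = 0.
Proof.
move=> nt; have [t0|t0] := ltP t 0.
  rewrite -(derive_cst (0 : R) t (1 : R)); apply: near_eq_derive => //.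
  near=> u; rewrite /= step_le0// ltW//; near: u; exact: lt_nbhsl.
have t1 : 1 < t by rewrite ltNge; apply/negP => t1; apply: nt; rewrite t0.
rewrite -(derive_cst (1 : R) t (1 : R)); apply: near_eq_derive => //.
near=> u; rewrite /= step_ge1// ltW//; near: u; exact: lt_nbhsr.
Unshelve. all: by end_near. Qed.

Lemma Dstep_bound : exists2 M : R, 0 < M & forall t, `|'D_1 (@step R) t| <= M.
Proof.
have cD : {within `[(0 : R), 1], continuous ('D_(1 : R) (@step R))}.
  by apply: continuous_subspaceT; exact: continuous_Dstep.
have /compact_bounded[M [Mr HM]] := continuous_compact cD (@segment_compact R 0 1).
exists (`|M| + 1); first by rewrite ltr_wpDl.
move=> t; have [t01|nt] := pselect (0 <= t <= 1); last first.
  by rewrite Dstep_out// normr0 addr_ge0.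
apply: (HM (`|M| + 1)); first by rewrite ltr_pwDr// ler_norm.
by exists t => //=; rewrite in_itv.
Qed.

(** For k > 0 it rises from 0 at [s] to 1 at [s + k^-1], so its derivative is a smooth kernel of
    integral 1 located just to the right of [s]. *)
Definition ramp (k s : R) (y : R) : R := step (k * (y - s)).

Lemma Cn_ramp n k s : Cn n (ramp k s).
Proof. exact: Cn_step_lin. Qed.

Lemma Dramp k s y : 'D_1 (ramp k s) y = k * 'D_1 (@step R) (k * (y - s)).
Proof.
have dL : is_derive y 1 (fun y : R => k * (y - s)) k.
  have d0 : is_derive y 1 (fun y : R => y - s) (1 : R).
    by have := is_deriveB (is_derive_id y (1 : R)) (is_derive_cst s y (1 : R)); rewrite subr0.
  by have := is_deriveZ k d0; rewrite [k%:A]mulr1.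
have dS : is_derive (k * (y - s)) 1 (@step R) ('D_1 (@step R) (k * (y - s))).
  by apply: derivableP; exact: derivable_step.
by have := @is_derive1_comp R (@step R) (fun y : R => k * (y - s)) y _ _ dS dL; rewrite mulrC => -[].
Qed.

(** The kernel has integral 1 and is bounded by k M on an interval of length 1/k, where M bounds the
    derivative of [step]; its total mass in absolute value is thus at most M for every k. *)
Lemma Dramp_approx : exists2 M : R, 0 < M & forall (u : R -> R) (c d s k e : R),
  0 < k -> c <= s -> s + k^-1 <= d -> {within `[c, d], continuous u} ->
  (forall y, s <= y <= s + k^-1 -> `|u y - u s| <= e) ->
  `|\int[la]_(y in `[c, d]) (u y * 'D_1 (ramp k s) y) - u s| <= M * e.
Proof.
have [M M0 HM] := Dstep_bound; exists M => // u c d s k e k0 cs sd cu ue.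
have k'0 : 0 < k^-1 by rewrite invr_gt0.
have cd : c < d by lra.
have cK : continuous (fun y => 'D_1 (ramp k s) y).
  by have [_ [_ D]] := Cn_ramp 1 k s; exact: (D 1).1.
have mcd : @measurable _ (measurableTypeR R) `[c, d]%classic by exact: measurable_itv.
have I (w : R -> R) : {within `[c, d], continuous w} ->
    la.-integrable `[c, d] (EFin \o (fun y => w y * 'D_1 (ramp k s) y)).
  move=> cw; apply: continuous_compact_integrable; first exact: segment_compact.
  move=> y; apply: cvgM; first exact: cw.
  exact: (continuous_subspaceT cK).
have I1 := I _ cu.
have ccst (w : R) : {within `[c, d], continuous (cst w : R -> R)}.
  by apply: continuous_subspaceT; exact: cst_continuous.
have I2 := I _ (ccst (u s)).
have IK : la.-integrable `[c, d] (EFin \o (fun y => 'D_1 (ramp k s) y)).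
  by apply: continuous_compact_integrable; [exact: segment_compact|exact: continuous_subspaceT].
have E1 : \int[la]_(y in `[c, d]) 'D_1 (ramp k s) y = 1.
  rewrite /Rintegral FTC2_smooth//=; last by move=> y; have [_ [D _]] := Cn_ramp 1 k s; exact: D.
  rewrite /ramp step_ge1; last by rewrite mulrC -ler_pdivrMr// div1r; lra.
  have h : k * (c - s) <= 0 by apply: mulr_ge0_le0; [exact: ltW|rewrite subr_le0].
  by rewrite step_le0 ?subr0.
have -> : \int[la]_(y in `[c, d]) (u y * 'D_1 (ramp k s) y) - u s =
   \int[la]_(y in `[c, d]) ((u y - u s) * 'D_1 (ramp k s) y).
  rewrite -[X in _ - X]mulr1 -[X in u s * X]E1 -RintegralZl// -RintegralB//.
  by apply: eq_Rintegral => y _; rewrite mulrBl.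
have cus : {within `[c, d], continuous (fun y => u y - u s)}.
  by move=> y; apply: cvgB; [exact: cu|exact: cvg_cst].
have I3 := I _ cus.
refine (le_trans (le_normr_Rintegral mcd I3) _).
have out y : ~ (s <= y <= s + k^-1) -> 'D_1 (ramp k s) y = 0.
  move=> ny; rewrite Dramp Dstep_out ?mulr0// => /andP[h1 h2]; apply: ny.
  move: h1; rewrite pmulr_rge0// subr_ge0 => -> /=.
  by move: h2; rewrite mulrC -ler_pdivlMr// div1r lerBlDl.
have sub : `[s, s + k^-1]%classic `<=` (`[c, d]%classic : set R).
  by move=> y /=; rewrite !in_itv /=; lra.
have -> : \int[la]_(y in `[c, d]) `|(u y - u s) * 'D_1 (ramp k s) y| =
   \int[la]_(y in `[s, s + k^-1]) `|(u y - u s) * 'D_1 (ramp k s) y|.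
  rewrite Rintegral_mkcond [RHS]Rintegral_mkcond; apply: eq_Rintegral => y _.
  rewrite /patch !mem_setE !in_itv /=; case: ifPn => [/andP[cy yd]|ncd].
    case: ifPn => // /negP ny; rewrite out ?mulr0 ?normr0//; exact: ny.
  case: ifPn => // sy; exfalso; move/negP: ncd; apply; lra.
have ms : @measurable _ (measurableTypeR R) `[s, s + k^-1]%classic by exact: measurable_itv.
have I4 : la.-integrable `[s, s + k^-1] (EFin \o (fun y => `|(u y - u s) * 'D_1 (ramp k s) y|)).
  have := integrable_abse (integrableS mcd ms sub I3).
  by apply: eq_integrable => // y _.
have I5 : la.-integrable `[s, s + k^-1] (EFin \o cst (e * (k * M))).
  by apply: continuous_compact_integrable; [exact: segment_compact|exact/continuous_subspaceT/cst_continuous].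
apply: (@le_trans _ _ (\int[la]_(y in `[s, s + k^-1]) (e * (k * M)))).
  apply: le_Rintegral => // y; rewrite /= in_itv /= => ys; rewrite normrM.
  by rewrite ler_pM ?ue// Dramp normrM gtr0_norm// ler_pM2l.
have L : la `[s, s + k^-1] = (k^-1)%:E.
  rewrite lebesgue_measure_itv /= lte_fin ltrDl k'0 -EFinD; congr (_%:E).
  by rewrite addrAC subrr add0r.
rewrite Rintegral_cst// [X in fine X]L /=.
by rewrite le_eqVlt; apply/orP; left; apply/eqP; field; rewrite gt_eqF.
Qed.

(** Balls of radius [r c] cover [Q] while the oscillation is controlled on the doubled balls; this
    leaves room for a displacement [d] below all the radii. *)
Lemma compact_unif_cont (f : R * R -> R) (Q : set (R * R)) (e : R) : compact Q ->
  {within Q, continuous f} -> 0 < e ->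
  exists2 d, 0 < d & forall z w, Q z -> Q w -> ball z d w -> `|f z - f w| < e.
Proof.
move=> cQ /subspace_continuousP cf e0.
have e20 : 0 < e / 2 by rewrite divr_gt0.
have H z : exists r, Q z -> 0 < r /\ forall w, Q w -> ball z (2 * r) w -> `|f z - f w| < e / 2.
  have [Qz|nQ] := pselect (Q z); last by exists 0.
  have : nbhs (f z) (ball (f z) (e / 2)) by exact: nbhsx_ballx.
  move=> /(cf z Qz) /nbhs_ballP[r /= r0 Hr]; exists (r / 2) => _.
  split; first by rewrite divr_gt0.
  move=> w Qw zw; apply: Hr => //; by rewrite mulrC divfK in zw.
have [r Hr] := choice H.
have [s [sQ sc]] := compact_box_cover cQ (fun c Qc => (Hr c Qc).1).
have [d d0 Hd] : exists2 d, 0 < d & forall c, c \in s -> d <= r c.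
  have : forall c, c \in s -> 0 < r c by move=> c /sQ /Hr[].
  elim: (s) => [|c l IH] Hl; first by exists 1.
  have [|d d0 Hd] := IH; first by move=> c' c'l; apply: Hl; rewrite inE c'l orbT.
  exists (Num.min d (r c)); first by rewrite lt_min d0 Hl// inE eqxx.
  move=> c'; rewrite inE => /orP[/eqP->|/Hd]; first by rewrite ge_min lexx orbT.
  by move=> h; rewrite ge_min h.
exists d => // z w Qz Qw zw; have [c cs cz] := sc z Qz.
have [rc0 Hc] := Hr c (sQ c cs).
have h1 : `|f c - f z| < e / 2.
  by apply: Hc => //; apply: le_ball cz; rewrite mulr_natl mulr2n lerDl ltW.
have h2 : `|f c - f w| < e / 2.
  apply: Hc => //; apply: (@le_ball _ _ _ (r c + d)); last exact: ball_triangle zw.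
  by rewrite mulr_natl mulr2n lerD2l Hd.
rewrite (_ : f z - f w = (f c - f w) - (f c - f z)); last by ring.
by apply: (le_lt_trans (ler_normB _ _)); rewrite [ltRHS](splitr e) ltrD.
Qed.

End Kernel.

(** * Oscillation on vertical lines, for a fixed pair of heights *)

Section ACL.
Context {R : realType}.
Notation P2 := (R * R)%type.
Notation mu := (@leb2 R).
Notation la := (@lebesgue_measure R).
Local Notation M1 := (measurableTypeR R).
Local Notation M2 := (measurableTypeR R * measurableTypeR R)%type.
Local Notation mset A := (@measurable _ M2 A).
Local Notation mfun D f := (@measurable_fun _ _ M2 _ D f).
Variables (a b c d : R).
Hypotheses (ab : a < b) (cd : c < d).
Let Q : set P2 := `[a, b] `*` `[c, d].

Lemma rect_measurable : mset Q.
Proof. by apply: measurableX; exact: measurable_itv. Qed.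

Lemma rect_compact : compact Q.
Proof. by apply: compact_setX; exact: segment_compact. Qed.

Lemma seg_measurable (p q : R) : @measurable _ M1 `[p, q]%classic.
Proof. exact: measurable_itv. Qed.

Lemma fubini_rect (h : P2 -> \bar R) : mu.-integrable Q h ->
  la.-integrable `[a, b] (fun x => \int[la]_(y in `[c, d]) h (x, y))%E /\
  (\int[mu]_(z in Q) h z = \int[la]_(x in `[a, b]) \int[la]_(y in `[c, d]) h (x, y))%E.
Proof.
move=> ih.
have iH := (@integrable_mkcond _ _ _ mu Q h rect_measurable).1 ih.
have FE : fubini_F la (h \_ Q) = (fun x => \int[la]_(y in `[c, d]) h (x, y))%E \_ `[a, b].
  apply/funext => x; rewrite /fubini_F /patch.
  case: ifPn => xab; rewrite ?mem_setE ?in_itv /= in xab.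
    rewrite [RHS]integral_mkcond; apply: eq_integral => y _; rewrite /patch.
    have -> : ((x, y) \in Q) = (y \in `[c, d]%classic) => //.
    by apply/idP/idP; rewrite !inE /Q /= !in_itv /= xab => // -[].
  rewrite integral0_eq// => y _; rewrite ifF//.
  by apply/negP; rewrite inE => -[/=]; rewrite in_itv /= (negbTE xab).
split.
  apply: (@integrable_mkcond _ _ _ la `[a, b] _ (seg_measurable a b)).2.
  by rewrite -FE; exact: integrable_fubini_F.
rewrite integral_mkcond -(fubini1 iH) [RHS]integral_mkcond.
by congr (integral _ _ _).
Qed.

Lemma cont_slice1 (f : P2 -> R) (s : R) : c <= s <= d -> {within Q, continuous f} ->
  {within `[a, b], continuous (fun x => f (x, s))}.
Proof.
move=> scd /subspace_continuousP cf; apply/subspace_continuousP => x xab A HA.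
have Qx : Q (x, s) by split => //=; rewrite in_itv.
have /nbhs_ballP[r /= r0 Hr] := cf _ Qx _ HA.
apply/nbhs_ballP; exists r => //= y xy yab; apply: Hr; last by split => //=; rewrite in_itv.
by split => //=; exact: ballxx.
Qed.

Lemma cont_slice2 (f : P2 -> R) (x : R) : a <= x <= b -> {within Q, continuous f} ->
  {within `[c, d], continuous (fun y => f (x, y))}.
Proof.
move=> xab /subspace_continuousP cf; apply/subspace_continuousP => s scd A HA.
have Qx : Q (x, s) by split => //=; rewrite in_itv.
have /nbhs_ballP[r /= r0 Hr] := cf _ Qx _ HA.
apply/nbhs_ballP; exists r => //= y xy yab; apply: Hr; last by split => //=; rewrite in_itv.
by split => //=; exact: ballxx.
Qed.

Lemma measurable_slice (g : P2 -> R) (x : R) : a <= x <= b -> mfun Q g ->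
  measurable_fun (`[c, d] : set M1) (fun y => g (x, y)).
Proof.
move=> xab mg; have mgT := (measurable_restrictT g rect_measurable).1 mg.
have := measurable_fun_pair2 (x : M1) mgT.
move=> /(measurable_funS measurableT (@subsetT _ `[c, d])).
apply: eq_measurable_fun => y; rewrite inE /= in_itv /= => ycd.
by rewrite /patch ifT// inE; split => //=; rewrite in_itv.
Qed.

(* g is the weak derivative of f in the second variable, tested only against
   products phi(x) psi(y). *)
Definition ibp (f g : P2 -> R) := forall phi psi : R -> R,
  (forall n, Cn n phi) -> (forall n, Cn n psi) ->
  (forall x, ~ (a <= x <= b) -> phi x = 0) -> (forall y, ~ (c <= y <= d) -> psi y = 0) ->
  (\int[mu]_(z in Q) (f z * (phi z.1 * 'D_1 psi z.2))%:E =
   - \int[mu]_(z in Q) (g z * (phi z.1 * psi z.2))%:E)%E.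

Lemma norm_phi (p u v w : R) : 0 <= p <= 1 -> `|u - v| <= w -> p * v <= p * u + w.
Proof. by rewrite ler_norml; nra. Qed.

Lemma norm_sub4 (p q u v w : R) : `|p - u| <= w -> `|q - v| <= w ->
  `|p - q - (u - v)| <= 2 * w.
Proof.
move=> h1 h2; rewrite (_ : _ - _ = (p - u) - (q - v)); last by ring.
by apply: (le_trans (ler_normB _ _)); rewrite mulr_natl mulr2n lerD.
Qed.

(* psi is a smooth approximation of the indicator of the interval between s and t. *)
Lemma acl_pair (f g : P2 -> R) (s t : R) : mfun Q f -> {within Q, continuous f} ->
  mu.-integrable Q (EFin \o g) -> ibp f g -> c < s < d -> c < t < d ->
  \forall x \ae la, a <= x <= b ->
    f (x, s) - f (x, t) <= fine (\int[la]_(y in `[c, d]) `|g (x, y)|%:E)%E.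
Proof.
move=> mf cf ig Hibp /andP[cs sd] /andP[ct td].
have [M M0 HM] := @Dramp_approx R.
have mab := seg_measurable a b; have mcd := seg_measurable c d.
have mQ := rect_measurable; have cQ := rect_compact.
pose Ge x := (\int[la]_(y in `[c, d]) `|g (x, y)|%:E)%E.
have iabs := integrable_abse ig.
have [iGe _] := fubini_rect iabs.
have {}iGe : la.-integrable `[a, b] Ge by exact: iGe.
pose G x := fine (Ge x).
have iG : la.-integrable `[a, b] (EFin \o G).
  apply: (le_integrable mab _ _ iGe).
    apply/measurable_EFinP; apply: measurableT_comp; first exact: fine_measurable.
    by case/integrableP: iGe.
  by move=> x _; rewrite /= /G; case: (Ge x) => [r| |] //=; rewrite ?leey// normr0.
pose D x := f (x, s) - f (x, t).
have iD : la.-integrable `[a, b] (EFin \o D).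
  apply: continuous_compact_integrable; first exact: segment_compact.
  by move=> x; apply: cvgB; apply: cont_slice1 => //; rewrite !ltW.
(* In this form the inequality can be tested against nonnegative functions of [x] alone, by
   [ae_nonneg]. *)
suff H : \forall x \ae la, a <= x <= b -> 0 <= G x - D x.
  by apply: (ae_impl H) => x Hx /Hx; rewrite subr_ge0.
have ih : la.-integrable `[a, b] (EFin \o (fun x => G x - D x)).
  by have := integrableB mab iG iD; apply: eq_integrable.
apply: (ae_nonneg ab ih) => phi Cphi phi01 phi0.
have cphi : continuous phi := Cn_continuous (Cphi 0%N).
have mphi : measurable_fun (`[a, b] : set M1) phi.
  by apply: measurable_funTS; exact: continuous_measurable_fun.
have Iphi (p : R -> R) : la.-integrable `[a, b] (EFin \o p) ->
    la.-integrable `[a, b] (EFin \o (fun x => phi x * p x)).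
  move=> ip; apply: (le_integrable mab _ _ ip).
    apply/measurable_EFinP; apply: measurable_funM => //; apply/measurable_EFinP.
    by case/integrableP: ip.
  move=> x _; rewrite /= lee_fin normrM ler_piMl//.
  by have /andP[? ?] := phi01 x; rewrite ger0_norm.
suff H : 0 <= \int[la]_(x in `[a, b]) (phi x * (G x - D x)).
  by rewrite -(fineK (integrable_fin_num mab (Iphi _ ih))) lee_fin.
rewrite -[leLHS](subrr (\int[la]_(x in `[a, b]) (phi x * (G x - D x)))).
apply/ler_addgt0Pr => eta eta0; rewrite subrr.
(* Each ramp causes an error M e on every line; both together, integrated over [a, b], make exactly
   [eta]. *)
pose e := eta / (2 * M * (b - a)).
have ba0 : 0 < b - a by rewrite subr_gt0.
have e0 : 0 < e by rewrite divr_gt0// !mulr_gt0.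
have [dl dl0 Hdl] := compact_unif_cont cQ cf e0.
(* The width of the ramps: below the modulus of uniform continuity, and small enough for both ramps
   to reach 1 before [d], so that [psi] vanishes outside [c, d]. *)
pose m := Num.min dl (Num.min (d - s) (d - t)) / 2.
have m0 : 0 < m by rewrite divr_gt0// !lt_min dl0 !subr_gt0 sd td.
have mdl : m < dl by apply: (@lt_le_trans _ _ (Num.min dl (Num.min (d - s) (d - t))));
  rewrite ?ge_min ?lexx// ltr_pdivrMr// ltr_pMr ?ltr1n// !lt_min dl0 !subr_gt0 sd td.
have ms : s + m <= d.
  rewrite -lerBrDl; apply: (@le_trans _ _ (Num.min dl (Num.min (d - s) (d - t)))).
    by rewrite ler_pdivrMr// ler_peMr ?ler1n// !le_min (ltW dl0) !subr_ge0 !ltW.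
  by rewrite !ge_min lexx !orbT.
have mt : t + m <= d.
  rewrite -lerBrDl; apply: (@le_trans _ _ (Num.min dl (Num.min (d - s) (d - t)))).
    by rewrite ler_pdivrMr// ler_peMr ?ler1n// !le_min (ltW dl0) !subr_ge0 !ltW.
  by rewrite !ge_min lexx !orbT.
pose k := m^-1; have k0 : 0 < k by rewrite invr_gt0.
have kK : k^-1 = m by rewrite invrK.
pose psi := ramp k s \+ (\- ramp k t).
have Cpsi n : Cn n psi by apply: CnD; [|apply: CnN]; exact: Cn_ramp.
have dramp r y : derivable (ramp k r) y (1 : R) by have [_ [Dk _]] := Cn_ramp 1 k r; exact: Dk.
have Dpsi y : 'D_1 psi y = 'D_1 (ramp k s) y - 'D_1 (ramp k t) y.
  by rewrite /psi deriveB.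
have ramp01 r y : 0 <= ramp k r y <= 1 by rewrite step_ge0 step_le1.
have psi1 y : `|psi y| <= 1.
  have /andP[p0 p1] := ramp01 s y; have /andP[q0 q1] := ramp01 t y.
  by rewrite /psi /= ler_norml lerBrDl (le_trans _ p0) ?subr_le0//= lerBlDl (le_trans p1)// lerDr.
have ramp_lo r y : y <= r -> ramp k r y = 0.
  move=> yr; rewrite /ramp step_le0//; apply: mulr_ge0_le0; first exact: ltW.
  by rewrite subr_le0.
have ramp_hi r y : r + m <= y -> ramp k r y = 1.
  by move=> yr; rewrite /ramp step_ge1// /k mulrC ler_pdivlMr// mul1r lerBrDl.
have psi0 y : ~ (c <= y <= d) -> psi y = 0.
  move=> ny; have [yc|yc] := ltP y c.
    rewrite /psi /= (ramp_lo s) ?(ramp_lo t) ?subrr//; apply: ltW; exact: lt_trans yc _.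
  have yd : d < y by rewrite ltNge; apply/negP => yd; apply: ny; rewrite yc.
  rewrite /psi /= (ramp_hi s) ?(ramp_hi t) ?subrr//; apply: le_trans (ltW yd) => //.
have cDramp r : continuous (fun y => 'D_1 (ramp k r) y).
  by have [_ [_ Dk]] := Cn_ramp 1 k r; exact: (Dk 1).1.
have If x r : a <= x <= b -> la.-integrable `[c, d] (EFin \o (fun y => f (x, y) * 'D_1 (ramp k r) y)).
  move=> xab; apply: continuous_compact_integrable; first exact: segment_compact.
  move=> y; apply: cvgM; first exact: cont_slice2.
  exact: (continuous_subspaceT (cDramp r)).
pose K x := \int[la]_(y in `[c, d]) (f (x, y) * 'D_1 psi y).
have IK x : a <= x <= b -> la.-integrable `[c, d] (EFin \o (fun y => f (x, y) * 'D_1 psi y)).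
  move=> xab; have := integrableB mcd (If x s xab) (If x t xab).
  by apply: eq_integrable => // y _; rewrite /= Dpsi mulrBr.
have KD x : a <= x <= b -> `|K x - D x| <= 2 * M * e.
  move=> xab.
  have -> : K x = \int[la]_(y in `[c, d]) (f (x, y) * 'D_1 (ramp k s) y) -
      \int[la]_(y in `[c, d]) (f (x, y) * 'D_1 (ramp k t) y).
    rewrite -RintegralB//; try exact: If.
    by apply: eq_Rintegral => y _; rewrite Dpsi mulrBr.
  have est r : c < r -> r + m <= d ->
      `|\int[la]_(y in `[c, d]) (f (x, y) * 'D_1 (ramp k r) y) - f (x, r)| <= M * e.
    move=> cr rd; apply: (HM (fun y => f (x, y)) c d r k e) => //.
    - exact: ltW.
    - by rewrite kK.
    - exact: cont_slice2.
    - rewrite kK => y /andP[ry yr]; apply/ltW/Hdl.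
      + split => //=; rewrite in_itv /= (le_trans (ltW cr) ry).
        exact: le_trans yr rd.
      + split => //=; rewrite in_itv /= (ltW cr).
        by apply: le_trans rd; rewrite lerDl ltW.
      + split => /=; first exact: ballxx.
        rewrite /ball /= ger0_norm ?subr_ge0//; apply: le_lt_trans mdl.
        by rewrite lerBlDl.
  by rewrite -mulrA; apply: norm_sub4; exact: est.
have Qab z : Q z -> a <= z.1 <= b /\ c <= z.2 <= d by case; rewrite /= !in_itv.
have cphi2 : continuous (fun z : P2 => phi z.1).
  exact: Cn_continuous (Cn_fstc (Cphi 0%N)).
have cDpsi2 : continuous (fun z : P2 => 'D_1 psi z.2).
  have [_ [_ Dk]] := Cpsi 1%N.
  exact: Cn_continuous (Cn_sndc (n := 0) (Dk 1)).
have cpsi2 : continuous (fun z : P2 => psi z.2).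
  exact: Cn_continuous (Cn_sndc (Cpsi 0%N)).
have mphi2 : mfun Q (fun z : P2 => phi z.1).
  by apply: measurable_funTS; exact: cont_measurable2.
have mpsi2 : mfun Q (fun z : P2 => psi z.2).
  by apply: measurable_funTS; exact: cont_measurable2.
have IQ : mu.-integrable Q (EFin \o (fun z => f z * (phi z.1 * 'D_1 psi z.2))).
  have [B1 _ HB1] := cont_bounded cQ cf.
  have [B2 _ HB2] := cont_bounded cQ (continuous_subspaceT cDpsi2).
  apply: (bounded_integrable (M := B1 * (1 * B2))) => //.
    apply: measurable_funM => //; apply: measurable_funM => //.
    by apply: measurable_funTS; exact: cont_measurable2.
  move=> z Qz; rewrite !normrM ler_pM ?mulr_ge0 ?HB1// ler_pM ?HB2//.
  by have /andP[? ?] := phi01 z.1; rewrite ger0_norm.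
have mg : mfun Q g by apply/measurable_EFinP; case/integrableP: ig.
have IQ2 : mu.-integrable Q (EFin \o (fun z => g z * (phi z.1 * psi z.2))).
  apply: (le_integrable mQ _ _ ig).
    by apply/measurable_EFinP; apply: measurable_funM => //; exact: measurable_funM.
  move=> z _; rewrite /= lee_fin !normrM ler_piMr// mulr_ile1//.
  by have /andP[? ?] := phi01 z.1; rewrite ger0_norm.
have IQ3 : mu.-integrable Q (EFin \o (fun z => phi z.1 * `|g z|)).
  apply: (le_integrable mQ _ _ ig).
    apply/measurable_EFinP; apply: measurable_funM => //.
    exact: measurableT_comp.
  move=> z _; rewrite /= lee_fin !normrM normr_id ler_piMl//.
  by have /andP[? ?] := phi01 z.1; rewrite ger0_norm.
have [iK1 EK] := fubini_rect IQ; have [iG1 EG] := fubini_rect IQ3.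
have EK1 x : a <= x <= b -> (\int[la]_(y in `[c, d]) (EFin \o (fun z : P2 => f z * (phi z.1 * 'D_1 psi z.2))%R) (x, y) = (phi x * K x)%:E)%E.
  move=> xab; rewrite /= -[in RHS]RintegralZl//; last exact: IK.
  rewrite fineK; last first.
    have I0 : la.-integrable `[c, d] (fun y => (phi x * (f (x, y) * 'D_1 psi y))%:E).
      have := integrableZl mcd (phi x) (IK x xab).
      by apply: eq_integrable => // y _.
    exact: (integrable_fin_num mcd I0).
  by apply: eq_integral => y _; congr (_%:E); ring.
have iphiK : la.-integrable `[a, b] (EFin \o (fun x => phi x * K x)).
  move: iK1; apply: eq_integrable => // x; rewrite inE /= in_itv /= => xab.
  by rewrite -EK1.
have RK : (\int[mu]_(z in Q) (f z * (phi z.1 * 'D_1 psi z.2))%:E = (\int[la]_(x in `[a, b]) (phi x * K x))%:E)%E.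
  rewrite fineK; last exact: integrable_fin_num.
  rewrite EK; apply: eq_integral => x; rewrite inE /= in_itv /= => xab.
  by rewrite -EK1.
have RG : (\int[mu]_(z in Q) (phi z.1 * `|g z|)%:E = (\int[la]_(x in `[a, b]) (phi x * G x))%:E)%E.
  rewrite fineK; last by apply: integrable_fin_num => //; exact: Iphi.
  rewrite EG; apply: ae_eq_integral => //.
  - by case/integrableP: iG1.
  - by case/integrableP: (Iphi _ iG).
  have := integrable_ae mab iGe => H; apply: (ae_impl H) => x Hx xab /=.
  rewrite EFinM /G fineK; last exact: Hx.
  rewrite -ge0_integralZl_EFin//.
  - apply/measurable_EFinP; apply: measurableT_comp => //.
    apply: measurable_slice => //.
  - by case/andP: (phi01 x).
(* Integration by parts replaces the left side by minus the integral of g phi psi, and [psi] is at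
   most 1 in absolute value. *)
have le1 : \int[la]_(x in `[a, b]) (phi x * K x) <= \int[la]_(x in `[a, b]) (phi x * G x).
  rewrite -lee_fin -RK -RG Hibp//.
  apply: (@le_trans _ _ (\int[mu]_(z in Q) `|(g z * (phi z.1 * psi z.2))%:E|)%E).
    apply: le_trans (le_abse_integral _ mQ _); last by case/integrableP: IQ2.
    by rewrite -abseN lee_abs.
  apply: ge0_le_integral => //.
  - by apply: measurableT_comp => //; case/integrableP: IQ2.
  - by case/integrableP: IQ3.
  - move=> z _; rewrite /= lee_fin !normrM mulrCA.
    have /andP[p0 _] := phi01 z.1; rewrite (ger0_norm p0) ler_wpM2l//.
    by rewrite ler_piMr.
have I2 : la.-integrable `[a, b] (EFin \o (fun=> 2 * M * e)).
  by apply: continuous_compact_integrable; [exact: segment_compact|apply: continuous_subspaceT; exact: cst_continuous].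
have le2 : \int[la]_(x in `[a, b]) (phi x * D x) <=
    \int[la]_(x in `[a, b]) (phi x * K x) + 2 * M * e * (b - a).
  have -> : 2 * M * e * (b - a) = \int[la]_(x in `[a, b]) (2 * M * e).
    have L : la `[a, b] = (b - a)%:E by rewrite lebesgue_measure_itv /= lte_fin ab.
    by rewrite Rintegral_cst// [X in fine X]L.
  rewrite -RintegralD//; apply: le_Rintegral => //.
  - exact: Iphi.
  - by have := integrableD mab iphiK I2; apply: eq_integrable.
  - move=> x; rewrite /= in_itv /= => xab; have := KD x xab.
    by apply: norm_phi; exact: phi01.
have -> : \int[la]_(x in `[a, b]) (phi x * (G x - D x)) =
   \int[la]_(x in `[a, b]) (phi x * G x) - \int[la]_(x in `[a, b]) (phi x * D x).
  rewrite -RintegralB//; try exact: Iphi.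
  by apply: eq_Rintegral => x _; rewrite mulrBr.
have <- : 2 * M * e * (b - a) = eta.
  by rewrite /e; field; rewrite !gt_eqF.
by rewrite addrAC subr_ge0; apply: (le_trans le2); rewrite lerD2r.
Qed.

End ACL.

(** * Absolute continuity and energy bounds on almost every line *)

Section Lines.
Context {R : realType}.
Notation P2 := (R * R)%type.
Notation mu := (@leb2 R).
Notation la := (@lebesgue_measure R).
Local Notation M1 := (measurableTypeR R).
Local Notation M2 := (measurableTypeR R * measurableTypeR R)%type.
Local Notation mfun D f := (@measurable_fun _ _ M2 _ D f).

Lemma ae_ge0_Rintegral (D : set M1) (h : R -> R) : measurable D ->
  la.-integrable D (EFin \o h) ->
  (\forall x \ae la, D x -> 0 <= h x) -> 0 <= \int[la]_(x in D) h x.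
Proof.
move=> mD ih H; have mh : measurable_fun D (EFin \o h) by case/integrableP: ih.
suff -> : \int[la]_(x in D) h x = \int[la]_(x in D) `|h x| by apply: Rintegral_ge0.
rewrite /Rintegral; congr fine; apply: ae_eq_integral => //.
  by apply/measurable_EFinP; apply: measurableT_comp => //; exact/measurable_EFinP.
by apply: (ae_impl H) => x Hx Dx /=; rewrite ger0_norm// Hx.
Qed.

Lemma ae_le_Rintegral (D : set M1) (h1 h2 : R -> R) : measurable D ->
  la.-integrable D (EFin \o h1) -> la.-integrable D (EFin \o h2) ->
  (\forall x \ae la, D x -> h1 x <= h2 x) ->
  \int[la]_(x in D) h1 x <= \int[la]_(x in D) h2 x.
Proof.
move=> mD i1 i2 H; rewrite -subr_ge0 -RintegralB//; apply: ae_ge0_Rintegral => //.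
  by have := integrableB mD i2 i1; apply: eq_integrable.
by apply: (ae_impl H) => x Hx Dx; rewrite subr_ge0 Hx.
Qed.

(** Integrates (|g| - m)^2 >= 0 with m the mean of |g|, the choice that makes the resulting
    inequality sharp. *)
Lemma cauchy_schwarz_seg (c d : R) (g : R -> R) : c < d ->
  la.-integrable `[c, d] (EFin \o (fun y => `|g y|)) ->
  la.-integrable `[c, d] (EFin \o (fun y => g y ^+ 2)) ->
  (\int[la]_(y in `[c, d]) `|g y|) ^+ 2 <= (d - c) * \int[la]_(y in `[c, d]) (g y ^+ 2).
Proof.
move=> cd i1 i2; have mcd : @measurable _ M1 `[c, d]%classic by exact: measurable_itv.
have dc0 : 0 < d - c by rewrite subr_gt0.
set A := \int[la]_(y in `[c, d]) `|g y|; set B := \int[la]_(y in `[c, d]) (g y ^+ 2).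
pose m := A / (d - c).
have im : la.-integrable `[c, d] (EFin \o (fun=> m ^+ 2)).
  by apply: continuous_compact_integrable; [exact: segment_compact|apply: continuous_subspaceT; exact: cst_continuous].
have i1' : la.-integrable `[c, d] (EFin \o (fun y => 2 * m * `|g y|)).
  by have := integrableZl mcd (2 * m) i1; apply: eq_integrable.
have i3 : la.-integrable `[c, d] (EFin \o (fun y => 2 * m * `|g y| - m ^+ 2)).
  by have := integrableB mcd i1' im; apply: eq_integrable.
have : \int[la]_(y in `[c, d]) (2 * m * `|g y| - m ^+ 2) <= B.
  apply: le_Rintegral => // y _; rewrite -subr_ge0 -(real_normK (num_real (g y))).
  have -> : `|g y| ^+ 2 - (2 * m * `|g y| - m ^+ 2) = (`|g y| - m) ^+ 2 by ring.
  exact: sqr_ge0.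
have L : la `[c, d] = (d - c)%:E by rewrite lebesgue_measure_itv /= lte_fin cd.
rewrite RintegralB// RintegralZl// Rintegral_cst// [X in fine X]L /= -/A.
have -> : 2 * m * A - m ^+ 2 * (d - c) = A ^+ 2 / (d - c).
  by rewrite /m; field; rewrite gt_eqF.
by rewrite ler_pdivrMr// mulrC.
Qed.

Section Rect.
Variables (a b c d : R).
Hypotheses (ab : a < b) (cd : c < d).
Let Q : set P2 := `[a, b] `*` `[c, d].
Let mab : @measurable _ M1 `[a, b]%classic := seg_measurable a b.
Let mcd : @measurable _ M1 `[c, d]%classic := seg_measurable c d.

Lemma Rfubini (h : P2 -> R) : mu.-integrable Q (EFin \o h) ->
  la.-integrable `[a, b] (EFin \o (fun x => \int[la]_(y in `[c, d]) h (x, y))) /\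
  \int[mu]_(z in Q) h z = \int[la]_(x in `[a, b]) \int[la]_(y in `[c, d]) h (x, y).
Proof.
move=> ih; have [i1 E1] := fubini_rect ih.
have H := integrable_ae mab i1.
have i2 : la.-integrable `[a, b] (EFin \o (fun x => \int[la]_(y in `[c, d]) h (x, y))).
  apply: (le_integrable mab _ _ i1).
    apply/measurable_EFinP; apply: measurableT_comp; first exact: fine_measurable.
    by case/integrableP: i1.
  move=> x _; rewrite /= /Rintegral.
  by case: (integral _ _ _) => [r| |] //=; rewrite ?leey// normr0.
split => //; rewrite /Rintegral E1; congr fine; apply: ae_eq_integral => //.
- by case/integrableP: i1.
- by case/integrableP: i2.
by apply: (ae_impl H) => x Hx xab /=; rewrite fineK// Hx.
Qed.

Lemma integrable_slice (h : P2 -> R) : mfun Q h -> mu.-integrable Q (EFin \o h) ->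
  \forall x \ae la, a <= x <= b -> la.-integrable `[c, d] (EFin \o (fun y => h (x, y))).
Proof.
move=> mh ih; have [i1 _] := fubini_rect (integrable_abse ih).
apply: (ae_impl (integrable_ae mab i1)) => x Hx xab.
apply/integrableP; split; first by apply/measurable_EFinP; exact: (measurable_slice xab mh).
have := Hx; rewrite /= in_itv /= => /(_ xab).
by rewrite ge0_fin_numE//; exact: integral_ge0.
Qed.

(** The null set of [acl_pair] depends on the two heights. Countably many rational pairs give one
    null set, and continuity of [f] then reaches all heights, the endpoints included. *)
Lemma acl (f g : P2 -> R) : mfun Q f -> {within Q, continuous f} ->
  mu.-integrable Q (EFin \o g) -> ibp a b c d f g ->
  \forall x \ae la, a <= x <= b -> forall s t, c <= s <= d -> c <= t <= d ->
    `|f (x, s) - f (x, t)| <= \int[la]_(y in `[c, d]) `|g (x, y)|.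
Proof.
move=> mf cf ig Hibp.
(* An enumeration of the rationals; an index that codes no rational is sent to 0, which is
   harmless. *)
pose p (n : nat) : R := ratr (odflt 0%Q (unpickle n)).
have H : \forall x \ae la, forall n m : nat, c < p n < d -> c < p m < d -> a <= x <= b ->
    f (x, p n) - f (x, p m) <= \int[la]_(y in `[c, d]) `|g (x, y)|.
  apply: ae_foralln => n; apply: ae_foralln => m.
  have [hn|hn] := pselect (c < p n < d); last by apply: aeW => x /hn.
  have [hm|hm] := pselect (c < p m < d); last by apply: aeW => x _ /hm.
  by apply: (ae_impl (acl_pair ab mf cf ig Hibp hn hm)) => x Hx _ _.
apply: (ae_impl H) => x Hx xab s t scd tcd.
apply/ler_addgt0Pr => e e0; have e20 : 0 < e / 2 by rewrite divr_gt0.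
have [dl dl0 Hdl] := compact_unif_cont (rect_compact (a := a) (b := b) (c := c) (d := d)) cf e20.
have near r : c <= r <= d -> exists n, c < p n < d /\ `|f (x, r) - f (x, p n)| < e / 2.
  move=> /andP[cr rd]; pose lo := Num.max c (r - dl); pose hi := Num.min d (r + dl).
  have lohi : lo < hi.
    by rewrite /lo /hi gt_max !lt_min; have := dl0; have := cd; lra.
  have [q] := rat_in_itvoo lohi; rewrite in_itv /= /lo /hi gt_max lt_min.
  move=> /andP[/andP[cq rq] /andP[qd qr]]; exists (pickle q); rewrite /p pickleK /=.
  split; first by rewrite cq.
  apply: Hdl.
  - by split; rewrite /= in_itv //= cr.
  - by split; rewrite /= in_itv //= (ltW cq) (ltW qd).
  - split => /=; first exact: ballxx.
    by rewrite /ball /= distrC ltr_norml ltrBrDl rq /= ltrBlDl.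
have [n [hn ln]] := near s scd; have [m [hm lm]] := near t tcd.
have h1 := Hx n m hn hm xab; have h2 := Hx m n hm hn xab.
rewrite (_ : f (x, s) - f (x, t) = (f (x, s) - f (x, p n)) - (f (x, t) - f (x, p m))
   + (f (x, p n) - f (x, p m))); last by ring.
apply: (le_trans (ler_normD _ _)); rewrite addrC lerD//.
  by rewrite ler_norml h1 andbT lerNl opprB.
by apply: (le_trans (ler_normB _ _)); rewrite (splitr e) lerD// ltW.
Qed.

(** Absolute continuity and Cauchy-Schwarz are packed into one function [G] that bounds the squared
    oscillation on each line and integrates to an energy. The estimates on rectangles rest on [G]
    alone. *)
Lemma line_est (f g : P2 -> R) : mfun Q f -> {within Q, continuous f} -> mfun Q g ->
  mu.-integrable Q (EFin \o (fun z => g z ^+ 2)) -> ibp a b c d f g ->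
  exists G : R -> R, [/\ forall x, 0 <= G x, la.-integrable `[a, b] (EFin \o G),
    \int[la]_(x in `[a, b]) G x = (d - c) * \int[mu]_(z in Q) (g z ^+ 2) &
    \forall x \ae la, a <= x <= b -> forall s t, c <= s <= d -> c <= t <= d ->
      (f (x, s) - f (x, t)) ^+ 2 <= G x].
Proof.
move=> mf cf mg ig2 Hibp.
have mQ := rect_measurable a b c d.
have i1 : mu.-integrable Q (EFin \o (fun=> 1 : R)).
  by apply: cont_integrable; [exact: rect_compact|exact: cst_continuous].
(* On a bounded rectangle |g| <= 1 + g^2 passes from square integrability to integrability. *)
have ig : mu.-integrable Q (EFin \o g).
  apply: (le_integrable mQ _ _ (integrableD mQ i1 ig2)).
    exact/measurable_EFinP.
  move=> z _; rewrite /= lee_fin; rewrite [leRHS]ger0_norm ?addr_ge0 ?sqr_ge0//.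
  rewrite -(real_normK (num_real (g z))) -subr_ge0.
  have := sqr_ge0 (`|g z| - 1); have := normr_ge0 (g z); nra.
have mg2 : mfun Q (fun z => g z ^+ 2) by apply: measurable_funX.
have [iU EU] := Rfubini ig2.
have dc0 : 0 < d - c by rewrite subr_gt0.
exists (fun x => (d - c) * \int[la]_(y in `[c, d]) (g (x, y) ^+ 2)); split.
- by move=> x; rewrite mulr_ge0 ?(ltW dc0)// Rintegral_ge0// => y _; exact: sqr_ge0.
- by have := integrableZl mab (d - c) iU; apply: eq_integrable.
- by rewrite RintegralZl// EU.
- have S2 := integrable_slice mg2 ig2.
  have S1 := integrable_slice mg ig.
  apply: (ae_mp S2); apply: (ae_mp S1); apply: (ae_impl (acl mf cf ig Hibp)).
  move=> x Hx H1 H2 xab s t scd tcd.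
  apply: (@le_trans _ _ ((\int[la]_(y in `[c, d]) `|g (x, y)|) ^+ 2)).
    rewrite -(real_normK (num_real (f (x, s) - _))) ler_pXn2r ?nnegrE//.
      exact: Hx.
    exact: Rintegral_ge0.
  apply: cauchy_schwarz_seg => //; last exact: H2.
  by have := integrable_abse (H1 xab); apply: eq_integrable.
Qed.

End Rect.
End Lines.

(** * L2 estimates on rectangles: strips, zeros on lines, crossings *)

Section Strips.
Context {R : realType}.
Notation P2 := (R * R)%type.
Notation mu := (@leb2 R).
Notation la := (@lebesgue_measure R).
Local Notation M1 := (measurableTypeR R).
Local Notation M2 := (measurableTypeR R * measurableTypeR R)%type.
Local Notation mset A := (@measurable _ M2 A).
Local Notation mfun D f := (@measurable_fun _ _ M2 _ D f).

(** Stated for a pair of functions on a rectangle, so that it applies to [v] with its second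
    derivative and, after exchange of the coordinates, to [v] with its first one. *)
Definition acl_on (a b c d : R) (f g : P2 -> R) :=
  [/\ mfun (`[a, b] `*` `[c, d]) f, {within `[a, b] `*` `[c, d], continuous f},
    mfun (`[a, b] `*` `[c, d]) g,
    mu.-integrable (`[a, b] `*` `[c, d]) (EFin \o (fun z => g z ^+ 2)) & ibp a b c d f g].

Lemma sqr_split (p q G : R) : (p - q) ^+ 2 <= G -> p ^+ 2 <= 2 * q ^+ 2 + 2 * G.
Proof. by move=> h; have := sqr_ge0 (p - 2 * q); nra. Qed.

Section Seg.
Variables (c d : R).
Hypothesis cd : c < d.
Let mcd : @measurable _ M1 `[c, d]%classic := seg_measurable c d.

Lemma cst_integrable (S : set M1) (k : R) : S `<=` `[c, d] -> measurable S ->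
  la.-integrable S (EFin \o (fun=> k)).
Proof.
move=> Scd mS; apply: (integrableS mcd mS Scd).
by apply: continuous_compact_integrable; [exact: segment_compact|apply: continuous_subspaceT; exact: cst_continuous].
Qed.

Lemma sqr_integrable (u : R -> R) (S : set M1) : S `<=` `[c, d] -> measurable S ->
  {within `[c, d], continuous u} -> la.-integrable S (EFin \o (fun y => u y ^+ 2)).
Proof.
move=> Scd mS cu; apply: (integrableS mcd mS Scd).
apply: continuous_compact_integrable; first exact: segment_compact.
by rewrite (_ : (fun y => _) = (fun y => u y * u y)) => [y|]; [apply: cvgM; exact: cu|apply/funext => y; rewrite expr2].
Qed.

Lemma Rint_cst (S : set M1) (k : R) : measurable S ->
  \int[la]_(y in S) k = k * fine (la S).
Proof. by move=> mS; rewrite Rintegral_cst. Qed.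

Lemma la_seg : fine (la `[c, d]) = d - c.
Proof. by rewrite lebesgue_measure_itv /= lte_fin cd. Qed.

Lemma seg_mean (u : R -> R) (k G : R) (S : set M1) : S `<=` `[c, d] -> measurable S ->
  {within `[c, d], continuous u} ->
  (forall s, S s -> k <= 2 * u s ^+ 2 + 2 * G) ->
  k * fine (la S) <= 2 * \int[la]_(y in S) (u y ^+ 2) + 2 * G * fine (la S).
Proof.
move=> Scd mS cu H.
have iu := sqr_integrable Scd mS cu.
have i2u : la.-integrable S (EFin \o (fun y => 2 * u y ^+ 2)).
  by have := integrableZl mS 2 iu; apply: eq_integrable.
have iG := cst_integrable (2 * G) Scd mS; have ik := cst_integrable k Scd mS.
rewrite -Rint_cst// -Rint_cst// -RintegralZl// -RintegralD//.
apply: le_Rintegral => //.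
by have := integrableD mS i2u iG; apply: eq_integrable.
Qed.

(** The inequality u(y)^2 <= 2 u(s)^2 + 2 G is integrated over y in [c, d] and then over s in
    [S]. *)
Lemma seg_strip (u : R -> R) (G : R) (S : set M1) : S `<=` `[c, d] -> measurable S ->
  {within `[c, d], continuous u} ->
  (forall s t, c <= s <= d -> c <= t <= d -> (u s - u t) ^+ 2 <= G) ->
  fine (la S) * \int[la]_(y in `[c, d]) (u y ^+ 2) <=
    2 * (d - c) * \int[la]_(y in S) (u y ^+ 2) + 2 * (d - c) * fine (la S) * G.
Proof.
move=> Scd mS cu H.
have dc0 : 0 < d - c by rewrite subr_gt0.
pose U := \int[la]_(y in `[c, d]) (u y ^+ 2).
have h1 s : S s -> U <= (d - c) * (2 * u s ^+ 2 + 2 * G).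
  move=> /Scd; rewrite /= in_itv /= => scd.
  rewrite mulrC -la_seg -Rint_cst//; apply: le_Rintegral => //=.
  - exact: sqr_integrable.
  - exact: cst_integrable.
  - move=> y; rewrite /= in_itv /= => ycd; exact: sqr_split (H y s ycd scd).
have h2 s : S s -> U / (d - c) <= 2 * u s ^+ 2 + 2 * G.
  by move=> /h1; rewrite ler_pdivrMr// mulrC.
have := seg_mean Scd mS cu h2; rewrite -/U mulrAC ler_pdivrMr//; lra.
Qed.

End Seg.

Section Rect.
Variables (a b c d : R) (f g : P2 -> R).
Hypotheses (ab : a < b) (cd : c < d) (H : acl_on a b c d f g).
Let Q : set P2 := `[a, b] `*` `[c, d].
Let mab : @measurable _ M1 `[a, b]%classic := seg_measurable a b.
Let mcd : @measurable _ M1 `[c, d]%classic := seg_measurable c d.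

Lemma sq_integrable2 : mu.-integrable Q (EFin \o (fun z => f z ^+ 2)).
Proof.
have [mf cf _ _ _] := H; have cQ := @rect_compact R a b c d.
have [B B0 HB] := cont_bounded cQ cf.
apply: (bounded_integrable (M := B ^+ 2)) => //; first exact: measurable_funX.
move=> z Qz; rewrite normrX ler_pXn2r ?nnegrE ?(ltW B0)//; exact: HB.
Qed.

Lemma sub_integrable2 (A : set P2) : A `<=` Q -> mset A ->
  mu.-integrable A (EFin \o (fun z => f z ^+ 2)).
Proof. move=> AQ mA; exact: (integrableS (rect_measurable a b c d) mA AQ sq_integrable2). Qed.

Lemma Rfubini_sub (S T : set M1) : S `<=` `[a, b] -> T `<=` `[c, d] ->
  measurable S -> measurable T ->
  la.-integrable S (EFin \o (fun x => \int[la]_(y in T) (f (x, y) ^+ 2))) /\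
  \int[mu]_(z in S `*` T) (f z ^+ 2) = \int[la]_(x in S) \int[la]_(y in T) (f (x, y) ^+ 2).
Proof.
move=> Sab Tcd mS mT; have STQ : S `*` T `<=` Q by move=> z [/Sab z1 /Tcd z2].
have mST : mset (S `*` T) by apply: measurableX.
pose h := (fun z => f z ^+ 2) \_ (S `*` T).
have ih : mu.-integrable Q (EFin \o h).
  apply: (integrable_support STQ) => //.
  - exact: rect_measurable.
  - by move=> z _ nz; rewrite /h /= patchN// notin_setE.
  - move: (sub_integrable2 STQ mST); apply: eq_integrable => // z zST.
    by rewrite /h /= patchT.
have [i1 E1] := Rfubini ih.
have inner x : \int[la]_(y in `[c, d]) h (x, y) = ((fun x => \int[la]_(y in T) (f (x, y) ^+ 2)) \_ S) x.
  rewrite /h /patch; case: ifPn => xS.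
    rewrite Rintegral_mkcond [RHS]Rintegral_mkcond; apply: eq_Rintegral => y _.
    rewrite /patch; have [yT|nT] := pselect (T y).
      by rewrite !ifT// inE//; [split => //; exact/set_mem|exact: Tcd].
    rewrite [in RHS]ifF; last by apply/negP; rewrite inE.
    case: ifP => // _; rewrite ifF//; apply/negP; rewrite inE => -[]//.
  rewrite /Rintegral integral0_eq// => y _; rewrite ifF//.
  by apply/negP; rewrite inE => -[/mem_set /=]; rewrite (negbTE xS).
split.
  have i2 := integrableS mab mS Sab i1.
  by move: i2; apply: eq_integrable => // x xS; rewrite /= inner patchT.
rewrite (_ : \int[mu]_(z in S `*` T) (f z ^+ 2) = \int[mu]_(z in Q) h z).
  rewrite E1 [RHS]Rintegral_mkcond [LHS]Rintegral_mkcond; apply: eq_Rintegral => x _.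
  rewrite /patch; have [xS|nS] := pselect (S x).
    by rewrite !ifT ?inE//; [rewrite inner patchT// inE|exact: Sab].
  rewrite [in RHS]ifF; last by apply/negP; rewrite inE.
  by case: ifP => // _; rewrite inner patchN// notin_setE.
rewrite /Rintegral (integral_support STQ); last first.
  by move=> z _ nz; rewrite /h /= patchN// notin_setE.
by congr fine; apply: eq_integral => z zST; rewrite /h patchT.
Qed.

(** [seg_strip] integrated over the vertical lines. It carries an L2 bound from the strip over [S]
    to the whole rectangle, at the price of energy, with constants depending only on the rectangle
    and the length of [S]. *)
Lemma strip (S : set M1) : S `<=` `[c, d] -> measurable S ->
  fine (la S) * \int[mu]_(z in Q) (f z ^+ 2) <=
    2 * (d - c) * \int[mu]_(z in `[a, b] `*` S) (f z ^+ 2) +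
    2 * (d - c) ^+ 2 * fine (la S) * \int[mu]_(z in Q) (g z ^+ 2).
Proof.
move=> Scd mS; have [mf cf mg ig2 Hibp] := H.
have [G [G0 iG EG HG]] := line_est ab cd mf cf mg ig2 Hibp.
have [i1 E1] := Rfubini_sub (@subset_refl _ `[a, b]) (@subset_refl _ `[c, d]) mab mcd.
have [i2 E2] := Rfubini_sub (@subset_refl _ `[a, b]) Scd mab mS.
rewrite E1 E2.
have -> : 2 * (d - c) ^+ 2 * fine (la S) * \int[mu]_(z in Q) (g z ^+ 2) =
  2 * (d - c) * fine (la S) * \int[la]_(x in `[a, b]) G x by rewrite EG; ring.
have i1' : la.-integrable `[a, b] (EFin \o (fun x => fine (la S) * \int[la]_(y in `[c, d]) (f (x, y) ^+ 2))).
  by have := integrableZl mab (fine (la S)) i1; apply: eq_integrable.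
have i2' : la.-integrable `[a, b] (EFin \o (fun x => 2 * (d - c) * \int[la]_(y in S) (f (x, y) ^+ 2))).
  by have := integrableZl mab (2 * (d - c)) i2; apply: eq_integrable.
have i3' : la.-integrable `[a, b] (EFin \o (fun x => 2 * (d - c) * fine (la S) * G x)).
  by have := integrableZl mab (2 * (d - c) * fine (la S)) iG; apply: eq_integrable.
rewrite -RintegralZl// -RintegralZl// -RintegralZl// -RintegralD//.
apply: ae_le_Rintegral => //.
  by have := integrableD mab i2' i3'; apply: eq_integrable.
apply: (ae_impl HG) => x Hx; rewrite /= in_itv /= => xab.
exact: (seg_strip cd Scd mS (cont_slice2 xab cf) (Hx xab)).
Qed.

(** On a line that contains a zero of [f], the oscillation bound is a bound on [f] itself. *)
Lemma proj_small (P : set M1) : P `<=` `[a, b] -> measurable P ->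
  (forall x, P x -> exists2 s, c <= s <= d & f (x, s) = 0) ->
  \int[mu]_(z in P `*` `[c, d]) (f z ^+ 2) <= (d - c) ^+ 2 * \int[mu]_(z in Q) (g z ^+ 2).
Proof.
move=> Pab mP HP; have [mf cf mg ig2 Hibp] := H.
have [G [G0 iG EG HG]] := line_est ab cd mf cf mg ig2 Hibp.
have [i1 E1] := Rfubini_sub Pab (@subset_refl _ `[c, d]) mP mcd.
have dc0 : 0 < d - c by rewrite subr_gt0.
rewrite E1; have iGP := integrableS mab mP Pab iG.
apply: (@le_trans _ _ (\int[la]_(x in P) ((d - c) * G x))).
  apply: ae_le_Rintegral => //.
    by have := integrableZl mP (d - c) iGP; apply: eq_integrable.
  apply: (ae_impl HG) => x Hx Px; have [s scd fs] := HP x Px.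
  have xab : a <= x <= b by have := Pab x Px; rewrite /= in_itv.
  rewrite mulrC -la_seg// -Rint_cst//; apply: le_Rintegral => //.
  - exact: (sqr_integrable (@subset_refl _ _) mcd (cont_slice2 xab cf)).
  - exact: (cst_integrable (c:=c) (d:=d) _ (@subset_refl _ _) mcd).
  - move=> y; rewrite /= in_itv /= => ycd; have := Hx xab y s ycd scd.
    by rewrite fs subr0.
rewrite RintegralZl// expr2 -mulrA ler_pM2l// -EG.
rewrite Rintegral_mkcond [leRHS]Rintegral_mkcond.
apply: le_Rintegral => //.
- by have := (@integrable_mkcond _ _ _ la P _ mP).1 iGP; rewrite restrict_EFin.
- by have := (@integrable_mkcond _ _ _ la `[a, b] _ mab).1 iG; rewrite restrict_EFin.
- move=> x _; rewrite /patch; have [Px|nP] := pselect (P x).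
    by rewrite !ifT ?inE//; exact: Pab.
  by rewrite ifF; [case: ifP|apply/negP; rewrite inE].
Qed.

(** On a line where [f] reaches 1, either [f] stays large or it oscillates: 1 <= 2 f(x, y)^2 + 2
    G(x), which is integrated over the rectangle. Combined with a Poincare inequality, this bounds
    the energy from below. *)
Lemma crossing : (forall x, a <= x <= b -> exists2 s, c <= s <= d & 1 <= f (x, s)) ->
  (b - a) * (d - c) <= 2 * \int[mu]_(z in Q) (f z ^+ 2) +
    2 * (d - c) ^+ 2 * \int[mu]_(z in Q) (g z ^+ 2).
Proof.
move=> HP; have [mf cf mg ig2 Hibp] := H.
have [G [G0 iG EG HG]] := line_est ab cd mf cf mg ig2 Hibp.
have [i1 E1] := Rfubini_sub (@subset_refl _ `[a, b]) (@subset_refl _ `[c, d]) mab mcd.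
rewrite E1.
have -> : 2 * (d - c) ^+ 2 * \int[mu]_(z in Q) (g z ^+ 2) =
  2 * (d - c) * \int[la]_(x in `[a, b]) G x by rewrite EG; ring.
have -> : (b - a) * (d - c) = \int[la]_(x in `[a, b]) (d - c).
  by rewrite Rint_cst// la_seg// mulrC.
have i1' : la.-integrable `[a, b] (EFin \o (fun x => 2 * \int[la]_(y in `[c, d]) (f (x, y) ^+ 2))).
  by have := integrableZl mab 2 i1; apply: eq_integrable.
have i3' : la.-integrable `[a, b] (EFin \o (fun x => 2 * (d - c) * G x)).
  by have := integrableZl mab (2 * (d - c)) iG; apply: eq_integrable.
rewrite -RintegralZl// -RintegralZl// -RintegralD//.
apply: ae_le_Rintegral => //.
- exact: (cst_integrable (c:=a) (d:=b) _ (@subset_refl _ _) mab).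
- by have := integrableD mab i1' i3'; apply: eq_integrable.
apply: (ae_impl HG) => x Hx; rewrite /= in_itv /= => xab.
have [s scd fs] := HP x xab.
have h y : `[c, d]%classic y -> 1 <= 2 * f (x, y) ^+ 2 + 2 * G x.
  rewrite /= in_itv /= => ycd; by have := sqr_split (Hx xab s y scd ycd);
    apply: le_trans; apply: exprn_ege1.
have := seg_mean (@subset_refl _ `[c, d]) mcd (cont_slice2 xab cf) h.
rewrite la_seg// mul1r; lra.
Qed.

End Rect.
End Strips.

(** * Exchange of the two coordinates *)

Section Swap.
Context {R : realType}.
Notation P2 := (R * R)%type.
Notation mu := (@leb2 R).
Local Notation M1 := (measurableTypeR R).
Local Notation M2 := (measurableTypeR R * measurableTypeR R)%type.
Local Notation mset A := (@measurable _ M2 A).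
Local Notation mfun D f := (@measurable_fun _ _ M2 _ D f).
Notation sw := (@unstable.swap R R).

Lemma swap_mfunT : @measurable_fun _ _ M2 M2 setT sw.
Proof. exact: (@measurable_swap _ _ M1 M1). Qed.

Lemma swap_mfun d (T : measurableType d) (D : set P2) (f : P2 -> T) : mset D -> mfun D f ->
  mfun (sw @^-1` D) (f \o sw).
Proof.
move=> mD mf; apply: (measurable_comp (F := D)) => //.
  by move=> z [w Dw <-].
exact: measurable_funTS swap_mfunT.
Qed.

(** The image of the plane measure under the exchange. Uniqueness of the product measure identifies
    it with [leb2], so that estimates on vertical lines yield those on horizontal lines. *)
Definition swap_measure : measure M2 R :=
  measure_function_pushforward__canonical__measure_function_Measure mu swap_mfunT.

Lemma swap_measureE (A : set P2) : mset A ->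
  mu A = swap_measure A.
Proof.
move=> mA; rewrite /leb2; apply: product_measure_unique => // B C mB mC.
rewrite /= /pushforward (_ : sw @^-1` (B `*` C) = C `*` B).
  by rewrite product_measure1E// muleC.
by apply/seteqP; split => -[x y] [].
Qed.

Lemma swap_ge0_integral (D : set P2) (f : P2 -> \bar R) : mset D -> mfun D f ->
  (forall z, D z -> (0 <= f z)%E) ->
  (\int[mu]_(z in D) f z = \int[mu]_(z in sw @^-1` D) f (sw z))%E.
Proof.
move=> mD mf f0.
have f0' : {in D, forall y : M2, (0 <= f y)%E} by move=> z /set_mem; exact: f0.
have H := @ge0_integral_pushforward _ _ M2 M2 R sw swap_mfunT mu D f mD mf f0'.
transitivity (\int[swap_measure]_(z in D) f z)%E; last exact: H.
apply: (@eq_measure_integral _ M2 R D swap_measure mu) => A mA _.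
exact: swap_measureE.
Qed.

Lemma swap_integral (D : set P2) (f : P2 -> \bar R) : mset D -> mfun D f ->
  (\int[mu]_(z in D) f z = \int[mu]_(z in sw @^-1` D) f (sw z))%E.
Proof.
move=> mD mf.
have Ep := swap_ge0_integral mD (@measurable_funepos _ M2 R D f mf) (fun z _ => funepos_ge0 f z).
have En := swap_ge0_integral mD (@measurable_funeneg _ M2 R D f mf) (fun z _ => funeneg_ge0 f z).
transitivity (\int[mu]_(z in D) f^\+ z - \int[mu]_(z in D) f^\- z)%E.
  exact: (@integralE _ M2 R mu D f).
rewrite Ep En; apply: esym.
apply: (etrans (@integralE _ M2 R mu (sw @^-1` D) (f \o sw))).
have -> : (f \o sw)^\+%E = (fun z => f^\+ (sw z))%E by apply/funext => z; rewrite !funeposE.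
by have -> : (f \o sw)^\-%E = (fun z => f^\- (sw z))%E by apply/funext => z; rewrite !funenegE.
Qed.

Lemma swap_rect (A B : set R) : sw @^-1` (A `*` B) = B `*` A.
Proof. by apply/seteqP; split => -[x y] []. Qed.

End Swap.

(** * Functions of finite energy restricted to rectangles *)

Section FiniteEnergy.
Context {R : realType}.
Notation P2 := (R * R)%type.
Notation mu := (@leb2 R).
Local Notation M1 := (measurableTypeR R).
Local Notation M2 := (measurableTypeR R * measurableTypeR R)%type.
Local Notation mset A := (@measurable _ M2 A).
Local Notation mfun D f := (@measurable_fun _ _ M2 _ D f).
Notation sw := (@unstable.swap R R).

Lemma derive_prod1 (phi psi : R -> R) (z : P2) : (forall n, Cn n phi) ->
  (forall n, Cn n psi) ->
  'D_(1, 0) (fun z : P2 => phi z.1 * psi z.2) z = 'D_1 phi z.1 * psi z.2.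
Proof.
move=> Cphi Cpsi; have [c1 [d1 _]] := Cphi 1%N.
have CT n : Cn n ((fun z : P2 => phi z.1) \* (fun z : P2 => psi z.2)).
  by apply: CnM; [exact: Cn_fstc|exact: Cn_sndc].
have [_ [dT _]] := CT 1%N.
case: z => x y /=; have [_ <-] := is_derive_fst (dT (x, y) (1, 0)).
rewrite (_ : (fun _ => _) = psi y *: phi :> (R -> R)); last first.
  by apply/funext => t /=; rewrite mulrC.
by rewrite deriveZ//= mulrC.
Qed.

Lemma derive_prod2 (phi psi : R -> R) (z : P2) : (forall n, Cn n phi) ->
  (forall n, Cn n psi) ->
  'D_(0, 1) (fun z : P2 => phi z.1 * psi z.2) z = phi z.1 * 'D_1 psi z.2.
Proof.
move=> Cphi Cpsi; have [c1 [d1 _]] := Cpsi 1%N.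
have CT n : Cn n ((fun z : P2 => phi z.1) \* (fun z : P2 => psi z.2)).
  by apply: CnM; [exact: Cn_fstc|exact: Cn_sndc].
have [_ [dT _]] := CT 1%N.
case: z => x y /=; have [_ <-] := is_derive_snd (dT (x, y) (0, 1)).
rewrite (_ : (fun _ => _) = phi x *: psi :> (R -> R)); last by [].
by rewrite deriveZ.
Qed.

(** The part of [cap_admissible] that involves neither of the two sets nor the sign of [v]. *)
Definition finite_energy (O : set P2) (v g1 g2 : P2 -> R) :=
  [/\ {within O, continuous v}, weak_gradient O v g1 g2 & (dirichlet O g1 g2 < +oo)%E].

Variables (O : set P2) (v g1 g2 : P2 -> R).
Hypotheses (oO : open O) (fe : finite_energy O v g1 g2).

Lemma fe_meas : [/\ mfun O v, mfun O g1 & mfun O g2].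
Proof. by case: fe => _ [[mv _] [[m1 _] [[m2 _] _]]] _; split. Qed.

Lemma energy_fin : dirichlet O g1 g2 = (fine (dirichlet O g1 g2))%:E.
Proof. by case: fe => _ _ df; rewrite fineK// ge0_fin_numE//; exact: dirichlet_ge0. Qed.

Lemma energy_sub (g : P2 -> R) (A : set P2) : g = g1 \/ g = g2 -> mset A -> A `<=` O ->
  mu.-integrable A (EFin \o (fun z => g z ^+ 2)) /\
  \int[mu]_(z in A) (g z ^+ 2) <= fine (dirichlet O g1 g2).
Proof.
move=> Hg mA AO; have [mv m1 m2] := fe_meas.
have mO := open_measurable2 oO.
have mg : mfun O g by case: Hg => ->.
have mgA : mfun A (EFin \o (fun z => g z ^+ 2)).
  by apply/measurable_EFinP; apply: measurable_funX; exact: (measurable_funS mO AO mg).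
have le1 : (\int[mu]_(z in A) (g z ^+ 2)%:E <= dirichlet O g1 g2)%E.
  apply: (@le_trans _ _ (\int[mu]_(z in O) (g z ^+ 2)%:E)%E).
    apply: ge0_subset_integral => //; last by move=> z _; rewrite lee_fin sqr_ge0.
    by apply/measurable_EFinP; apply: measurable_funX.
  apply: ge0_le_integral => //.
  - by move=> z _; rewrite lee_fin sqr_ge0.
  - by apply/measurable_EFinP; apply: measurable_funX.
  - exact: sqsum_measurable.
  - by move=> z _; rewrite lee_fin; case: Hg => ->; rewrite ?lerDl ?lerDr sqr_ge0.
split.
  apply/integrableP; split => //; apply: le_lt_trans (_ : (_ <= dirichlet O g1 g2)%E) _.
    have -> : (fun z => `|(EFin \o (fun z => (g z ^+ 2)%R)) z|)%E = (fun z => (g z ^+ 2)%:E).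
      by apply/funext => z /=; rewrite ger0_norm ?sqr_ge0.
    exact: le1.
  by case: fe.
rewrite /Rintegral -lee_fin -energy_fin fineK// ge0_fin_numE//.
  by apply: le_lt_trans le1 _; case: fe.
by apply: integral_ge0 => z _; rewrite lee_fin sqr_ge0.
Qed.

Lemma rect_test (a b c d : R) (phi psi : R -> R) : `[a, b] `*` `[c, d] `<=` O ->
  (forall n, Cn n phi) -> (forall n, Cn n psi) ->
  (forall x, ~ (a <= x <= b) -> phi x = 0) -> (forall y, ~ (c <= y <= d) -> psi y = 0) ->
  let Q := `[a, b] `*` `[c, d] in
  let T := fun z : P2 => phi z.1 * psi z.2 in
  [/\ test_fun O T, forall z, ~ Q z -> T z = 0 & forall w z, ~ Q z -> 'D_w T z = 0].
Proof.
move=> QO Cphi Cpsi phi0 psi0 Q T.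
have T0 z : ~ Q z -> T z = 0.
  move=> nQ; rewrite /T; have [h|/negP h] := boolP (a <= z.1 <= b); last first.
    by rewrite phi0// mul0r.
  rewrite psi0 ?mulr0// => h2; apply: nQ.
  by split; rewrite /= in_itv.
have cQ : compact Q := @rect_compact R a b c d.
split => //; last by move=> w z; exact: derive_support.
split; last by exists Q.
apply/CnP => n; rewrite /T.
exact: (CnM (Cn_fstc (Cphi n)) (Cn_sndc (Cpsi n))).
Qed.

Lemma fe_ibp2 (a b c d : R) : `[a, b] `*` `[c, d] `<=` O -> ibp a b c d v g2.
Proof.
move=> QO phi psi Cphi Cpsi phi0 psi0.
have [tT T0 DT0] := rect_test QO Cphi Cpsi phi0 psi0.
have [_ [_ [_ [_ H]]] _] := fe; have [_] := H _ tT.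
rewrite (integral_support QO); last by move=> z _ nQ; rewrite DT0// mulr0.
rewrite (integral_support QO); last by move=> z _ nQ; rewrite T0// mulr0.
by move=> <-; apply: eq_integral => z _; rewrite derive_prod2.
Qed.

(** After the exchange, the first partial derivative becomes the derivative in the second variable,
    the only one that [ibp] speaks of. *)
Lemma fe_ibp1 (a b c d : R) : `[a, b] `*` `[c, d] `<=` O ->
  ibp c d a b (v \o sw) (g1 \o sw).
Proof.
move=> QO phi psi Cphi Cpsi phi0 psi0; have [mv m1 _] := fe_meas.
have [tT T0 DT0] := rect_test QO Cpsi Cphi psi0 phi0.
have mQ := rect_measurable a b c d; have mO := open_measurable2 oO.
have [_ [_ [_ [_ H]]] _] := fe; have [H1 _] := H _ tT; move: H1.
have CT n : Cn n ((fun z : P2 => psi z.1) \* (fun z : P2 => phi z.2)).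
  by apply: CnM; [exact: Cn_fstc|exact: Cn_sndc].
rewrite (integral_support QO); last by move=> z _ nQ; rewrite DT0// mulr0.
rewrite (integral_support QO); last by move=> z _ nQ; rewrite T0// mulr0.
rewrite swap_integral//; last first.
  apply/measurable_EFinP; apply: measurable_funM; first exact: (measurable_funS mO QO mv).
  exact: smooth_mfun.
rewrite (swap_integral (f := fun z => (g1 z * _)%:E))//; last first.
  apply/measurable_EFinP; apply: measurable_funM; first exact: (measurable_funS mO QO m1).
  by apply: measurable_funTS; apply: cont_measurable2; exact: Cn_continuous (CT 0%N).
rewrite swap_rect => H1.
transitivity (- \int[mu]_(z in `[c, d] `*` `[a, b]) (g1 (sw z) * (psi (sw z).1 * phi (sw z).2))%:E)%E.
  rewrite -H1; apply: eq_integral => z _; rewrite derive_prod1//.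
  by congr EFin; rewrite /= (mulrC (phi _)).
by congr (- _)%E; apply: eq_integral => z _; congr EFin; rewrite /= (mulrC (phi _)).
Qed.

Lemma fe_acl2 (a b c d : R) : `[a, b] `*` `[c, d] `<=` O -> acl_on a b c d v g2.
Proof.
move=> QO; have [mv m1 m2] := fe_meas; have [cv _ _] := fe.
have mQ := rect_measurable a b c d; have mO := open_measurable2 oO.
split; [exact: (measurable_funS mO QO mv)|exact: (continuous_subspaceW QO cv)|
  exact: (measurable_funS mO QO m2)| |exact: fe_ibp2].
by apply: (energy_sub _ mQ QO).1; right.
Qed.

Lemma fe_acl1 (a b c d : R) : `[a, b] `*` `[c, d] `<=` O ->
  acl_on c d a b (v \o sw) (g1 \o sw).
Proof.
move=> QO; have [mv m1 m2] := fe_meas; have [cv _ _] := fe.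
have mQ := rect_measurable a b c d; have mO := open_measurable2 oO.
rewrite /acl_on -(swap_rect `[a, b] `[c, d]); split.
- exact: (swap_mfun mQ (measurable_funS mO QO mv)).
- apply/subspace_continuousP => z Qz; have /subspace_continuousP cv' := continuous_subspaceW QO cv.
  move=> A HA; have /nbhs_ballP[e /= e0 He] := cv' (sw z) Qz A HA.
  apply/nbhs_ballP; exists e => //= w [w1 w2] Qw.
  by apply: (He (sw w)) => //; split.
- exact: (swap_mfun mQ (measurable_funS mO QO m1)).
- have [i1 _] : mu.-integrable (`[a, b] `*` `[c, d]) (EFin \o (fun z => g1 z ^+ 2)) /\ True.
    by split => //; apply: (energy_sub _ mQ QO).1; left.
  move/integrableP: i1 => [mi fi]; apply/integrableP; split.
    exact: swap_mfun mi.
  move: fi; rewrite swap_integral//; exact: measurableT_comp mi.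
- exact: fe_ibp1.
Qed.

Lemma swap_sq_int (g : P2 -> R) (A B : set M1) : measurable A -> measurable B ->
  mfun (A `*` B) g ->
  \int[mu]_(z in B `*` A) ((g \o sw) z ^+ 2) = \int[mu]_(z in A `*` B) (g z ^+ 2).
Proof.
move=> mA mB mg; have mf : mfun (A `*` B) (EFin \o (fun z => g z ^+ 2)).
  by apply/measurable_EFinP; exact: measurable_funX.
have := swap_integral (measurableX mA mB) mf; rewrite swap_rect => E.
by rewrite /Rintegral; congr fine; exact/esym/E.
Qed.

End FiniteEnergy.

(** * The Poincare inequality *)

Section Poincare.
Context {R : realType}.
Notation P2 := (R * R)%type.
Notation mu := (@leb2 R).
Notation la := (@lebesgue_measure R).
Local Notation M1 := (measurableTypeR R).
Local Notation M2 := (measurableTypeR R * measurableTypeR R)%type.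
Local Notation mset A := (@measurable _ M2 A).
Local Notation mfun D f := (@measurable_fun _ _ M2 _ D f).

Variables (O F : set P2).
Hypothesis (oO : open O).

(** The constant is uniform in [v]. The integral is kept in the extended reals because [W] is any
    measurable subset of [O], on which [v] need not be known to be square integrable. *)
Definition poincare (W : set P2) := [/\ mset W, W `<=` O &
  exists2 C : R, 0 <= C & forall v g1 g2, finite_energy O v g1 g2 ->
    (forall z, F z -> v z = 0) ->
    (\int[mu]_(z in W) (v z ^+ 2)%:E <= (C * fine (dirichlet O g1 g2))%:E)%E].

Lemma sq_mfun (W : set P2) v g1 g2 : W `<=` O -> finite_energy O v g1 g2 ->
  mfun W (fun z => (v z ^+ 2)%:E).
Proof.
move=> WO fe; have [mv _ _] := fe_meas fe; apply/measurable_EFinP.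
apply: measurable_funX; exact: (measurable_funS (open_measurable2 oO) WO mv).
Qed.

Lemma poincareS (W W' : set P2) : mset W' -> W' `<=` W -> poincare W -> poincare W'.
Proof.
move=> mW' W'W [mW WO [C C0 H]]; split=> //; first exact: subset_trans WO.
exists C => // v g1 g2 fe v0; apply: le_trans (H v g1 g2 fe v0).
apply: ge0_subset_integral => //; first exact: sq_mfun fe.
by move=> z _; rewrite lee_fin sqr_ge0.
Qed.

Lemma poincareU (W W' : set P2) : poincare W -> poincare W' -> poincare (W `|` W').
Proof.
move=> [mW WO [C C0 H]] [mW' WO' [C' C0' H']]; split; first exact: measurableU.
  by move=> z [/WO|/WO'].
exists (C + C'); first exact: addr_ge0.
move=> v g1 g2 fe v0; rewrite mulrDl EFinD -(setUIDK W' W) setUA (_ : W `|` _ = W).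
  have mD : mset (W' `\` W) by exact: measurableD.
  rewrite ge0_integral_setU//.
  - apply: leeD; first exact: H.
    apply: le_trans (H' v g1 g2 fe v0); apply: ge0_subset_integral => //.
    + exact: sq_mfun fe.
    + by move=> z _; rewrite lee_fin sqr_ge0.
  - by apply: sq_mfun fe => z [/WO|[/WO']].
  - by move=> z _; rewrite lee_fin sqr_ge0.
  - by apply/disj_setPS => z [Wz []].
by apply/seteqP; split => z; [case=> // -[]|left].
Qed.

Lemma poincare0 : poincare set0.
Proof.
split; [exact: measurable0|by []|exists 0 => // v g1 g2 _ _].
by rewrite integral_set0 mul0r.
Qed.

Section Rect.
Variables (a b c d : R).
Hypotheses (ab : a < b) (cd : c < d).
Let Q : set P2 := `[a, b] `*` `[c, d].
Hypothesis QO : Q `<=` O.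
Let mab : @measurable _ M1 `[a, b]%classic := seg_measurable a b.
Let mcd : @measurable _ M1 `[c, d]%classic := seg_measurable c d.
Let mQ : mset Q := rect_measurable a b c d.

Lemma poincareR (W : set P2) : W `<=` Q -> mset W ->
  poincare W <-> exists2 C : R, 0 <= C & forall v g1 g2, finite_energy O v g1 g2 ->
    (forall z, F z -> v z = 0) ->
    \int[mu]_(z in W) (v z ^+ 2) <= C * fine (dirichlet O g1 g2).
Proof.
move=> WQ mW.
have E v g1 g2 : finite_energy O v g1 g2 ->
    (\int[mu]_(z in W) (v z ^+ 2)%:E = (\int[mu]_(z in W) (v z ^+ 2))%:E)%E.
  move=> fe; have i := sub_integrable2 (fe_acl2 oO fe QO) WQ mW.
  by rewrite /Rintegral fineK//; apply: integrable_fin_num.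
split => [[_ _ [C C0 H]]|[C C0 H]].
  by exists C => // v g1 g2 fe v0; rewrite -lee_fin -(E _ _ _ fe); exact: H v0.
split=> //; first exact: subset_trans QO.
by exists C => // v g1 g2 fe v0; rewrite (E _ _ _ fe) lee_fin; exact: H v0.
Qed.

Lemma strip_const (L C l D I J G E : R) : 0 < L -> 0 <= D -> G <= E -> J <= C * E ->
  L * I <= D * J + D * l * L * G -> 0 <= l -> I <= (D * C / L + D * l) * E.
Proof.
move=> L0 D0 GE JE H l0.
have h1 : D * J <= D * (C * E) by rewrite ler_wpM2l.
have h2 : D * l * L * G <= D * l * L * E.
  by rewrite ler_wpM2l// !mulr_ge0// ltW.
have : L * I <= L * ((D * C / L + D * l) * E).
  have -> : L * ((D * C / L + D * l) * E) = D * (C * E) + D * l * L * E.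
    by field; rewrite gt_eqF.
  exact: le_trans H (lerD h1 h2).
by rewrite ler_pM2l.
Qed.

(** [T] is any measurable set of positive length rather than an interval, since it will also be a
    projection of a piece of [F]. *)
Lemma poincare_strip2 (T : set M1) : T `<=` `[c, d] -> measurable T ->
  0 < fine (la T) -> poincare (`[a, b] `*` T) -> poincare Q.
Proof.
move=> Tcd mT T0.
have TQ : `[a, b] `*` T `<=` Q by move=> z [z1 /Tcd z2].
have mTQ : mset (`[a, b] `*` T) by exact: measurableX.
move=> /(poincareR TQ mTQ)[C C0 H]; apply/poincareR => //.
have dc0 : 0 <= d - c by rewrite subr_ge0 ltW.
exists (2 * (d - c) * C / fine (la T) + 2 * (d - c) * (d - c)).
  by rewrite addr_ge0 ?mulr_ge0 ?invr_ge0 ?(ltW T0).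
move=> v g1 g2 fe v0; have [_ h2] := energy_sub oO fe (or_intror erefl) mQ QO.
apply: (strip_const T0 _ h2 (H _ _ _ fe v0)) => //; first by rewrite mulr_ge0.
have := strip ab cd (fe_acl2 oO fe QO) Tcd mT.
by rewrite (_ : 2 * (d - c) ^+ 2 = 2 * (d - c) * (d - c))// expr2 mulrA.
Qed.

Lemma poincare_strip1 (T : set M1) : T `<=` `[a, b] -> measurable T ->
  0 < fine (la T) -> poincare (T `*` `[c, d]) -> poincare Q.
Proof.
move=> Tab mT T0.
have TQ : T `*` `[c, d] `<=` Q by move=> z [/Tab z1 z2].
have mTQ : mset (T `*` `[c, d]) by exact: measurableX.
move=> /(poincareR TQ mTQ)[C C0 H]; apply/poincareR => //.
have ba0 : 0 <= b - a by rewrite subr_ge0 ltW.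
exists (2 * (b - a) * C / fine (la T) + 2 * (b - a) * (b - a)).
  by rewrite addr_ge0 ?mulr_ge0 ?invr_ge0 ?(ltW T0).
move=> v g1 g2 fe v0; have [_ h2] := energy_sub oO fe (or_introl erefl) mQ QO.
have [mv m1 _] := fe_meas fe; have mO := open_measurable2 oO.
apply: (strip_const T0 _ h2 (H _ _ _ fe v0)) => //; first by rewrite mulr_ge0.
have := strip cd ab (fe_acl1 oO fe QO) Tab mT.
rewrite !swap_sq_int//.
- by rewrite (_ : 2 * (b - a) ^+ 2 = 2 * (b - a) * (b - a))// expr2 mulrA.
- exact: (measurable_funS mO QO m1).
- exact: (measurable_funS mO (subset_trans TQ QO) mv).
- exact: (measurable_funS mO QO mv).
Qed.

Lemma poincare_proj2 (P : set M1) : P `<=` `[a, b] -> measurable P ->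
  (forall x, P x -> exists2 s, c <= s <= d & F (x, s)) -> poincare (P `*` `[c, d]).
Proof.
move=> Pab mP HP.
have PQ : P `*` `[c, d] `<=` Q by move=> z [/Pab z1 z2].
have mPQ : mset (P `*` `[c, d]) by exact: measurableX.
apply/poincareR => //; exists ((d - c) ^+ 2); first exact: sqr_ge0.
move=> v g1 g2 fe v0; have [_ h2] := energy_sub oO fe (or_intror erefl) mQ QO.
apply: (@le_trans _ _ ((d - c) ^+ 2 * \int[mu]_(z in Q) (g2 z ^+ 2))).
  apply: (proj_small ab cd (fe_acl2 oO fe QO) Pab mP) => x Px.
  by have [s scd Fs] := HP x Px; exists s => //; exact: v0.
by rewrite ler_wpM2l// sqr_ge0.
Qed.

Lemma poincare_proj1 (P : set M1) : P `<=` `[c, d] -> measurable P ->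
  (forall y, P y -> exists2 s, a <= s <= b & F (s, y)) -> poincare (`[a, b] `*` P).
Proof.
move=> Pcd mP HP.
have PQ : `[a, b] `*` P `<=` Q by move=> z [z1 /Pcd z2].
have mPQ : mset (`[a, b] `*` P) by exact: measurableX.
apply/poincareR => //; exists ((b - a) ^+ 2); first exact: sqr_ge0.
move=> v g1 g2 fe v0; have [_ h2] := energy_sub oO fe (or_introl erefl) mQ QO.
have [mv m1 _] := fe_meas fe; have mO := open_measurable2 oO.
apply: (@le_trans _ _ ((b - a) ^+ 2 * \int[mu]_(z in Q) (g1 z ^+ 2))).
  have := @proj_small _ _ _ _ _ _ _ cd ab (fe_acl1 oO fe QO) P Pcd mP.
  rewrite !swap_sq_int//.
  - apply => y Py; have [s sab Fs] := HP y Py; exists s => //.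
    exact: (v0 (s, y)).
  - exact: (measurable_funS mO QO m1).
  - exact: (measurable_funS mO (subset_trans PQ QO) mv).
by rewrite ler_wpM2l// sqr_ge0.
Qed.

End Rect.

Definition good (p : P2) := exists2 r, 0 < r & poincare (box p r).

Lemma sub_lt (p r : R) : 0 < r -> p - r < p + r.
Proof. by move=> r0; lra. Qed.

Lemma seg_pos (p r : R) : 0 < r -> 0 < fine (la `[p - r, p + r]).
Proof. by move=> r0; rewrite la_seg; lra. Qed.

(* A good box inside a box of O is extended to a horizontal strip, then to the
   whole box. *)
Lemma good_prop (x : P2) : O x ->
  exists2 r, 0 < r & forall y z, box x r y -> box x r z -> O y -> O z -> good y -> good z.
Proof.
move=> Ox; have [r r0 xO] := open_box oO Ox.
(* With [y] and [z] in the half box, boxes of radius at most r/2 around them stay in the box of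
   radius [r] around [x]. *)
exists (r / 2); first by rewrite divr_gt0.
move=> y z /boxP[y1 y2] /boxP[z1 z2] _ _ [s0 s00 Gs0].
pose s := Num.min s0 (r / 2).
have s_0 : 0 < s by rewrite lt_min s00 divr_gt0.
have ss0 : s <= s0 by rewrite ge_min lexx.
have sr : s <= r / 2 by rewrite ge_min lexx orbT.
have Gs : poincare (box y s).
  apply: poincareS Gs0; first exact: box_measurable.
  by move=> w /boxP[w1 w2]; apply/boxP; split; [exact: le_trans w1 _|exact: le_trans w2 _].
have sub (p q : R) : `|p - q| <= r / 2 -> `[p - s, p + s] `<=` `[q - r, q + r].
  by move=> pq t; rewrite /= !in_itv /=; move: pq; rewrite ler_norml; lra.
have S1 := sub _ _ y1; have S2 := sub _ _ y2.
have H1 : poincare (`[x.1 - r, x.1 + r] `*` `[y.2 - s, y.2 + s]).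
  apply: (poincare_strip1 _ _ _ S1 _ _ Gs); try lra.
  - by move=> w [w1 /S2 w2]; apply: xO; split.
  - exact: seg_measurable.
  - exact: seg_pos.
have H2 : poincare (box x r).
  apply: (poincare_strip2 _ _ xO S2 _ _ H1); try lra.
  - exact: seg_measurable.
  - exact: seg_pos.
exists (r / 2); first by rewrite divr_gt0.
apply: poincareS H2; first exact: box_measurable.
move=> w /boxP[w1 w2]; apply/boxP; split.
  by move: z1 w1; rewrite !ler_norml; lra.
by move: z2 w2; rewrite !ler_norml; lra.
Qed.

Lemma null_cover (T : eqType) (s : seq T) (A : T -> set M1) :
  (forall p, measurable (A p)) -> (forall p, p \in s -> la (A p) = 0%E) ->
  la (\big[setU/set0]_(p <- s) A p) = 0%E.
Proof.
move=> mA; elim: s => [|p s IH] H; first by rewrite big_nil measure0.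
rewrite big_cons; have A0 : la (\big[setU/set0]_(q <- s) A q) = 0%E.
  by apply: IH => q qs; apply: H; rewrite inE qs orbT.
have ms : measurable (\big[setU/set0]_(q <- s) A q) by exact: bigsetU_measurable.
apply: (etrans (@measureU0 _ M1 R la _ _ (mA p) ms A0)).
by apply: H; rewrite inE eqxx.
Qed.

Lemma compact_proj_measurable (h : P2 -> R) (K : set P2) : continuous h -> compact K ->
  @measurable _ M1 (h @` K).
Proof.
move=> ch cK; apply: closed_measurable; apply: compact_closed; first exact: norm_hausdorff.
by apply: continuous_compact => //; exact: continuous_subspaceT.
Qed.

(** The piece of [F] in one box need not be connected, so its projection need not contain an
    interval. But the projections of finitely many pieces cover the interval between [h p] and
    [h q], so they cannot all be null. *)
Lemma proj_positive (h : P2 -> R) (s : seq P2) (r : P2 -> R) (p q : P2) :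
  continuous h -> compact F -> connected F -> F p -> F q -> h p < h q ->
  (forall z, F z -> exists2 w, w \in s & box w (r w) z) ->
  exists2 w, w \in s & (0 < la (h @` (F `&` box w (r w))))%E.
Proof.
move=> ch cF kF Fp Fq pq cov; apply: contrapT => H.
pose A w : set M1 := h @` (F `&` box w (r w)).
have mA w : measurable (A w).
  apply: compact_proj_measurable => //; apply: compact_closedI => //.
  by apply: compact_closed2; exact: box_compact.
have A0 w : w \in s -> la (A w) = 0%E.
  move=> ws; apply/eqP; rewrite eq_le measure_ge0 andbT leNgt; apply/negP => h0.
  by apply: H; exists w.
have N0 := null_cover mA A0.
have sub : `[h p, h q] `<=` \big[setU/set0]_(w <- s) A w.
  move=> t tpq.
  have : (h @` F) t.
    have cI : connected (h @` F) by apply: connected_continuous_connected => //; exact: continuous_subspaceT.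
    have iI := (connected_intervalP _).1 cI.
    move: tpq; rewrite /= in_itv /=; apply: (iI (h p) (h q)); [by exists p|by exists q].
  move=> [z Fz <-]; have [w ws wz] := cov z Fz.
  rewrite -bigcup_seq; exists w => //; exists z => //.
have : (la `[h p, h q] <= 0)%E.
  by rewrite -N0; apply: le_measure => //; rewrite inE//; apply: bigsetU_measurable.
by rewrite lebesgue_measure_itv /= lte_fin pq -EFinB lee_fin subr_le0 leNgt pq.
Qed.

Lemma good_start : compact F -> connected F -> F `<=` O ->
  (exists a b, F a /\ F b /\ a <> b) -> exists2 x, O x & good x.
Proof.
move=> cF kF FO [p [q [Fp [Fq pq]]]].
have /choice[r Hr] : forall z, exists r, O z -> 0 < r /\ box z r `<=` O.
  move=> z; have [Oz|nOz] := pselect (O z); last by exists 0.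
  by have [r r0 H] := open_box oO Oz; exists r.
have [s [sF cov]] := compact_box_cover cF (fun z Fz => (Hr z (FO z Fz)).1).
have cov' z : F z -> exists2 w, w \in s & box w (r w) z.
  by move=> /cov[w ws /ball_box wz]; exists w.
have mA h w : continuous h -> @measurable _ M1 (h @` (F `&` box w (r w))).
  move=> ch; apply: compact_proj_measurable => //; apply: compact_closedI => //.
  by apply: compact_closed2; exact: box_compact.
have seg_fin u v (A : set M1) : measurable A -> A `<=` `[u, v] -> (0 < la A)%E -> 0 < fine (la A).
  move=> mA' Auv A0; rewrite -lte_fin fineK// ge0_fin_numE//.
  apply: (@le_lt_trans _ _ (la `[u, v])); first by apply: le_measure => //; rewrite inE.
  by rewrite lebesgue_measure_itv /=; case: ifP => _; rewrite ltry.
have case1 p' q' : F p' -> F q' -> p'.1 < q'.1 -> exists2 x, O x & good x.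
  move=> Fp' Fq' lt; have cfst : continuous (fst : P2 -> R) by move=> z; exact: cvg_fst.
  have [w ws A0] := proj_positive cfst cF kF Fp' Fq' lt cov'.
  have [rw wO] := Hr w (FO w (sF w ws)); exists w; first exact/FO/sF.
  exists (r w) => //; set A := fst @` _ in A0.
  have mAw : @measurable _ M1 A := mA _ w cfst.
  have Asub : A `<=` `[w.1 - r w, w.1 + r w] by move=> t [z [_ [z1 z2]] <-].
  have l1 := sub_lt w.1 rw; have l2 := sub_lt w.2 rw.
  (* Every vertical line over [A] meets [F] inside the box, where [v] vanishes; this gives the
     inequality over [A], and the positive length of [A] extends it to the box. *)
  apply: (poincare_strip1 l1 l2 wO Asub mAw); first exact: seg_fin Asub A0.
  apply: (poincare_proj2 l1 l2 wO Asub mAw).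
  move=> t [z [Fz [z1 z2]] <-]; exists z.2; first by move: z2; rewrite /= in_itv.
  by case: z Fz z1 z2.
have case2 p' q' : F p' -> F q' -> p'.2 < q'.2 -> exists2 x, O x & good x.
  move=> Fp' Fq' lt; have csnd : continuous (snd : P2 -> R) by move=> z; exact: cvg_snd.
  have [w ws A0] := proj_positive csnd cF kF Fp' Fq' lt cov'.
  have [rw wO] := Hr w (FO w (sF w ws)); exists w; first exact/FO/sF.
  exists (r w) => //; set A := snd @` _ in A0.
  have mAw : @measurable _ M1 A := mA _ w csnd.
  have Asub : A `<=` `[w.2 - r w, w.2 + r w] by move=> t [z [_ [z1 z2]] <-].
  have l1 := sub_lt w.1 rw; have l2 := sub_lt w.2 rw.
  apply: (poincare_strip2 l1 l2 wO Asub mAw); first exact: seg_fin Asub A0.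
  apply: (poincare_proj1 l1 l2 wO Asub mAw).
  move=> t [z [Fz [z1 z2]] <-]; exists z.1; first by move: z1; rewrite /= in_itv.
  by case: z Fz z1 z2.
have [e1|/lt_total/orP[|]] := eqVneq p.1 q.1; [|exact: case1|exact: case1].
have [e2|/lt_total/orP[|]] := eqVneq p.2 q.2; [|exact: case2|exact: case2].
by case: pq; case: p q e1 e2 {Fp Fq} => [p1 p2] [q1 q2] /= -> ->.
Qed.

Lemma poincare_compact (W : set P2) : connected O -> continuum F -> F `<=` O ->
  compact W -> W `<=` O -> poincare W.
Proof.
move=> cO [cF [kF neF]] FO cW WO.
have G z : O z -> good z.
  by apply: connected_ind => //; [exact: good_start|exact: good_prop].
have /choice[r Hr] : forall z, exists r, O z -> 0 < r /\ poincare (box z r).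
  move=> z; have [Oz|nOz] := pselect (O z); last by exists 0.
  by have [r r0 H] := G z Oz; exists r.
have [s [sW cov]] := compact_box_cover cW (fun z Wz => (Hr z (WO z Wz)).1).
apply: (@poincareS (\big[setU/set0]_(w <- s) box w (r w))).
- exact: compact_measurable2.
- by move=> z /cov[w ws /ball_box wz]; rewrite -bigcup_seq; exists w.
elim: s sW {cov} => [|w s IH] sW; first by rewrite big_nil; exact: poincare0.
rewrite big_cons; apply: poincareU.
  by apply: (Hr w _).2; apply/WO/sW; rewrite inE eqxx.
by apply: IH => z zs; apply: sW; rewrite inE zs orbT.
Qed.

End Poincare.

(** * Comparison of the two metrics *)

Section Comparison.
Context {R : realType}.
Notation P2 := (R * R)%type.
Notation mu := (@leb2 R).
Local Notation M2 := (measurableTypeR R * measurableTypeR R)%type.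
Local Notation mset A := (@measurable _ M2 A).
Local Notation mfun D f := (@measurable_fun _ _ M2 _ D f).
Local Notation e1 := ((1%R : R), (0%R : R)).
Local Notation e2 := ((0%R : R), (1%R : R)).

Lemma adm_fe (F A O : set P2) v g1 g2 : cap_admissible F A O v g1 g2 -> finite_energy O v g1 g2.
Proof. by move=> [cv [_ [wg [df _]]]]. Qed.

Lemma adm_zero (F A O : set P2) v g1 g2 : F `<=` O -> cap_admissible F A O v g1 g2 ->
  forall z, F z -> v z = 0.
Proof. by move=> FO [_ [_ [_ [_ [[U [_ [FU HU]]] _]]]]] z Fz; apply: HU; [exact: FU|exact: FO]. Qed.

Lemma adm_ge1 (F A O : set P2) v g1 g2 : A `<=` O -> cap_admissible F A O v g1 g2 ->
  forall z, A z -> 1 <= v z.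
Proof. by move=> AO [_ [_ [_ [_ [_ [U [_ [AU HU]]]]]]]] z Az; apply: HU; [exact: AU|exact: AO]. Qed.

Lemma sqr_gradient_mul (e d v g M : R) : 0 <= e <= 1 -> `|d| <= M ->
  (e * g + d * v) ^+ 2 <= 2 * g ^+ 2 + 2 * M ^+ 2 * v ^+ 2.
Proof.
move=> /andP[e0 e1] dM.
have h1 : (e * g) ^+ 2 <= g ^+ 2.
  by rewrite exprMn ler_piMl ?sqr_ge0// expr_le1.
have h2 : (d * v) ^+ 2 <= M ^+ 2 * v ^+ 2.
  rewrite exprMn ler_wpM2r ?sqr_ge0// -[d ^+ 2](real_normK (num_real d)) ler_sqr ?nnegrE//.
  exact: le_trans dM.
have := sqr_ge0 (e * g - d * v); rewrite sqrrB sqrrD; lra.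
Qed.

Section CaseA.
Variables (O F1 F2 : set P2) (theta : P2 -> R) (S W : set P2).
Hypotheses (oO : open O) (F2O : F2 `<=` O) (Ct : forall n, Cn n theta)
  (t01 : forall z, 0 <= theta z <= 1) (oW : open W) (F1W : F1 `<=` W)
  (tW : forall z, W z -> theta z = 1) (cS : compact S) (SO : S `<=` O)
  (tS : forall z, ~ S z -> theta z = 0).

Lemma Dtheta_bound : exists2 M, 0 <= M & forall z, `|'D_e1 theta z| <= M /\ `|'D_e2 theta z| <= M.
Proof.
have [_ [_ Dt]] := Ct 1%N.
have [M1 M10 H1] := cont_bounded cS (continuous_subspaceT (Dt e1).1).
have [M2 M20 H2] := cont_bounded cS (continuous_subspaceT (Dt e2).1).
exists (M1 + M2); first by rewrite addr_ge0// ltW.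
move=> z; have [Sz|nSz] := pselect (S z).
  by split; [apply: le_trans (H1 z Sz) _; rewrite lerDl ltW|
    apply: le_trans (H2 z Sz) _; rewrite lerDr ltW].
by rewrite !(derive_support _ cS tS nSz) normr0 addr_ge0// ltW.
Qed.

(** The competitor is (1 - theta) v: it vanishes near [F1] because theta is 1 there, and it
    coincides with [v] off [S], in particular near [l]. *)
Lemma cut_adm : poincare O F2 S -> exists2 K : R, 0 <= K & forall l v g1 g2,
  l `&` S = set0 -> cap_admissible F2 l O v g1 g2 ->
  exists k1 k2 u, cap_admissible F1 l O u k1 k2 /\
    fine (dirichlet O k1 k2) <= K * fine (dirichlet O g1 g2).
Proof.
move=> [mS _ [C C0 HC]]; have [M M0 HM] := Dtheta_bound.
exists (2 + 4 * M ^+ 2 * C); first by rewrite addr_ge0// !mulr_ge0// sqr_ge0.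
move=> l v g1 g2 lS H; have [cv [v0 [wg [df [_ [U [oU [lU HU]]]]]]]] := H.
pose eta z := 1 - theta z.
have Ceta n : Cn n eta.
  rewrite (_ : eta = cst 1 \+ (\- theta)); last by apply/funext.
  by apply: CnD; [exact: Cn_cst|exact: CnN].
have eta01 z : 0 <= eta z <= 1 by have := t01 z; rewrite /eta; lra.
have [_ [dt _]] := Ct 1%N.
have Deta w z : 'D_w eta z = - 'D_w theta z.
  rewrite (_ : eta = cst 1 - theta); last by apply/funext.
  by rewrite deriveB// derive_cst sub0r.
have [_ [_ DC]] := Ceta 1%N.
have mO := open_measurable2 oO.
have [mv m1 m2] := adm_meas H.
have wg' := weak_gradient_mul oO Ceta wg.
set k1 := _ \+ _ in wg'; set k2 := (_ \* g2) \+ _ in wg'.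
have mk1 : mfun O k1 by case: wg' => _ [[]].
have mk2 : mfun O k2 by case: wg' => _ [_ [[]]].
(* The term v grad theta is bounded by M |v| on [S] and vanishes elsewhere. Treating [w] and [o] as
   a gradient lets [dirichlet_comb] absorb it; each of the two components contributes 2 M^2 w^2,
   hence the 4. *)
pose w : P2 -> R := v \_ S; pose o : P2 -> R := cst 0.
have mw : mfun O w.
  have := (@measurable_restrict _ _ M2 _ S O v mS mO).1.
  rewrite (_ : O `&` S = S); last by apply/seteqP; split => z; [case|move=> Sz; split=> //; exact: SO].
  by apply; exact: (measurable_funS mO SO mv).
have Ew : dirichlet O w o = (\int[mu]_(z in S) (v z ^+ 2)%:E)%E.
  rewrite /dirichlet (integral_support SO).
    by apply: eq_integral => z Sz; rewrite /w /o patchT// expr0n addr0.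
  by move=> z _ nS; rewrite /w /o patchN ?notin_setE// expr0n addr0.
have Dk : (dirichlet O k1 k2 <= 2%:E * dirichlet O g1 g2 + (4 * M ^+ 2)%:E * dirichlet O w o)%E.
  have M4 : 0 <= 4 * M ^+ 2 by rewrite mulr_ge0// sqr_ge0.
  have m0 : mfun O o by exact: measurable_cst.
  apply: (@dirichlet_comb _ O 2 (4 * M ^+ 2) g1 g2 w o k1 k2 mO (ler0n _ 2) M4
    m1 m2 mw m0 mk1 mk2) => z Oz.
  have bd x : `|'D_x eta z| <= M -> forall g, (eta z * g z + 'D_x eta z * v z) ^+ 2 <=
      2 * g z ^+ 2 + 2 * M ^+ 2 * w z ^+ 2.
    move=> hM g; have [Sz|nSz] := pselect (S z).
      by rewrite /w patchT ?inE//; exact: sqr_gradient_mul.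
    rewrite Deta (derive_support _ cS tS nSz) /eta (tS nSz) subr0 mul1r oppr0 mul0r addr0.
    have := sqr_ge0 (g z); have := mulr_ge0 (sqr_ge0 M) (sqr_ge0 (w z)); lra.
  have h1 : `|'D_(1, 0) eta z| <= M by rewrite Deta normrN; exact: (HM z).1.
  have h2 : `|'D_(0, 1) eta z| <= M by rewrite Deta normrN; exact: (HM z).2.
  have := lerD (bd _ h1 g1) (bd _ h2 g2); rewrite /k1 /k2 /= => /le_trans; apply.
  by rewrite le_eqVlt; apply/orP; left; apply/eqP; rewrite /o /=; ring.
have Ek : (dirichlet O k1 k2 <= ((2 + 4 * M ^+ 2 * C) * fine (dirichlet O g1 g2))%:E)%E.
  apply: (le_trans Dk); rewrite Ew; set E := fine _.
  have -> : ((2 + 4 * M ^+ 2 * C) * E)%:E = ((2 * E)%:E + (4 * M ^+ 2)%:E * (C * E)%:E)%E.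
    by rewrite -EFinM -EFinD; congr EFin; ring.
  apply: leeD; first by rewrite (adm_fin H) -/E EFinM.
  apply: lee_wpmul2l; first by rewrite lee_fin mulr_ge0// sqr_ge0.
  exact: HC (adm_fe H) (adm_zero F2O H).
exists k1, k2, (eta \* v); split; last first.
  rewrite -lee_fin fineK//; rewrite ge0_fin_numE; last exact: dirichlet_ge0.
  by apply: le_lt_trans Ek _; rewrite ltry.
split.
  move=> z; apply: cvgM; last exact: cv.
  have : {within O, continuous eta} by apply: continuous_subspaceT; exact: Cn_continuous (Ceta 0%N).
  exact.
split; first by move=> z Oz; rewrite mulr_ge0 ?v0//; case/andP: (eta01 z).
split; first exact: wg'.
split; first by apply: le_lt_trans Ek _; rewrite ltry.
split.
  exists W; do 2 (split => //).
  by move=> z Wz _; rewrite /eta /= tW// subrr mul0r.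
exists (U `&` ~` S); split.
  by apply: openI => //; apply: closed_openC; exact: compact_closed2.
split; last by move=> z [Uz nSz] Oz; rewrite /eta /= tS// subr0 mul1r; exact: HU.
move=> z lz; split; first exact: lU.
by move=> Sz; have : (l `&` S) z by []; rewrite lS.
Qed.

End CaseA.

Lemma weight_le_of_avoid (O F1 V1 F2 V2 : set P2) (theta : P2 -> R) (S W : set P2) :
  domain O -> cap_pair O F1 V1 -> cap_pair O F2 V2 ->
  (forall n, Cn n theta) -> (forall z, 0 <= theta z <= 1) ->
  open W -> V1 `<=` W -> V2 `<=` W -> (forall z, W z -> theta z = 1) ->
  compact S -> S `<=` O -> (forall z, ~ S z -> theta z = 0) ->
  exists2 K, 0 < K & forall l, l `&` S = set0 -> weight O F1 V1 l <= K * weight O F2 V2 l.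
Proof.
move=> dO cp1 cp2 Ct t01 oW V1W V2W tW cS SO tS.
have [oO [cO _]] := dO.
have [_ [_ [_ [F1V1 _]]]] := cp1; have [cF2 [F2O _]] := cp2.
have PS := poincare_compact oO cO cF2 F2O cS SO.
have WS : W `<=` S.
  by move=> z Wz; apply: contrapT => nS; have := tW z Wz; rewrite tS// => /eqP; rewrite eq_sym oner_eq0.
have [K K0 HK] := cut_adm (F1 := F1) oO F2O Ct t01 oW (subset_trans F1V1 V1W) tW cS SO tS PS.
(* The 1 makes the constant positive even when [K] is 0. *)
exists (Num.sqrt (K + 1)); first by rewrite sqrtr_gt0 ltr_wpDl.
move=> l lS.
have disj V : V `<=` W -> l `&` V = set0.
  by move=> VW; rewrite -subset0 -lS => z [lz /VW/WS Sz].
have minus V : V `<=` W -> l `\` V = l.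
  move=> VW; apply/seteqP; split => z; first by case.
  by move=> lz; split=> // Vz; have : (l `&` V) z by []; rewrite disj.
rewrite /weight !minus// !disj// !(cap_set0 _ oO).2 sqrtr0 !addr0.
rewrite -sqrtrM; last by rewrite addr_ge0.
have [C2 adm2] := adm_out dO cp2.
have ex2 : adm_exists F2 l O by have [] := adm2 l; rewrite minus.
apply: ler_wsqrtr.
have [h|h] := ltP 0 (K + 1); last by lra.
rewrite mulrC -ler_pdivrMr//; apply: le_cap => // v g1 g2 H.
rewrite ler_pdivrMr// mulrC.
have [k1 [k2 [u [Hu Eu]]]] := HK l v g1 g2 lS H.
apply: (le_trans (cap_le Hu)); apply: (le_trans Eu).
by rewrite ler_wpM2r ?lerDl//; exact: fine_ge0 (dirichlet_ge0 _ _ _).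
Qed.

Section CaseB.
Variables (O W2 : set P2) (C : R) (v g1 g2 : P2 -> R).
Hypotheses (oO : open O).
Hypotheses (fe : finite_energy O v g1 g2) (W2O : W2 `<=` O) (mW2 : mset W2).
Hypothesis HC : (\int[mu]_(z in W2) (v z ^+ 2)%:E <= (C * fine (dirichlet O g1 g2))%:E)%E.

Lemma cross_sq (a b c d : R) : `[a, b] `*` `[c, d] `<=` W2 ->
  \int[mu]_(z in `[a, b] `*` `[c, d]) (v z ^+ 2) <= C * fine (dirichlet O g1 g2).
Proof.
move=> QW; have mQ := rect_measurable a b c d.
have i := sq_integrable2 (fe_acl2 oO fe (subset_trans QW W2O)).
rewrite -lee_fin /Rintegral fineK; last exact: integrable_fin_num.
apply: le_trans HC; apply: ge0_subset_integral => //.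
  exact: (@sq_mfun R O oO W2 v g1 g2 W2O fe).
by move=> z _; rewrite lee_fin sqr_ge0.
Qed.

(** Both terms of [crossing] are bounded by the energy, the square of [v] through the Poincare
    inequality on [W2]; the lower bound depends on the rectangle only through its side lengths. *)
Lemma cross_lb2 (a b c d : R) : a < b -> c < d -> `[a, b] `*` `[c, d] `<=` W2 ->
  (forall x, a <= x <= b -> exists2 s, c <= s <= d & 1 <= v (x, s)) ->
  (b - a) * (d - c) <= (2 * C + 2 * (d - c) ^+ 2) * fine (dirichlet O g1 g2).
Proof.
move=> ab cd QW H; have QO := subset_trans QW W2O.
have := crossing ab cd (fe_acl2 oO fe QO) H.
have h1 := cross_sq QW.
have [_ h2] := energy_sub oO fe (or_intror erefl) (rect_measurable a b c d) QO.
have h3 : 2 * (d - c) ^+ 2 * \int[mu]_(z in `[a, b] `*` `[c, d]) (g2 z ^+ 2) <=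
    2 * (d - c) ^+ 2 * fine (dirichlet O g1 g2) by rewrite ler_wpM2l// mulr_ge0// sqr_ge0.
by move=> h; rewrite [leRHS]mulrDl; apply: (le_trans h); apply: lerD => //; rewrite -mulrA ler_wpM2l.
Qed.

Lemma cross_lb1 (a b c d : R) : a < b -> c < d -> `[a, b] `*` `[c, d] `<=` W2 ->
  (forall y, c <= y <= d -> exists2 s, a <= s <= b & 1 <= v (s, y)) ->
  (d - c) * (b - a) <= (2 * C + 2 * (b - a) ^+ 2) * fine (dirichlet O g1 g2).
Proof.
move=> ab cd QW H; have QO := subset_trans QW W2O.
have [mv m1 _] := fe_meas fe; have mO := open_measurable2 oO.
have := crossing cd ab (fe_acl1 oO fe QO) H.
rewrite !swap_sq_int//; try exact: seg_measurable; try exact: (measurable_funS mO QO).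
have h1 := cross_sq QW.
have [_ h2] := energy_sub oO fe (or_introl erefl) (rect_measurable a b c d) QO.
have h3 : 2 * (b - a) ^+ 2 * \int[mu]_(z in `[a, b] `*` `[c, d]) (g1 z ^+ 2) <=
    2 * (b - a) ^+ 2 * fine (dirichlet O g1 g2) by rewrite ler_wpM2l// mulr_ge0// sqr_ge0.
by move=> h; rewrite [leRHS]mulrDl; apply: (le_trans h); apply: lerD => //; rewrite -mulrA ler_wpM2l.
Qed.

End CaseB.
End Comparison.

(** * How a curve enters a compact set *)

Section Hitting.
Context {R : realType}.
Notation P2 := (R * R)%type.

Lemma compact_Rmax (A : set R) : compact A -> A !=set0 -> exists2 m, A m & forall t, A t -> t <= m.
Proof.
move=> cA A0; have cid : {within A, continuous (id : R -> R)}.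
  by apply: continuous_subspaceT => t; exact: cvg_id.
have [m /set_mem Am H] := compact_EVT_max A0 cA cid.
by exists m => // t At; apply: H; rewrite inE.
Qed.

Lemma compact_Rmin (A : set R) : compact A -> A !=set0 -> exists2 m, A m & forall t, A t -> m <= t.
Proof.
move=> cA A0; have cid : {within A, continuous (id : R -> R)}.
  by apply: continuous_subspaceT => t; exact: cvg_id.
have [m /set_mem Am H] := compact_EVT_min A0 cA cid.
by exists m => // t At; apply: H; rewrite inE.
Qed.

(* Only half of the range is kept, so that each value is taken strictly before
   time t1, the time at which the curve enters S. *)
Lemma seg_hit (h : R -> R) (t0 t1 r : R) : continuous h -> 0 < r -> t0 <= t1 ->
  `|h t0 - h t1| = r -> exists a, [/\ h t1 - r <= a, a + r / 2 <= h t1 + r &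
    forall u, a <= u <= a + r / 2 -> exists2 t, t0 <= t < t1 & h t = u].
Proof.
move=> ch r0 t01 hr.
have hit u : u != h t1 -> Num.min (h t0) (h t1) <= u <= Num.max (h t0) (h t1) ->
    exists2 t, t0 <= t < t1 & h t = u.
  move=> ut Hu; have [t] := IVT t01 (continuous_subspaceT ch) Hu.
  rewrite in_itv /= => /andP[t0t tt1] htu; exists t => //.
  rewrite t0t lt_neqAle tt1 andbT; apply: contra ut => /eqP <-.
  by rewrite htu.
have [le|lt] := leP (h t1) (h t0).
  move: hr; rewrite ger0_norm ?subr_ge0// => hr.
  exists (h t1 + r / 2); split; try lra.
  move=> u /andP[u1 u2]; apply: hit; first by rewrite gt_eqF//; lra.
  by rewrite min_r// max_l//; lra.
move: hr; rewrite ltr0_norm ?subr_lt0// => hr.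
exists (h t1 - r); split; try lra.
move=> u /andP[u1 u2]; apply: hit; first by rewrite lt_eqF//; lra.
by rewrite min_l ?max_r ?(ltW lt)//; lra.
Qed.

Lemma last_exit (c : R -> P2) (t1 r : R) : continuous c -> 0 < r -> 0 <= t1 ->
  ~ box (c t1) r (c 0) -> exists t0, [/\ 0 <= t0 <= t1,
    forall t, t0 <= t <= t1 -> box (c t1) r (c t) &
    `|(c t0).1 - (c t1).1| = r \/ `|(c t0).2 - (c t1).2| = r].
Proof.
move=> cc r0 t10 out; set p := c t1.
pose m t := Num.max `|(c t).1 - p.1| `|(c t).2 - p.2|.
have mE t : box p r (c t) <-> m t <= r.
  by rewrite /m ge_max; split => [/boxP[-> ->]//|/andP[h1 h2]]; apply/boxP.
have cm : continuous m.
  have c1 : continuous (fun t => `|(c t).1 - p.1|).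
    move=> t; apply: cvg_norm; apply: cvgB; last exact: cvg_cst.
    exact: (continuous_comp (cc t) (@cvg_fst _ _ _ _ _)).
  have c2 : continuous (fun t => `|(c t).2 - p.2|).
    move=> t; apply: cvg_norm; apply: cvgB; last exact: cvg_cst.
    exact: (continuous_comp (cc t) (@cvg_snd _ _ _ _ _)).
  move=> t; exact: (continuous_max (c1 t) (c2 t)).
have m0 : r < m 0 by rewrite ltNge; apply/negP => /mE.
have mt1 : m t1 = 0 by rewrite /m /p !subrr normr0 maxxx.
pose A : set R := `[0, t1]%classic `&` [set t | m t = r].
have cA : compact A.
  apply: compact_closedI; first exact: segment_compact.
  apply: (@preimage_closed _ _ m [set r]); first by move=> t _; exact: cm.
  exact: closed_eq.
have [t0 [/= + mt0] tmax] : exists2 t0, A t0 & forall t, A t -> t <= t0.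
  apply: compact_Rmax => //.
  have [|t] := @IVT _ m 0 t1 r t10 (continuous_subspaceT cm).
    by rewrite mt1 min_r ?max_l ?(ltW r0) ?(ltW m0)// (ltW (lt_trans r0 m0)).
  by move=> tt mt; exists t; split.
rewrite in_itv /= => t0t1; exists t0; split=> //; last first.
  by move: mt0; rewrite /m /Num.max; case: ifP => _ <-; [right|left].
move=> t /andP[t0t tt1]; apply/mE; rewrite leNgt; apply/negP => rt.
have [|s] := @IVT _ m t t1 r tt1 (continuous_subspaceT cm).
  by rewrite mt1 min_r ?max_l ?(ltW r0) ?(ltW rt)// (ltW (lt_trans r0 rt)).
rewrite in_itv /= => /andP[ts st1] ms.
have st0 : s <= t0.
  apply: tmax; split=> //=; rewrite in_itv /= st1 andbT.
  by case/andP: t0t1 => h _; exact: le_trans (le_trans h t0t) ts.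
have tE : t = t0 by apply/eqP; rewrite eq_le t0t (le_trans ts st0).
by move: rt; rewrite tE mt0 ltxx.
Qed.

Lemma first_hit (c : R -> P2) (S : set P2) : continuous c -> compact S ->
  (exists2 t, 0 <= t <= 1 & S (c t)) ->
  exists t1, [/\ 0 <= t1 <= 1, S (c t1) & forall t, 0 <= t < t1 -> ~ S (c t)].
Proof.
move=> cc cS [t t01 St].
pose A : set R := `[0, 1]%classic `&` (c @^-1` S).
have cA : compact A.
  apply: compact_closedI; first exact: segment_compact.
  apply: preimage_closed; first by move=> s _; exact: cc.
  exact: compact_closed2.
have [t1 [/= + St1] tmin] : exists2 t1, A t1 & forall t, A t -> t1 <= t.
  by apply: compact_Rmin => //; exists t; split=> //=; rewrite in_itv.
rewrite in_itv /= => /andP[t1_0 t1_1]; exists t1; split=> //; first by rewrite t1_0.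
move=> s /andP[s0 st1] Ss; have : t1 <= s.
  by apply: tmin; split=> //=; rewrite in_itv /= s0 (le_trans (ltW st1)).
by rewrite leNgt st1.
Qed.

Lemma seq_min_pos (s : seq P2) (r : P2 -> R) : (forall w, w \in s -> 0 < r w) ->
  exists2 m, 0 < m & forall w, w \in s -> m <= r w.
Proof.
elim: s => [|w s IH] H; first by exists 1.
have [|m m0 Hm] := IH; first by move=> z zs; apply: H; rewrite inE zs orbT.
exists (Num.min (r w) m); first by rewrite lt_min m0 H// inE eqxx.
move=> z; rewrite inE => /orP[/eqP ->|zs]; first by rewrite ge_min lexx.
by rewrite ge_min (Hm z zs) orbT.
Qed.

Lemma lebesgue_number (S U : set P2) : compact S -> open U -> S `<=` U ->
  exists2 r, 0 < r & forall p, S p -> box p r `<=` U.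
Proof.
move=> cS oU SU.
have /choice[r Hr] : forall z, exists r, U z -> 0 < r /\ box z (2 * r) `<=` U.
  move=> z; have [Uz|nUz] := pselect (U z); last by exists 0.
  have [r r0 H] := open_box oU Uz; exists (r / 2) => _; split; first by rewrite divr_gt0.
  by rewrite mulrC divfK.
have [s [sS cov]] := compact_box_cover cS (fun z Sz => (Hr z (SU z Sz)).1).
have [m m0 Hm] := seq_min_pos (fun w ws => (Hr w (SU w (sS w ws))).1).
exists m => // p /cov[w ws /ball_box /boxP[p1 p2]] z /boxP[z1 z2].
apply: (Hr w (SU w (sS w ws))).2; have mr := Hm w ws; apply/boxP; split.
  by move: p1 z1; rewrite !ler_norml; lra.
by move: p2 z2; rewrite !ler_norml; lra.
Qed.

End Hitting.

(** * The comparison outside a compact set and the passage to limits *)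

Section Main.
Context {R : realType}.
Notation P2 := (R * R)%type.
Notation mu := (@leb2 R).

(** The rectangle crossed has side r/2 in the direction in which the curve moves, as given by
    [seg_hit], and the full side 2 r of the box in the other. *)
Lemma rect_const (r C E : R) : 0 < r -> 0 <= C ->
  r / 2 * (2 * r) <= (2 * C + 2 * (2 * r) ^+ 2) * E -> r ^+ 2 / (2 * C + 8 * r ^+ 2) <= E.
Proof.
move=> r0 C0 H; have r20 : 0 < r ^+ 2 by rewrite exprn_gt0.
rewrite ler_pdivrMr; last by rewrite ltr_wpDl ?mulr_gt0 ?mulr_ge0.
move: H; have -> : r / 2 * (2 * r) = r ^+ 2 by field.
by have -> : (2 * C + 2 * (2 * r) ^+ 2) * E = E * (2 * C + 8 * r ^+ 2) by ring.
Qed.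

(** Before its first point in [S] the curve crosses a box of radius [r] centred at that point. That
    piece avoids [V], so every admissible function is at least 1 on it, and the crossing estimate
    applies. *)
Lemma cap_ge_of_hit (O F V S W2 : set P2) (r : R) : domain O -> cap_pair O F V ->
  V `<=` S -> compact S -> compact W2 -> W2 `<=` O -> 0 < r ->
  (forall p, S p -> box p r `<=` W2) ->
  exists2 k, 0 < k & forall x y c, rect_curve O x y c -> ~ W2 x ->
    (exists2 z, (c @` (@I01 R)) z & S z) -> k <= cap F ((c @` (@I01 R)) `\` V) O.
Proof.
move=> dO cp VS cS cW WO r0 HW; have [oO [cO _]] := dO; have [cF [FO _]] := cp.
have [mW _ [C C0 HC]] := poincare_compact oO cO cF FO cW WO.
exists (r ^+ 2 / (2 * C + 8 * r ^+ 2)).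
  by rewrite divr_gt0 ?exprn_gt0// ltr_wpDl ?mulr_gt0 ?mulr_ge0 ?exprn_gt0.
move=> x y c Hc nWx hitS; have [cb Eim] := rect_curve_clamp Hc.
have [_ [c0 [_ [cO' _]]]] := Hc.
have [C2 adm2] := adm_out dO cp.
apply: le_cap; first exact: (adm2 _).1.
move=> v g1 g2 H; set E := fine _; set b := c \o clamp in cb Eim.
have b0 : b 0 = x by rewrite /b /= clamp_id ?lexx ?ler01.
have [t1 [/andP[t10 t11] St1 Hfirst]] : exists t1, [/\ 0 <= t1 <= 1, S (b t1) & forall t, 0 <= t < t1 -> ~ S (b t)].
  apply: first_hit => //; have [z [t t01 <-] Sz] := hitS.
  by exists t => //; rewrite /b /= clamp_id.
(* The box centred at the first hitting point lies in [W2], whereas the curve starts outside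
   [W2]. *)
have out : ~ box (b t1) r (b 0) by move=> /(HW _ St1); rewrite b0.
have [t0 [/andP[t00 t01] Hbox Hr]] := last_exit cb r0 t10 out.
have fe := adm_fe H.
have Hv : (\int[mu]_(z in W2) (v z ^+ 2)%:E <= (C * E)%:E)%E.
  exact: HC fe (adm_zero FO H).
(* Strictly before [t1] the curve is outside [S], hence outside [V], and its points count in the
   capacity; at [t1] itself this may fail. *)
have v1 t : t0 <= t < t1 -> 1 <= v (b t).
  move=> /andP[t0t tt1]; apply: (adm_ge1 _ H); first by move=> z [/cO'].
  have t0' : 0 <= t by exact: le_trans t0t.
  split; last by move=> /VS; apply: Hfirst; rewrite t0'.
  by rewrite -Eim; exists t => //; rewrite /I01 /= t0' (le_trans (ltW tt1)).
have inW t : t0 <= t < t1 -> box (b t1) r (b t).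
  by move=> /andP[t0t tt1]; apply: Hbox; rewrite t0t ltW.
have bW := HW _ St1.
have rr : 0 < r / 2 by rewrite divr_gt0.
case: Hr => Hr.
  have cfst : continuous (fun t => (b t).1).
    by move=> t; exact: (continuous_comp (cb t) (@cvg_fst _ _ _ _ _)).
  have [a [a1 a2 Ha]] := seg_hit cfst r0 t01 Hr.
  have := @cross_lb2 _ O W2 C v g1 g2 oO fe WO mW Hv a (a + r / 2) ((b t1).2 - r) ((b t1).2 + r).
  rewrite (_ : a + r / 2 - a = r / 2); last by ring.
  rewrite (_ : (b t1).2 + r - ((b t1).2 - r) = 2 * r); last by ring.
  move=> K; apply: (rect_const r0 C0); apply: K.
  - by rewrite ltrDl.
  - exact: sub_lt.
  - move=> z [z1 z2]; apply: bW; split=> //; move: z1; rewrite /= !in_itv /= => /andP[h1 h2].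
    by rewrite (le_trans a1 h1) (le_trans h2 a2).
  - move=> u /Ha[t tt <-]; exists (b t).2.
      by have /boxP[_] := inW t tt; rewrite ler_distl.
    by rewrite -surjective_pairing; exact: v1.
have csnd : continuous (fun t => (b t).2).
  by move=> t; exact: (continuous_comp (cb t) (@cvg_snd _ _ _ _ _)).
have [a [a1 a2 Ha]] := seg_hit csnd r0 t01 Hr.
have := @cross_lb1 _ O W2 C v g1 g2 oO fe WO mW Hv ((b t1).1 - r) ((b t1).1 + r) a (a + r / 2).
rewrite (_ : a + r / 2 - a = r / 2); last by ring.
rewrite (_ : (b t1).1 + r - ((b t1).1 - r) = 2 * r); last by ring.
move=> K; apply: (rect_const r0 C0); apply: K.
- exact: sub_lt.
- by rewrite ltrDl.
- move=> z [z1 z2]; apply: bW; split=> //; move: z2; rewrite /= !in_itv /= => /andP[h1 h2].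
  by rewrite (le_trans a1 h1) (le_trans h2 a2).
- move=> u /Ha[t tt <-]; exists (b t).1.
    by have /boxP[] := inW t tt; rewrite ler_distl.
  by rewrite -surjective_pairing; exact: v1.
Qed.

(** Two nested cutoffs are used: one with support [S] around the closures of [V1] and [V2], the
    other to place a neighbourhood [U] of [S] inside [S2]. The Lebesgue number of [S] in [U] is the
    radius of the boxes to be crossed. The constant is the sum of those of the two cases. *)
Lemma comparison (O F1 V1 F2 V2 : set P2) : domain O -> cap_pair O F1 V1 -> cap_pair O F2 V2 ->
  exists W K, [/\ compact W, W `<=` O, 0 < K & forall x y, O x -> O y -> ~ W x ->
    rho O F1 V1 x y <= K * rho O F2 V2 x y].
Proof.
move=> dO cp1 cp2; have oO := dO.1.
have [_ [_ [_ [_ [cV1 [V1O _]]]]]] := cp1; have [_ [_ [_ [_ [cV2 [V2O _]]]]]] := cp2.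
have cV : compact (closure V1 `|` closure V2) by exact: compactU.
have VO : closure V1 `|` closure V2 `<=` O by rewrite subUset.
have [theta [S [W [Ct t01 [oW [VW tW]] [cS [SO tS]]]]]] := cutoff cV oO VO.
have V1W : V1 `<=` W by move=> z Vz; apply: VW; left; exact: subset_closure.
have V2W : V2 `<=` W by move=> z Vz; apply: VW; right; exact: subset_closure.
have WS : W `<=` S.
  by move=> z Wz; apply: contrapT => nS; have := tW z Wz; rewrite tS// => /eqP; rewrite eq_sym oner_eq0.
have [th [S2 [U [_ _ [oU [SU tU]] [cS2 [S2O tS2]]]]]] := cutoff cS oO SO.
have US2 : U `<=` S2.
  by move=> z Wz; apply: contrapT => nS; have := tU z Wz; rewrite tS2// => /eqP; rewrite eq_sym oner_eq0.
have [r r0 Hr] := lebesgue_number cS oU SU.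
have [k k0 Hk] := cap_ge_of_hit dO cp2 (subset_trans V2W WS) cS cS2 S2O r0
  (fun p Sp => subset_trans (Hr p Sp) US2).
have [K K0 HK] := weight_le_of_avoid dO cp1 cp2 Ct t01 oW V1W V2W tW cS SO tS.
have [C C0 HC] := weight_bounded dO cp1.
have sk : 0 < Num.sqrt k by rewrite sqrtr_gt0.
have CK : 0 <= C / Num.sqrt k by rewrite divr_ge0// ltW.
have K'0 : 0 < K + C / Num.sqrt k by rewrite ltr_wpDr.
exists S2, (K + C / Num.sqrt k); split=> // x y Ox Oy nx.
rewrite mulrC -ler_pdivrMr//; apply: (le_rho dO) => // c Hc.
rewrite ler_pdivrMr// mulrC; apply: (le_trans (rho_le _ _ Hc)).
set l := c @` _; have w2 := weight_ge0 O F2 V2 l.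
have [lS|/set0P[z [lz Sz]]] := eqVneq (l `&` S) set0.
  by apply: (le_trans (HK l lS)); rewrite ler_wpM2r// lerDl.
apply: (le_trans (HC l)); apply: (@le_trans _ _ (C / Num.sqrt k * weight O F2 V2 l)).
  (* [C] bounds the first weight of any curve, and the square root of [k] is at most the second
     weight of a curve that meets [S]. *)
  rewrite mulrAC ler_pdivlMr// ler_pM2l//.
  apply: (@le_trans _ _ (Num.sqrt (cap F2 (l `\` V2) O))); last by rewrite /weight lerDl sqrtr_ge0.
  by apply: ler_wsqrtr; apply: (Hk x y c Hc nx); exists z.
by rewrite ler_wpM2r// lerDr ltW.
Qed.

Section Seq.
Variables (O F V : set P2).
Hypotheses (dO : domain O) (cp : cap_pair O F V).

(** If the sequence kept returning to every ball around a point [a] of [W], it would, being Cauchy,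
    converge to [a] for [rho], which a boundary sequence does not do. So some ball around each point
    is left for good, and finitely many such balls cover [W]. *)
Lemma boundary_seq_leaves (x : nat -> P2) (W : set P2) : boundary_seq O F V x ->
  compact W -> W `<=` O -> exists N, forall n, (N <= n)%N -> ~ W (x n).
Proof.
move=> [[xO cx] nc] cW WO.
have loc a : W a -> exists d N, 0 < d /\ forall n, (N <= n)%N -> ~ ball a d (x n).
  move=> Wa; apply: contrapT => H; apply: nc; exists a; split; first exact: WO.
  apply/cvgrPdist_lt => e e0; have e2 : 0 < e / 2 by rewrite divr_gt0.
  have [N HN] := cx _ e2; have [d d0 Hd] := rho_small dO cp (WO a Wa) e2.
  have [n Nn xn] : exists2 n, (N <= n)%N & ball a d (x n).
    apply: contrapT => H'; apply: H; exists d, N; split=> // n Nn Bn.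
    by apply: H'; exists n.
  exists N => // m /= Nm; rewrite sub0r normrN ger0_norm; last exact: (rho_ge0 _ _ dO (xO m) (WO a Wa)).
  have h1 := HN m n Nm Nn; have [_ h2] := Hd _ xn.
  have h3 := rho_triangle dO cp (xO m) (xO n) (WO a Wa); lra.
have /choice[d Hd] : forall a, exists d, W a -> exists N, 0 < d /\ forall n, (N <= n)%N -> ~ ball a d (x n).
  move=> a; have [Wa|nWa] := pselect (W a); last by exists 0.
  by have [d H] := loc a Wa; exists d.
have [s [sW cov]] := compact_box_cover cW (fun a Wa => let: ex_intro _ H := Hd a Wa in H.1).
have [N HN] : exists N, forall a, a \in s -> forall n, (N <= n)%N -> ~ ball a (d a) (x n).
  elim: s sW {cov} => [|a s IH] sW; first by exists 0%N.
  have [|N HN] := IH; first by move=> b bs; apply: sW; rewrite inE bs orbT.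
  have [N' [_ HN']] := Hd a (sW a (mem_head _ _)).
  exists (maxn N N') => b; rewrite inE => /orP[/eqP -> n|bs n]; rewrite geq_max => /andP[h1 h2].
    exact: HN'.
  exact: HN.
by exists N => n Nn /cov[a as_]; exact: HN.
Qed.

(** The extension of [rho] to pairs of Cauchy sequences: by the triangle inequality the values along
    the two sequences are themselves Cauchy. *)
Lemma rho_cvg (x y : nat -> P2) : rho_cauchy O F V x -> rho_cauchy O F V y ->
  exists2 l : R, 0 <= l & (fun n => rho O F V (x n) (y n)) @ \oo --> l.
Proof.
move=> [xO cx] [yO cy]; pose a n := rho O F V (x n) (y n).
have : cvg (a @ \oo).
  apply: cauchy_cvg; apply: cauchy_exP => e e0; have e2 : 0 < e / 2 by rewrite divr_gt0.
  have [N1 H1] := cx _ e2; have [N2 H2] := cy _ e2.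
  exists (a (maxn N1 N2)); exists (maxn N1 N2) => // n /=.
  set m := maxn N1 N2 => mn; have mm : (m <= m)%N by [].
  have [m1 m2] : (N1 <= m)%N /\ (N2 <= m)%N by rewrite leq_maxl leq_maxr.
  have n1 := leq_trans m1 mn; have n2 := leq_trans m2 mn.
  rewrite /ball /= ltr_distl /a.
  have h1 := rho_triangle dO cp (xO m) (xO n) (yO m).
  have h2 := rho_triangle dO cp (xO n) (yO n) (yO m).
  have h3 := rho_triangle dO cp (xO n) (xO m) (yO n).
  have h4 := rho_triangle dO cp (xO m) (yO m) (yO n).
  have k1 := H1 m n m1 n1; have k2 := H1 n m n1 m1.
  have k3 := H2 m n m2 n2; have k4 := H2 n m n2 m2.
  by apply/andP; split; lra.
move=> ca; exists (lim (a @ \oo)); last exact: ca.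
have := @ler_cvg_to _ (\oo : set_system nat) _ R (cst 0) a 0 _ (@cvg_cst _ _ _ _ _) ca.
by apply; apply: nearW => n; exact: rho_ge0.
Qed.

End Seq.

End Main.

(** Points of H_rho are given by representatives for the first metric, and [d1], [d2] are the values
    of the two extended metrics. The existence of [d2] relies on these sequences being Cauchy for
    the second metric as well. *)
Theorem theorem2p8 (R : realType) (O F1 V1 F2 V2 : set (R * R)) :
  domain O -> cap_pair O F1 V1 -> cap_pair O F2 V2 ->
  exists K : R, 0 < K /\
    forall x y : nat -> R * R,
      boundary_seq O F1 V1 x -> boundary_seq O F1 V1 y ->
      exists d1 d2 : R,
        (fun n => rho O F1 V1 (x n) (y n)) @ \oo --> d1 /\
        (fun n => rho O F2 V2 (x n) (y n)) @ \oo --> d2 /\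
        d2 / K <= d1 /\ d1 <= K * d2.
Proof.
move=> dO cp1 cp2.
have [W [K [cW WO K0 HK]]] := comparison dO cp1 cp2.
have [W' [K' [cW' WO' K0' HK']]] := comparison dO cp2 cp1.
exists (K + K'); split; first exact: addr_gt0.
move=> x y bx by_.
(* Once [z] has left W', the second metric is at most K' times the first along the sequence, so the
   Cauchy property is transferred. *)
have cauchy2 z : boundary_seq O F1 V1 z -> rho_cauchy O F2 V2 z.
  move=> bz; have [N HN] := boundary_seq_leaves dO cp1 bz cW' WO'.
  have [[zO cz] _] := bz; split=> // e e0.
  have [N' HN'] := cz (e / K') (divr_gt0 e0 K0').
  exists (maxn N N') => m n; rewrite !geq_max => /andP[m1 m2] /andP[n1 n2].
  apply: (le_lt_trans (HK' _ _ (zO m) (zO n) (HN m m1))).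
  by rewrite mulrC -ltr_pdivlMr//; exact: HN'.
have [d1 d10 c1] := rho_cvg dO cp1 bx.1 by_.1.
have [d2 d20 c2] := rho_cvg dO cp2 (cauchy2 x bx) (cauchy2 y by_).
have [[[xO _] _] [[yO _] _]] := (bx, by_).
have [N HN] := boundary_seq_leaves dO cp1 bx cW WO.
have [N' HN'] := boundary_seq_leaves dO cp1 bx cW' WO'.
(* [comparison] asks only one endpoint to lie outside the compact set, so it is enough that [x]
   leaves it. *)
have h1 : d1 <= K * d2.
  have Kc : (fun n => K * rho O F2 V2 (x n) (y n)) @ \oo --> K * d2 by exact: cvgMl_tmp c2.
  apply: (ler_cvg_to c1 Kc); exists N => // n /= Nn.
  by apply: HK => //; exact: HN.
have h2 : d2 <= K' * d1.
  have Kc : (fun n => K' * rho O F1 V1 (x n) (y n)) @ \oo --> K' * d1 by exact: cvgMl_tmp c1.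
  apply: (ler_cvg_to c2 Kc); exists N' => // n /= Nn.
  by apply: HK' => //; exact: HN'.
exists d1, d2; do 2 (split=> //); split.
  rewrite ler_pdivrMr ?addr_gt0// mulrC; apply: (le_trans h2).
  by rewrite ler_wpM2r// lerDr ltW.
by apply: (le_trans h1); rewrite ler_wpM2r// lerDl ltW.
Qed.
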